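(* (1) For a generic value of the parameter, the Temperley-Lieb category has no non-zero proper ideal. That is: the category $\mathrm{TL}$ over $\mathbb{C}(t)$, with $t$ an indeterminate and loop parameter $d=t+t^{-1}$, has no non-zero proper ideal; and for every $\tau\in\mathbb{C}\setminus\{0\}$ that is not a proper root of unity, the category $\mathrm{TL}(\tau)$ over $\mathbb{C}$, with loop parameter $d=\tau+\tau^{-1}$, has no non-zero proper ideal. (2) If the loop parameter is $d=2\cos(\pi/n)$ for some integer $n\ge 3$ (i.e. $d=\tau+\tau^{-1}$ with $\tau=e^{\pm i\pi/n}$), then the Temperley-Lieb category $\mathrm{TL}(\tau)$ over $\mathbb{C}$ has exactly one non-zero proper ideal, namely the ideal of negligible morphisms.
   Context: Diagrams. For $m,n\in\mathbb{N}_0=\{0,1,2,\dots\}$ with $n-m$ even, an $(m,n)$-TL diagram is a rectangle with $m$ marked points on its top edge and $n$ marked points on its bottom edge, together with $(m+n)/2$ pairwise non-intersecting smooth curves (strands) in the rectangle, each meeting the boundary exactly in its two endpoints, which are marked points. Diagrams are considered up to equivalence: two are equivalent if they induce the same pairing of the $m+n$ marked points (so a diagram is a non-crossing perfect matching of the $m+n$ boundary points). The category. Let $K$ be a field and $d\in K$. The Temperley-Lieb category over $K$ with loop parameter $d$ is the strict tensor category with objects the elements of $\mathbb{N}_0$; $\mathrm{Hom}(m,n)$ is the $K$-vector space with basis the $(m,n)$-TL diagrams if $n-m$ is even, and is $0$ if $n-m$ is odd. The composition $ba$ of an $(m,n)$-diagram $b$ with an $(\ell,m)$-diagram $a$ is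 obtained by gluing the bottom edge of $a$ to the top edge of $b$, removing the closed loops that arise, say $r$ of them, to get an $(\ell,n)$-diagram $c$, and setting $ba=d^{r}c$; this is extended bilinearly. The tensor product is $n\otimes n'=n+n'$ on objects and horizontal juxtaposition of diagrams (extended bilinearly) on morphisms. $\mathrm{TL}$ denotes the case $K=\mathbb{C}(t)$, $t$ an indeterminate, $d=t+t^{-1}$. For $\tau\in\mathbb{C}\setminus\{0\}$, $\mathrm{TL}(\tau)$ denotes the case $K=\mathbb{C}$, $d=\tau+\tau^{-1}$. A proper root of unity is a root of unity $\tau$ with $\tau\neq\pm1$ (equivalently, $\tau^2$ is a primitive $\ell$-th root of unity for some $\ell\ge 2$). Ideals. An ideal $J$ is a ($K$-linear) vector subspace of $\bigoplus_{m,n}\mathrm{Hom}(m,n)$, of the form $J=\bigoplus_{m,n}(J\cap\mathrm{Hom}(m,n))$, closed under composition and tensor product with arbitrary morphisms: if $a,b$ are composable morphisms and one of them is in $J$ then $ab\in J$; if $a,b$ are any morphisms and one of them is in $J$ then $a\otimes b\in J$. It is proper if it is not all of $\bigoplus_{m,n}\mathrm{Hom}(m,n)$. Trace and negligible morphisms. Write $T_n=\mathrm{End}(n)$. The Markov trace $\mathrm{Tr}:T_n\to K\cong\mathrm{End}(0)$ is the linear map sending an $(n,n)$-diagram $a$ to $d^{c(a)}$, where $c(a)$ is the number of closed loops obtained by closing up $a$ (joining the $i$-th top point to the $i$-th bottom point by non-crossing arcs outside the rectangle, for each $i$). A morphism $a\in\mathrm{Hom}(n,m)$ is negligible if $\mathrm{Tr}(ab)=0$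 for all $b\in\mathrm{Hom}(m,n)$; the ideal of negligible morphisms is the direct sum over all $n,m$ of the spaces of negligible morphisms in $\mathrm{Hom}(n,m)$. *)

(* Defs.v *)
From HB Require Import structures.
From mathcomp Require Import all_boot all_order all_algebra.
From mathcomp Require Import complex.
From mathcomp Require Import reals trigo.

Set Implicit Arguments.
Unset Strict Implicit.
Unset Printing Implicit Defensive.

Import Order.TTheory GRing.Theory Num.Theory.
Local Open Scope ring_scope.

(* The boundary points of a rectangle with m points on its top edge and n on
   its bottom edge, both numbered from left to right. *)
Definition point (m n : nat) : finType := ('I_m + 'I_n)%type.

(* Rank of a boundary point when the boundary is read clockwise from the top
   left corner; hence the bottom edge is read from right to left. *)
Definition bpos (m n : nat) (x : point m n) : nat :=
  match x with
  | inl i => i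
  | inr j => (m + rev_ord j)%N
  end.

Definition perfect_matching (m n : nat) (f : {ffun point m n -> point m n}) :
    bool :=
  [forall x, (f x != x) && (f (f x) == x)].

Definition noncrossing (m n : nat) (f : {ffun point m n -> point m n}) : bool :=
  [forall x, forall y,
    ~~ [&& bpos x < bpos y, bpos y < bpos (f x) & bpos (f x) < bpos (f y)]%N].

(* (m,n)-TL diagrams up to equivalence; the type is empty if n - m is odd. *)
Definition diagram (m n : nat) : finType :=
  {f : {ffun point m n -> point m n} | perfect_matching f && noncrossing f}.

Definition partner (m n : nat) (a : diagram m n) (x : point m n) : point m n :=
  val a x.

(* Gluing: the points of an (l,m)-diagram a stacked on an (m,n)-diagram b,
   with the bottom edge of a identified with the top edge of b. *)
Definition stack (l m n : nat) : finType := ('I_l + 'I_m + 'I_n)%type.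

Definition upper (l m n : nat) (x : point l m) : stack l m n := inl x.

Definition lower (l m n : nat) (y : point m n) : stack l m n :=
  match y with
  | inl j => inl (inr j)
  | inr k => inr k
  end.

Definition outer (l m n : nat) (z : point l n) : stack l m n :=
  match z with
  | inl i => inl (inl i)
  | inr k => inr k
  end.

Definition strand (l m n : nat) (a : diagram l m) (b : diagram m n) :
    rel (stack l m n) :=
  fun u v =>
    [exists x, (u == upper n x) && (v == upper n (partner a x))] ||
    [exists y, (u == lower l y) && (v == lower l (partner b y))].

(* c is the diagram left after gluing a and b and removing the closed loops.
   For given a and b there is exactly one such c. *)
Definition is_glueing (l m n : nat)
    (a : diagram l m) (b : diagram m n) (c : diagram l n) : bool :=
  [forall z, connect (strand a b) (outer m z) (outer m (partner c z))].

(* The closed loops are the components containing no outer point. *)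
Definition nb_loops (l m n : nat) (a : diagram l m) (b : diagram m n) : nat :=
  n_comp (strand a b)
    [pred u | [forall z, ~~ connect (strand a b) u (outer m z)]].

Definition juxt_left (m m' n n' : nat) (x : point m n) :
    point (m + m') (n + n') :=
  match x with
  | inl i => inl (lshift m' i)
  | inr j => inr (lshift n' j)
  end.

Definition juxt_right (m m' n n' : nat) (x : point m' n') :
    point (m + m') (n + n') :=
  match x with
  | inl i => inl (rshift m i)
  | inr j => inr (rshift n j)
  end.

(* c is a placed to the left of b; for given a and b there is exactly one
   such c. *)
Definition is_juxtaposition (m m' n n' : nat)
    (a : diagram m n) (b : diagram m' n') (c : diagram (m + m') (n + n')) :
    bool :=
  [forall x, partner c (juxt_left m' n' x) == juxt_left m' n' (partner a x)] &&
  [forall y, partner c (juxt_right m n y) == juxt_right m n (partner b y)].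

Definition opposite (n : nat) (x : point n n) : point n n :=
  match x with
  | inl i => inr i
  | inr i => inl i
  end.

(* Number of closed loops of the closure of an (n,n)-diagram. *)
Definition nb_closure_loops (n : nat) (a : diagram n n) : nat :=
  n_comp [rel x y | (y == partner a x) || (y == opposite x)]
    [pred x : point n n | true].

(* Morphisms m -> n: a function f on diagrams stands for the linear
   combination \sum_a f a *: a. *)
Definition TLhom (K : fieldType) (m n : nat) : lmodType K :=
  {ffun diagram m n -> K^o}.

(* The composite g o f of f : l -> m and g : m -> n, with loop parameter d. *)
Definition TLcomp (K : fieldType) (d : K) (l m n : nat)
    (g : TLhom K m n) (f : TLhom K l m) : TLhom K l n :=
  [ffun c : diagram l n =>
    (\sum_(a : diagram l m) \sum_(b : diagram m n | is_glueing a b c)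
       g b * f a * d ^+ nb_loops a b : K^o)].

Definition TLtens (K : fieldType) (m m' n n' : nat)
    (f : TLhom K m n) (g : TLhom K m' n') : TLhom K (m + m') (n + n') :=
  [ffun c : diagram (m + m') (n + n') =>
    (\sum_(a : diagram m n)
       \sum_(b : diagram m' n' | is_juxtaposition a b c) f a * g b : K^o)].

Definition markov_trace (K : fieldType) (d : K) (n : nat) (f : TLhom K n n) : K :=
  \sum_(a : diagram n n) f a * d ^+ nb_closure_loops a.

(* An ideal J = \bigoplus_(m, n) (J :&: Hom(m, n)) is given by the family of
   its homogeneous components. *)
Definition hom_family (K : fieldType) : Type := forall m n, TLhom K m n -> Prop.

Record is_ideal (K : fieldType) (d : K) (J : hom_family K) : Prop := IsIdeal {
  ideal_zero : forall m n, J m n 0;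
  ideal_add : forall m n (f g : TLhom K m n), J m n f -> J m n g -> J m n (f + g);
  ideal_scale : forall m n (k : K) (f : TLhom K m n), J m n f -> J m n (k *: f);
  ideal_comp_l : forall l m n (g : TLhom K m n) (f : TLhom K l m),
    J m n g -> J l n (TLcomp d g f);
  ideal_comp_r : forall l m n (g : TLhom K m n) (f : TLhom K l m),
    J l m f -> J l n (TLcomp d g f);
  ideal_tens_l : forall m m' n n' (f : TLhom K m n) (g : TLhom K m' n'),
    J m n f -> J (m + m')%N (n + n')%N (TLtens f g);
  ideal_tens_r : forall m m' n n' (f : TLhom K m n) (g : TLhom K m' n'),
    J m' n' g -> J (m + m')%N (n + n')%N (TLtens f g)
}.

Definition nonzero_family (K : fieldType) (J : hom_family K) : Prop :=
  exists m n (f : TLhom K m n), J m n f /\ f <> 0.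

Definition proper_family (K : fieldType) (J : hom_family K) : Prop :=
  exists m n (f : TLhom K m n), ~ J m n f.

Definition nonzero_proper_ideal (K : fieldType) (d : K) (J : hom_family K) :
    Prop :=
  [/\ is_ideal d J, nonzero_family J & proper_family J].

Definition negligible (K : fieldType) (d : K) : hom_family K :=
  fun n m (a : TLhom K n m) =>
    forall b : TLhom K m n, markov_trace d (TLcomp d a b) = 0.

Definition proper_root_of_unity (K : fieldType) (tau : K) : Prop :=
  (exists2 k : nat, (0 < k)%N & tau ^+ k = 1) /\ tau <> 1 /\ tau <> -1.

Definition loop_parameter (K : fieldType) (tau : K) : K := tau + tau^-1.

(* The indeterminate of C(t), where C = R[i]. *)
Definition indeterminate (R : realType) : {fraction {poly R[i]}} :=
  tofrac ('X : {poly R[i]}).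

(* Main.v *)
Require Import Defs.
From mathcomp Require Import all_boot all_order all_algebra.
From mathcomp Require Import complex.
From mathcomp Require Import reals trigo.
From mathcomp Require Import zify ring.
From Stdlib Require Import Classical.

Set Implicit Arguments.
Unset Strict Implicit.
Unset Printing Implicit Defensive.

Import GRing.Theory.

(** Bending strands identifies [Hom(m, n)] with [Hom(m + n, 0)] and preserves
    ideals, so that an ideal is known by its elements with an empty bottom edge.
    A nonzero element [f] with the least number of points is annihilated by
    composition with every cup, which removes two points. The proof determines
    all such [f].

    Let [d = q + q^-1]. A diagram with an empty bottom edge is a functional on a
    tensor power of a two-dimensional space: its value on a 0-1 word is a product
    over the arcs, an arc with ends 0, 1 contributing 1 and one with ends 1, 0
    contributing [q] ([diagram_value]). Capping off two neighbouring points of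
    the diagram becomes a contraction of these values ([value_cup]), and the
    values of distinct diagrams are linearly independent ([hom_value_inj]). If
    all cups annihilate [f], replacing 01 by 10 in a word multiplies its value by
    [- q^-1]; so [f] is determined by its value on the sorted word [0^k 1^k]. On
    the other hand every diagram is invariant under the quantum group [sl_2]:
    the divided powers of the raising operator annihilate its values
    ([weighted_sum_hom_value]). On [f] they give the Gaussian binomials
    [binom(k + j, j)] at [q^-2], which must therefore vanish for [1 <= j <= k]
    ([killed_qbin]).

    If [q] is not a proper root of unity, the case [j = 1] forces [k = 0]: then
    [f] is a multiple of the identity of the unit object, and the ideal is
    everything ([generic_no_ideal]). If [q = e ^ (i pi / n)], then [j = 1] gives
    [n <= k + 1], and Lucas' theorem for [j = n] excludes [n <= k]. Hence
    [k = n - 1], and [f], bent into an endomorphism of [n - 1], has a nonzero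
    coefficient on the identity (it is a multiple of the Jones-Wenzl projection). Modulo a
    nonzero proper ideal [J], the identity of [n - 1] is thus a combination of
    diagrams with a cap, and an induction on the number of points shows that [J]
    contains all negligible morphisms ([negligible_sub]). Conversely, an element
    of an ideal that pairs nontrivially with a diagram puts the identity of the
    unit object into the ideal, so that proper ideals are negligible
    ([proper_ideal_negligible]).

    There remains to see that negligible morphisms form a nonzero ideal. That
    they form an ideal is a matter of counting closed curves: the number of
    curves does not depend on the order of the gluings ([nb_curves_glue],
    [partial_closure]); here one needs that gluing planar diagrams gives planar
    diagrams, which is a parity argument ([ends_matching]). If all of them were
    zero, the Gram matrix of the diagrams would be invertible and there would be a
    morphism dual to the rainbow diagram; all cups but the middle one annihilate
    it, hence the middle one does too at a root of unity, a contradiction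
    ([negligible_nonzero]). *)

(** * Components of finite graphs *)

Section Components.

Lemma connect_ind (T : finType) (e : rel T) (P : T -> Prop) x y :
  (forall u v, P u -> e u v -> P v) -> P x -> connect e x y -> P y.
Proof.
move=> Pe Px /connectP[p e_p ->]; elim: p x Px e_p => //= z p IHp x Px.
by case/andP=> /(Pe _ _ Px) /IHp.
Qed.

(** The image of [i] meets every component, as [x] is connected to [i (r x)]. *)
Lemma n_comp_retract (S T : finType) (eS : rel S) (eT : rel T)
    (r : S -> T) (i : T -> S) :
    connect_sym eS -> connect_sym eT ->
    (forall x, connect eS x (i (r x))) -> cancel i r ->
    (forall x y, eS x y -> connect eT (r x) (r y)) ->
    (forall x y, eT x y -> connect eS (i x) (i y)) ->
  n_comp eS S = n_comp eT T.
Proof.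
move=> symS symT ir ri er ei.
have cr x y : connect eS x y -> connect eT (r x) (r y).
  by move=> xy; apply: (connect_ind (P := fun z => connect eT (r x) (r z)) _ _ xy) => // u v xu
    /er; apply: connect_trans.
have ci x y : connect eT x y -> connect eS (i x) (i y).
  by move=> xy; apply: (connect_ind (P := fun z => connect eS (i x) (i z)) _ _ xy) => // u v xu
    /ei; apply: connect_trans.
rewrite (adjunction_n_comp i symS symT (a := S)) //.
split=> [x _|x y _]; first by exists (r x).
by apply/idP/idP=> [/ci//|/cr]; rewrite !ri.
Qed.

Variables (S U : finType) (e : rel S) (h : U -> S) (mu : U -> U) (e2 : rel U).
Hypothesis sym_e : connect_sym e.
Hypothesis sym_e2 : symmetric e2.
Hypothesis connect_h : forall u v, connect e (h u) (h v) = (v == u) || (v == mu u).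

(** A graph [e] on [S] that connects the boundary points [h u] in pairs given by
    [mu] is plugged into a graph [e2] on the boundary. *)
Definition plug_rel : rel S :=
  [rel x y | e x y || [exists u, exists v, [&& e2 u v, x == h u & y == h v]]].

Definition plugged_rel : rel U := [rel u v | (v == mu u) || e2 u v].

Lemma plug_relP x y : reflect
  (e x y \/ exists u v, [/\ e2 u v, x = h u & y = h v]) (plug_rel x y).
Proof.
apply: (iffP orP) => -[exy|]; [by left| |by left|].
  by case/existsP=> u /existsP[v /and3P[uv /eqP-> /eqP->]]; right; exists u, v.
case=> u [v [uv -> ->]]; right; apply/existsP; exists u; apply/existsP; exists v.
by rewrite uv !eqxx.
Qed.

Lemma connect_plug_sub x y : connect e x y -> connect plug_rel x y.
Proof. by apply: connect_sub => u v uv; apply/connect1/plug_relP; left. Qed.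

Lemma plug_rel_sym : connect_sym plug_rel.
Proof.
apply: symmetric_from_pre => x y xy.
apply: (connect_ind (P := fun z => connect plug_rel z x) _ _ xy) => //.
move=> u v ux /plug_relP[uv|[z [t [zt ? ?]]]].
  apply: connect_trans ux; apply: connect_plug_sub; rewrite sym_e; exact: connect1.
subst u v; apply: connect_trans ux; apply/connect1/plug_relP.
by right; exists t, z; rewrite sym_e2.
Qed.

Lemma mu_inv u : mu (mu u) = u.
Proof.
have muu: connect e (h (mu u)) (h u) by rewrite sym_e connect_h eqxx orbT.
have uu: connect e (h (mu u)) (h (mu (mu u))) by rewrite connect_h eqxx orbT.
have := uu; rewrite (same_connect sym_e muu) connect_h => /orP[/eqP//|/eqP e1].
by move: muu; rewrite connect_h e1 => /orP[] /eqP.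
Qed.

Lemma plugged_rel_sym : connect_sym plugged_rel.
Proof.
apply: sym_connect_sym => u v; rewrite /plugged_rel /= sym_e2; congr (_ || _).
by apply/eqP/eqP=> ->; rewrite mu_inv.
Qed.

Lemma connect_plugged u v :
  connect plug_rel (h u) (h v) = connect plugged_rel u v.
Proof.
apply/idP/idP=> uv.
  suff: forall w, connect e (h v) (h w) -> connect plugged_rel u w by apply.
  apply: (connect_ind (P := fun x => forall w, connect e x (h w) ->
    connect plugged_rel u w) _ _ uv) => [x y Px|w]; last first.
    by rewrite connect_h => /orP[/eqP-> //|/eqP->]; apply/connect1; rewrite /plugged_rel /= eqxx.
  case/plug_relP=> [xy w yw|[z [t [zt ? ?]]] w]; first apply: Px.
    exact: connect_trans (connect1 xy) yw.
  subst x y; have/Px uz: connect e (h z) (h z) by [].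
  have ut: connect plugged_rel u t.
    by apply: connect_trans uz (connect1 _); rewrite /plugged_rel /= zt orbT.
  rewrite connect_h => /orP[/eqP->//|/eqP->].
  by apply: connect_trans ut (connect1 _); rewrite /plugged_rel /= eqxx.
apply: (connect_ind (P := fun x => connect plug_rel (h u) (h x)) _ _ uv) => //.
move=> x y ux /orP[/eqP->|xy]; apply: connect_trans ux _.
  by apply: connect_plug_sub; rewrite connect_h eqxx orbT.
by apply/connect1/plug_relP; right; exists x, y.
Qed.

(** The added edges only affect the components that meet the boundary, and these
    see of [e] nothing but the matching [mu]. *)
Lemma n_comp_plug :
  n_comp plug_rel S
    = n_comp e [pred x | [forall u, ~~ connect e x (h u)]]
      + n_comp plugged_rel U.
Proof.
pose a := [pred x | [exists u, connect e x (h u)]].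
have cl_a : closed plug_rel a.
  apply: (intro_closed plug_rel_sym) => x y /plug_relP[xy|[u [v [_ -> ->]]] _].
    case/existsP=> u xu; apply/existsP; exists u.
    by rewrite -(same_connect1 sym_e xy).
  by apply/existsP; exists v.
have cl_aC : closed plug_rel [predC a] by apply: predC_closed.
have cl_eC : closed e [predC a].
  by move=> x y xy; apply: cl_aC; apply/plug_relP; left.
rewrite (n_compC a) addnC; congr (_ + _).
  have aE : [predC a] =i [pred x | [forall u, ~~ connect e x (h u)]].
    by move=> x; rewrite !inE negb_exists.
  rewrite -(eq_n_comp_r aE) (adjunction_n_comp id plug_rel_sym sym_e) //.
  split=> [x ax|x y]; first by exists x.
  move=> ax; apply/idP/idP=> [|xy]; first exact: connect_plug_sub.
  suff [] : y \in [predC a] /\ connect e x y by [].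
  apply: (connect_ind (P := fun z => z \in [predC a] /\ connect e x z) _ _ xy) => //.
  move=> u v [au xu] /plug_relP[uv|[z [t [_ uz _]]]].
    by split; [rewrite -(cl_eC _ _ uv) | apply: connect_trans xu (connect1 uv)].
  by move: au; rewrite inE => /negP[]; apply/existsP; exists z; rewrite uz.
rewrite (adjunction_n_comp h plug_rel_sym plugged_rel_sym) //.
  by apply: eq_n_comp_r => u; rewrite !inE; apply/existsP; exists u.
split=> [x /existsP/sigW[u xu]|u v _]; last by rewrite connect_plugged.
by exists u; apply: connect_plug_sub.
Qed.

End Components.

(** * Components of a pair of involutions *)

Section TwoInvolutions.

Variables (S : finType) (al be : S -> S).
Hypotheses (alK : involutive al) (beK : involutive be).
Hypothesis no_common_fix : forall x, ~~ ((al x == x) && (be x == x)).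

Definition inv_rel (al be : S -> S) : rel S :=
  [rel x y | (y == al x) || (y == be x)].

Lemma inv_rel_sym : symmetric (inv_rel al be).
Proof.
by move=> x y; rewrite /inv_rel /=; congr (_ || _); apply/eqP/eqP=> ->; rewrite ?alK ?beK.
Qed.

Definition end_point x := (al x == x) || (be x == x).

(** An end point [x] fixed by [be] is an end of a path: along the orbit of [x]
    under [be \o al] both involutions act as reflections. *)
Lemma path_end x : be x == x -> exists y, [/\ end_point y, y != x,
    connect (inv_rel al be) x y &
    forall z, end_point z -> connect (inv_rel al be) x z -> z = x \/ z = y].
Proof.
move=> bex; pose rho z := be (al z).
have rho_inj : injective rho.
  by move=> u v /(congr1 (al \o be)); rewrite /rho /= !beK !alK.
have rhoab z : rho (al (be z)) = z by rewrite /rho alK beK.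
set r := order rho x; have r_gt0 : 0 < r by apply: order_gt0.
have rx : iter r rho x = x by apply: iter_order.
have alx i : i < r -> al (iter i rho x) = iter (r - i.+1) rho x.
  elim: i => [_|i IHi ir]; apply: rho_inj; rewrite -iterS.
    by rewrite subn1 prednK // rx /= /rho alK (eqP bex).
  have -> : (r - i.+2).+1 = r - i.+1 by lia.
  rewrite -IHi; last by lia.
  by rewrite iterS {2}/rho -{2}[al (iter i rho x)]rhoab.
have bex' i : i < r -> be (iter i rho x) = iter (r - i) rho x.
  case: i => [|i] ir; first by rewrite subn0 rx (eqP bex).
  rewrite iterS {1}/rho beK alx; last by lia.
  by [].
have inj i j : i < r -> j < r -> iter i rho x = iter j rho x -> i = j.
  by move=> ir jr /(congr1 (findex rho x)); rewrite !findex_iter.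
have inO z : connect (inv_rel al be) x z -> exists2 i, i < r & z = iter i rho x.
  move=> xz; apply: (connect_ind (P := fun z => exists2 i, i < r & z = iter i rho x)
     _ _ xz); last by exists 0.
  move=> u v [i ir ->] /orP[] /eqP->; first by rewrite alx //; exists (r - i.+1) => //; lia.
  case: i ir => [|i] ir; first by rewrite /= (eqP bex); exists 0.
  by rewrite bex' //; exists (r - i.+1) => //; lia.
have conn i : connect (inv_rel al be) x (iter i rho x).
  elim: i => // i IHi; apply: connect_trans IHi _; rewrite iterS.
  apply: (@connect_trans _ _ (al (iter i rho x))); apply: connect1.
    by rewrite /inv_rel /= eqxx.
  by rewrite /inv_rel /= /rho eqxx orbT.
have r_gt1 : 1 < r.
  rewrite ltn_neqAle r_gt0 andbT; apply/negP=> /eqP r1.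
  by have := no_common_fix x; rewrite bex -{1}[x]/(iter 0 rho x) alx // -r1 /= eqxx.
(* The other end is halfway along the orbit. *)
exists (iter r./2 rho x); split; last 2 first.
- exact: conn.
- move=> z zE /inO[i ir zi]; move: zE; rewrite {}zi => /orP[] /eqP.
    rewrite alx // => E; right; congr (iter _ _ _).
    by have := inj (r - i.+1) i ltac:(lia) ir E; lia.
  case: i ir => [|i] ir; first by left.
  rewrite bex' // => E; right.
  by have -> : r./2 = i.+1 by have := inj (r - i.+1) i.+1 ltac:(lia) ir E; lia.
- rewrite /end_point alx; last by lia.
  rewrite bex'; last by lia.
  have [ro|re] := boolP (odd r).
    by have -> : r - r./2.+1 = r./2; [lia|rewrite eqxx].
  by have -> : r - r./2 = r./2; [lia|rewrite eqxx orbT].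
- by apply/eqP=> E; have := inj r./2 0 ltac:(lia) r_gt0 E; lia.
Qed.

End TwoInvolutions.

(** * Diagrams *)

Lemma bpos_inj m n : injective (@bpos m n).
Proof.
move=> [i|i] [j|j] /=; have := ltn_ord i; have := ltn_ord j => Hj Hi E.
- by congr inl; apply: val_inj.
- by exfalso; lia.
- by exfalso; lia.
- by congr inr; apply: val_inj; simpl; lia.
Qed.

Section DiagramTheory.
Variables (m n : nat).
Implicit Types a b : diagram m n.

Lemma partnerK a : involutive (partner a).
Proof.
by move=> x; have /andP[/forallP/(_ x)/andP[_ /eqP]] := valP a.
Qed.

Lemma partner_neq a x : partner a x != x.
Proof. by have /andP[/forallP/(_ x)/andP[]] := valP a. Qed.

Lemma partner_noncrossing a x y :
  ~~ [&& bpos x < bpos y, bpos y < bpos (partner a x)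
       & bpos (partner a x) < bpos (partner a y)].
Proof. by have /andP[_ /forallP/(_ x)/forallP/(_ y)] := valP a. Qed.

Lemma partner_inj a : injective (partner a).
Proof. exact: can_inj (partnerK a). Qed.

Lemma diagram_ext a b : partner a =1 partner b -> a = b.
Proof. by move=> E; apply/val_inj/ffunP => x; apply: E. Qed.

Lemma diagram_of (f : point m n -> point m n) :
    (forall x, f x != x) -> involutive f ->
    (forall x y, ~~ [&& bpos x < bpos y, bpos y < bpos (f x)
       & bpos (f x) < bpos (f y)]) ->
  {a : diagram m n | partner a =1 f}.
Proof.
move=> f1 f2 f3.
have P : perfect_matching (finfun f) && noncrossing (finfun f).
  apply/andP; split; apply/forallP=> x; first by rewrite !ffunE f1 f2 eqxx.
  by apply/forallP=> y; rewrite !ffunE.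
by exists (Sub (finfun f) P : diagram m n) => x; rewrite /partner SubK ffunE.
Qed.

End DiagramTheory.

Lemma odd_addF x y : odd (x + y) = false -> odd x = odd y.
Proof. by rewrite oddD; case: (odd x) (odd y) => -[]. Qed.

(** Pair every point with its image: the smaller and the larger points of the
    pairs are equally many. *)
Lemma even_sum_involution (T : finType) (f : T -> T) (P : pred T) :
    involutive f -> (forall x, f x != x) -> (forall x, P (f x) = P x) ->
  odd (\sum_(x : T) (P x : nat)) = false.
Proof.
move=> fK f_neq Pf.
have E : \sum_x (P x : nat)
  = \sum_x (P x && (enum_rank x < enum_rank (f x)) : nat)
    + \sum_x (P x && (enum_rank (f x) < enum_rank x) : nat).
  rewrite -big_split; apply: eq_bigr => x _ /=.
  case: (ltngtP (enum_rank x) (enum_rank (f x))) => [_|_|/val_inj/enum_rank_inj E].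
  - by rewrite andbT andbF addn0.
  - by rewrite andbT andbF.
  - by case/eqP: (f_neq x).
rewrite E [X in _ + X](reindex_inj (can_inj fK)) /=.
under [X in _ + X]eq_bigr => x _ do rewrite Pf fK.
by rewrite oddD addbb.
Qed.

(** No arc of the set [G] crosses the arc from [x], so that the points of [G]
    below this arc are matched among themselves. *)
Lemma even_between m n (a : diagram m n) (G : pred (point m n)) x :
    (forall y, G (partner a y) = G y) -> ~~ G x ->
  odd (\sum_y (G y && (bpos x < bpos y < bpos (partner a x)) : nat)) = false.
Proof.
move=> Ga Gx; apply: (even_sum_involution (@partnerK _ _ a) (@partner_neq _ _ a)) => y.
rewrite Ga; case Gy: (G y) => //=.
have yx : y != x by apply: contraTneq Gy => ->; rewrite (negbTE Gx).
have yax : y != partner a x by apply: contraTneq Gy => ->; rewrite Ga (negbTE Gx).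
have H1 : bpos y <> bpos x by move=> /bpos_inj/eqP; rewrite (negbTE yx).
have H2 : bpos y <> bpos (partner a x) by move=> /bpos_inj/eqP; rewrite (negbTE yax).
have H3 : bpos (partner a y) <> bpos x.
  by move=> /bpos_inj E; case/eqP: yax; rewrite -E partnerK.
have H4 : bpos (partner a y) <> bpos (partner a x).
  by move=> /bpos_inj/partner_inj/eqP; rewrite (negbTE yx).
have := partner_noncrossing a x y; have := partner_noncrossing a y x.
have := partner_noncrossing a x (partner a y).
have := partner_noncrossing a (partner a y) x.
rewrite !partnerK; lia.
Qed.

Lemma odd_below m n (a : diagram m n) (G : pred (point m n)) x :
    (forall y, G (partner a y) = G y) -> ~~ G x ->
  odd (\sum_y (G y && (bpos y < bpos (partner a x)) : nat))
    = odd (\sum_y (G y && (bpos y < bpos x) : nat)).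
Proof.
move=> Ga.
wlog lt_x : x / bpos x < bpos (partner a x) => [W Gx|Gx].
  have [/W/(_ Gx)//|] := ltnP (bpos x) (bpos (partner a x)).
  rewrite leq_eqVlt => /orP[/eqP/bpos_inj E|lt_x].
    by case/eqP: (partner_neq a x).
  have := W (partner a x); rewrite partnerK Ga => /(_ lt_x Gx) <- //.
have := even_between Ga Gx; set s := (\sum__ _) => s0.
suff -> : \sum_y (G y && (bpos y < bpos (partner a x)) : nat)
  = \sum_y (G y && (bpos y < bpos x) : nat) + s by rewrite oddD s0 addbF.
rewrite /s -big_split; apply: eq_bigr => y _ /=; case Gy: (G y) => //=.
have H1 : bpos y <> bpos x by move=> /bpos_inj E; move: Gx; rewrite -E Gy.
lia.
Qed.

(** * Planar contractions *)

(** The criterion that a matching induced by two involutions is planar: every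
    union [gam] of components has a checkerboard colouring [s] of its
    complement, which an arc keeps and an end point of [gam] switches. *)
Section PlanarEnds.

Variables (S U : finType) (al be : S -> S) (h : U -> S) (pos : U -> nat).
Hypotheses (alK : involutive al) (beK : involutive be).
Hypothesis no_common_fix : forall x, ~~ ((al x == x) && (be x == x)).
Hypothesis h_inj : injective h.
Hypothesis hE : forall x, end_point al be x = (x \in codom h).
Hypothesis colour : forall gam : pred S,
  (forall x, gam (al x) = gam x) -> (forall x, gam (be x) = gam x) ->
  exists s : S -> bool,
  [/\ forall x, ~~ gam x -> s (al x) = s x,
      forall x, ~~ gam x -> s (be x) = s x
    & forall u u', ~~ gam (h u) -> ~~ gam (h u') -> pos u < pos u' ->
        s (h u) (+) s (h u')
          = odd (\sum_v (gam (h v) && (pos u < pos v < pos u') : nat))].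

Let e := inv_rel al be.
Let sym_e : connect_sym e := sym_connect_sym (inv_rel_sym alK beK).

(** A crossing of the arcs from [x] and [y] is excluded by colouring the
    complement of the component of [x]: the colour is the same at both ends of
    the arc from [y], but exactly one end of the arc from [x] lies between. *)
Lemma ends_matching : exists mu : U -> U,
  [/\ forall u, mu u != u, involutive mu,
      forall u v, connect e (h u) (h v) = (v == u) || (v == mu u)
    & forall x y, ~~ [&& pos x < pos y, pos y < pos (mu x) & pos (mu x) < pos (mu y)]].
Proof.
have ex_mu u : exists v, (v != u) &&
    [forall w, connect e (h u) (h w) == (w == u) || (w == v)].
  have : end_point al be (h u) by rewrite hE codom_f.
  have get x y : x = h u -> [/\ end_point al be y, y != x, connect e x y &
      forall z, end_point al be z -> connect e x z -> z = x \/ z = y] ->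
    exists v, (v != u) && [forall w, connect e (h u) (h w) == (w == u) || (w == v)].
    move=> -> [+ yx xy Hy]; rewrite hE => /codomP[v yv].
    exists v; apply/andP; split; first by apply: contra_neq yx; rewrite yv => ->.
    apply/forallP=> w; apply/eqP; apply/idP/orP=> [uw|].
      have /Hy/(_ uw) : end_point al be (h w) by rewrite hE codom_f.
      by rewrite yv => -[/h_inj->|/h_inj->]; rewrite eqxx; [left|right].
    by case=> /eqP->; rewrite -?yv.
  case/orP=> fx.
    have ncf x : ~~ ((be x == x) && (al x == x)) by rewrite andbC.
    have [y [y1 y2 y3 y4]] := path_end beK alK ncf fx; apply: (get _ y erefl).
    have eE x z : connect (inv_rel be al) x z = connect e x z.
      by apply: eq_connect => {}x {}z; rewrite /e /inv_rel /= orbC.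
    split=> //; first by rewrite /end_point orbC.
      by rewrite -eE.
    by move=> z; rewrite /end_point orbC -eE; apply: y4.
  have [y Hy] := path_end alK beK no_common_fix fx; exact: (get _ y erefl).
pose mu u := xchoose (ex_mu u).
have muP u : (mu u != u) /\ forall w, connect e (h u) (h w) = (w == u) || (w == mu u).
  case/andP: (xchooseP (ex_mu u)) => ? /forallP H; split=> // w; exact/eqP.
have mu_neq u : mu u != u by case: (muP u).
have muE u w : connect e (h u) (h w) = (w == u) || (w == mu u) by case: (muP u).
have muK : involutive mu.
  move=> u; have uu : connect e (h (mu u)) (h u) by rewrite sym_e muE eqxx orbT.
  by move: uu; rewrite muE eq_sym (negbTE (mu_neq u)) => /eqP.
exists mu; split=> // x y; apply/and3P=> -[lt1 lt2 lt3].
pose gam := connect e (h x).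
have gam_al z : gam (al z) = gam z.
  by rewrite /gam; apply: esym; apply: same_connect1r; rewrite // /e /inv_rel /= eqxx.
have gam_be z : gam (be z) = gam z.
  by rewrite /gam; apply: esym; apply: same_connect1r; rewrite // /e /inv_rel /= eqxx orbT.
have gamE v : gam (h v) = (v == x) || (v == mu x) by rewrite /gam muE.
have [s [s_al s_be s_h]] := colour gam_al gam_be.
have gy : ~~ gam (h y).
  rewrite gamE; apply/orP=> -[] /eqP E; move: lt1 lt2; rewrite E; lia.
have gmy : ~~ gam (h (mu y)).
  rewrite gamE; apply/orP=> -[/eqP E|/eqP/(can_inj muK) E].
    by move: lt1 lt2 lt3; rewrite E; lia.
  by move: lt1; rewrite E ltnn.
have /(connect_ind (P := fun z => ~~ gam z /\ s z = s (h y)))[] :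
    connect e (h y) (h (mu y)) by rewrite muE eqxx orbT.
- by move=> u v [gu su] /orP[]/eqP->; rewrite ?gam_al ?gam_be ?s_al ?s_be.
- by [].
move=> _ E; have := s_h _ _ gy gmy (ltn_trans lt2 lt3); rewrite E addbb.
rewrite (bigD1 (mu x)) //= gamE eqxx orbT lt2 lt3 /= big1 // => v vmx.
rewrite gamE (negbTE vmx) orbF; case: eqP => //= ->; lia.
Qed.

End PlanarEnds.

(** ** Composition of diagrams *)

Section Glue.

Variables (l m n : nat) (a : diagram l m) (b : diagram m n).

(** Both diagrams act by involutions on the stack, fixing the outer points that
    they do not contain; the outer points are the ends of the paths. *)
Definition glue_up (u : stack l m n) : stack l m n :=
  match u with inl x => upper n (partner a x) | inr k => inr k end.

Definition glue_low (u : stack l m n) : stack l m n :=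
  match u with
  | inl (inl i) => inl (inl i)
  | inl (inr j) => lower l (partner b (inl j))
  | inr k => lower l (partner b (inr k))
  end.

Lemma glue_low_lower y : glue_low (lower l y) = lower l (partner b y).
Proof. by case: y. Qed.

Lemma upper_inj : injective (@upper l m n).
Proof. by move=> x y []. Qed.

Lemma lower_inj : injective (@lower l m n).
Proof. by move=> [x|x] [y|y] // []; move->. Qed.

Lemma outer_inj : injective (@outer l m n).
Proof. by move=> [x|x] [y|y] // []; move->. Qed.

Lemma glue_upK : involutive glue_up.
Proof. by move=> [x|k] //=; rewrite /upper partnerK. Qed.

Lemma glue_lowK : involutive glue_low.
Proof. by move=> [[i|j]|k] //=; rewrite glue_low_lower partnerK. Qed.

Lemma strandP u v : reflect
  ((exists x, u = upper n x /\ v = upper n (partner a x)) \/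
   (exists y, u = lower l y /\ v = lower l (partner b y))) (strand a b u v).
Proof.
apply: (iffP orP) => -[].
- by case/existsP=> x /andP[/eqP-> /eqP->]; left; exists x.
- by case/existsP=> x /andP[/eqP-> /eqP->]; right; exists x.
- by case=> x [-> ->]; left; apply/existsP; exists x; rewrite !eqxx.
- by case=> x [-> ->]; right; apply/existsP; exists x; rewrite !eqxx.
Qed.

Lemma strand_upper x : strand a b (upper n x) (upper n (partner a x)).
Proof. by apply/strandP; left; exists x. Qed.

Lemma strand_lower y : strand a b (lower l y) (lower l (partner b y)).
Proof. by apply/strandP; right; exists y. Qed.

Lemma strand_sym : connect_sym (strand a b).
Proof.
suff H u v : strand a b u v -> strand a b v u.
  by apply: sym_connect_sym => u v; apply/idP/idP; apply: H.
case/strandP=> -[x [-> ->]]; apply/strandP.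
  by left; exists (partner a x); rewrite partnerK.
by right; exists (partner b x); rewrite partnerK.
Qed.

Lemma connect_strandE : connect (strand a b) =2 connect (inv_rel glue_up glue_low).
Proof.
move=> u v; apply/idP/idP; apply: connect_sub => {u v} u v.
  case/strandP=> -[x [-> ->]]; apply: connect1; rewrite /inv_rel /=.
    by rewrite eqxx.
  by rewrite glue_low_lower eqxx orbT.
case/orP=> /eqP->.
  by case: u => [x|k] //; apply/connect1/strand_upper.
case: u => [[i|j]|k] //=; apply: connect1.
  exact: (strand_lower (inl j)).
exact: (strand_lower (inr k)).
Qed.

Lemma glue_ends u : end_point glue_up glue_low u = (u \in codom (@outer l m n)).
Proof.
rewrite /end_point; case: u => [[i|j]|k] /=.
- by rewrite eqxx orbT; apply: esym; apply/codomP; exists (inl i).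
- rewrite (inj_eq upper_inj) (negbTE (partner_neq a _)) /=.
  rewrite -[inl (inr j)]/(lower l (inl j)) (inj_eq lower_inj) (negbTE (partner_neq b _)).
  by apply: esym; apply/codomP=> -[[]].
- by rewrite eqxx /=; apply: esym; apply/codomP; exists (inr k).
Qed.

Lemma glue_no_common_fix u : ~~ ((glue_up u == u) && (glue_low u == u)).
Proof.
rewrite negb_and; apply/orP; case: u => [x|k]; [left|right].
  by rewrite -[inl x]/(upper n x) (inj_eq upper_inj (partner a x)) partner_neq.
rewrite -[inr k]/(lower l (inr k)) glue_low_lower.
by rewrite (inj_eq lower_inj (partner b (inr k))) partner_neq.
Qed.

(** The colour of a point is the parity of the number of points of [gam] before it
    in the circular order of the boundary of the upper diagram, or of the lower
    one. The two agree on the middle line, because the upper diagram has an even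
    number of points in [gam]. *)
Lemma glue_colour (gam : pred (stack l m n)) :
  (forall x, gam (glue_up x) = gam x) -> (forall x, gam (glue_low x) = gam x) ->
  exists s : stack l m n -> bool,
  [/\ forall x, ~~ gam x -> s (glue_up x) = s x,
      forall x, ~~ gam x -> s (glue_low x) = s x
    & forall u u', ~~ gam (outer m u) -> ~~ gam (outer m u') -> bpos u < bpos u' ->
        s (outer m u) (+) s (outer m u')
          = odd (\sum_v (gam (outer m v) && (bpos u < bpos v < bpos u') : nat))].
Proof.
move=> gam_al gam_be.
pose G := [pred x | gam (upper n x)]; pose H := [pred y | gam (lower l y)].
have Ga x : G (partner a x) = G x by apply: (gam_al (inl x)).
have Hb y : H (partner b y) = H y.
  by rewrite /H /= -[RHS]gam_be glue_low_lower.
have G0 := even_sum_involution (@partnerK _ _ a) (@partner_neq _ _ a) Ga.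
have H0 := even_sum_involution (@partnerK _ _ b) (@partner_neq _ _ b) Hb.
pose sG (x : point l m) := odd (\sum_y (G y && (bpos y < bpos x) : nat)).
pose sH (x : point m n) := odd (\sum_y (H y && (bpos y < bpos x) : nat)).
have sGa x : ~~ G x -> sG (partner a x) = sG x by apply: odd_below.
have sHb x : ~~ H x -> sH (partner b x) = sH x by apply: odd_below.
have ub p (i : 'I_p) := ltn_ord i.
have mid j : ~~ gam (inl (inr j)) -> sG (inr j) = sH (inl j).
  move=> gj; rewrite /sG /sH !big_sumType /= in G0 *.
  have -> : \sum_(i < l) (G (inl i) && (i < l + (m - j.+1)) : nat) = \sum_i (G (inl i) : nat).
    by apply: eq_bigr => i _; have := ub _ i => ?; case: (G _) => //=; lia.
  have -> : \sum_(i < n) (H (inr i) && (m + (n - i.+1) < j) : nat) = 0.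
    by rewrite big1 // => i _; case: (H _) => //=; have := ub _ j => ?; lia.
  have E : \sum_(i < m) (G (inr i) : nat)
    = \sum_(i < m) (G (inr i) && (l + (m - i.+1) < l + (m - j.+1)) : nat)
      + \sum_(i < m) (H (inl i) && (i < j) : nat).
    rewrite -big_split; apply: eq_bigr => i _ /=.
    case: (ltngtP i j) => [lt|lt|/val_inj E].
    - by have := ub _ j => ?; have -> : (l + (m - i.+1) < l + (m - j.+1)) = false; [lia|rewrite andbF andbT].
    - by have := ub _ i => ?; have -> : (l + (m - i.+1) < l + (m - j.+1)); [lia|rewrite andbF andbT addn0].
    - by rewrite E /upper (negbTE gj).
  by apply: odd_addF; rewrite addn0 -addnA -E.
pose s (u : stack l m n) := match u with inl x => sG x | inr k => sH (inr k) end.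
have sL y : ~~ gam (lower l y) -> s (lower l y) = sH y.
  by case: y => [j|k] //= /mid.
pose t (u : point l n) := odd (\sum_v (gam (outer m v) && (bpos v < bpos u) : nat)).
have sO u : ~~ gam (outer m u) -> s (outer m u) = t u.
  case: u => [i|k] _; rewrite /s /t /= /sG /sH !big_sumType /=.
    congr (odd (_ + _)); rewrite !big1 // => j _; case: (gam _) => //=; have := ub _ i; lia.
  rewrite !oddD; congr (_ (+) _); last first.
    by congr odd; apply: eq_bigr => k' _; congr (_ && _ : nat); apply/idP/idP; lia.
  have -> : \sum_(i < m) (H (inl i) && (i < m + (n - k.+1)) : nat) = \sum_i (H (inl i) : nat).
    by apply: eq_bigr => i _; have := ub _ i => ?; case: (H _) => //=; lia.
  have -> : \sum_(i < l) (gam (outer m (inl i)) && (i < l + (n - k.+1)) : nat)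
     = \sum_i (G (inl i) : nat).
    by apply: eq_bigr => i _; have := ub _ i => ?; rewrite /G /upper /=; case: (gam _) => //=; lia.
  by apply: odd_addF; rewrite addnC; move: G0; rewrite big_sumType.
exists s; split.
- by move=> [x|k] //=; apply: sGa.
- have low y : ~~ gam (lower l y) -> s (glue_low (lower l y)) = s (lower l y).
    move=> gy; rewrite glue_low_lower !sL ?sHb //.
    by have := Hb y; rewrite /H /= => ->.
  by move=> [[i|j]|k] // gu; [apply: (low (inl j)) | apply: (low (inr k))].
move=> u u' gu gu' uu'; rewrite !sO // /t.
have -> : \sum_v (gam (outer m v) && (bpos v < bpos u') : nat)
  = \sum_v (gam (outer m v) && (bpos v < bpos u) : nat)
    + \sum_v (gam (outer m v) && (bpos u < bpos v < bpos u') : nat).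
  rewrite -big_split; apply: eq_bigr => v _ /=; case gv: (gam _) => //=.
  have : bpos v <> bpos u by move=> /bpos_inj E; move: gu; rewrite -E gv.
  lia.
by rewrite oddD addbA addbb.
Qed.

Lemma glue_exists : exists c : diagram l n, is_glueing a b c.
Proof.
have [mu [mu_neq muK muE mu_nc]] := ends_matching glue_upK glue_lowK
  glue_no_common_fix outer_inj glue_ends glue_colour.
have [c cE] := diagram_of mu_neq muK mu_nc.
by exists c; apply/forallP=> z; rewrite connect_strandE muE cE eqxx orbT.
Qed.

Lemma connect_outer_partner c : is_glueing a b c -> forall z z',
  connect (strand a b) (outer m z) (outer m z') = (z' == z) || (z' == partner c z).
Proof.
have [mu [mu_neq muK muE mu_nc]] := ends_matching glue_upK glue_lowK
  glue_no_common_fix outer_inj glue_ends glue_colour.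
move=> /forallP H z z'; rewrite connect_strandE muE; congr (_ || (_ == _)).
have := H z; rewrite connect_strandE muE (negbTE (partner_neq c z)).
by move=> /eqP.
Qed.

Definition glue : diagram l n := xchoose glue_exists.

Lemma glueP : is_glueing a b glue.
Proof. exact: xchooseP. Qed.

Lemma connect_outer z z' :
  connect (strand a b) (outer m z) (outer m z') = (z' == z) || (z' == partner glue z).
Proof. exact: (connect_outer_partner glueP). Qed.

Lemma is_glueingE c : is_glueing a b c = (c == glue).
Proof.
apply/idP/eqP=> [gc|->]; last exact: glueP.
apply: diagram_ext => z; have := connect_outer_partner gc z (partner c z).
rewrite eqxx orbT connect_outer (negbTE (partner_neq c z)).
by move=> /eqP.
Qed.

Lemma partner_glue z z' : z' != z ->
  connect (strand a b) (outer m z) (outer m z') -> partner glue z = z'.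
Proof. by move=> zz'; rewrite connect_outer (negbTE zz') => /eqP->. Qed.

End Glue.

Lemma bpos_lt m n (x : point m n) : bpos x < m + n.
Proof. by case: x => i /=; have := ltn_ord i; lia. Qed.

(** ** Changes of the boundary *)

(** The changes of four positions under a reversal or a rotation by one step. *)
Definition cyclic4 (a b c d : nat) :=
  [|| [&& a < b, b < c & c < d], [&& b < c, c < d & d < a],
      [&& d < a, a < b & b < c] | [&& d < c, c < b & b < a]].

(** Crossing is invariant under reversals and rotations of the boundary circle. *)
Lemma diagram_transport m n m' n' (f : point m n -> point m' n') g
    (a : diagram m n) : cancel f g -> cancel g f ->
    (forall x y z t,
       [&& bpos (f x) < bpos (f y), bpos (f y) < bpos (f z) & bpos (f z) < bpos (f t)] ->
       cyclic4 (bpos x) (bpos y) (bpos z) (bpos t)) ->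
  {b : diagram m' n' | forall x, partner b x = f (partner a (g x))}.
Proof.
move=> fK gK fC; apply: (@diagram_of m' n' (fun x => f (partner a (g x)))).
- by move=> x; rewrite -{2}[x]gK (can_eq fK) partner_neq.
- by move=> x; rewrite fK partnerK gK.
move=> x y; rewrite -{1}[x]gK -{1 2}[y]gK.
have := fC (g x) (g y) (partner a (g x)) (partner a (g y)).
case: ([&& _, _ & _]) => // /(_ isT).
have := partner_noncrossing a (g x) (g y).
have := partner_noncrossing a (g y) (partner a (g x)).
have := partner_noncrossing a (partner a (g y)) (g x).
have := partner_noncrossing a (partner a (g y)) (partner a (g x)).
rewrite /cyclic4 !partnerK => /negbTE H1 /negbTE H2 /negbTE H3 /negbTE H4.
by case/or4P=> H; [move: H4|move: H3|move: H2|move: H1]; rewrite H.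
Qed.

(** Exchanging the two edges, left to right order kept, reverses the boundary
    circle. *)
Definition flip_point m n (x : point m n) : point n m :=
  match x with inl i => inr i | inr j => inl j end.

Lemma flip_pointK m n : cancel (@flip_point m n) (@flip_point n m).
Proof. by case. Qed.

Lemma flip_point_cyclic m n (x y z t : point m n) :
  [&& bpos (flip_point x) < bpos (flip_point y),
      bpos (flip_point y) < bpos (flip_point z)
    & bpos (flip_point z) < bpos (flip_point t)] ->
  cyclic4 (bpos x) (bpos y) (bpos z) (bpos t).
Proof.
have E (u : point m n) : bpos u < m + n /\ bpos (flip_point u) = m + n - (bpos u).+1.
  by split; [exact: bpos_lt | case: u => i /=; have := ltn_ord i; lia].
move: (E x) (E y) (E z) (E t) => [xl ->] [yl ->] [zl ->] [tl ->] H.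
by apply/or4P/Or44; lia.
Qed.

Definition dflip m n (a : diagram m n) : diagram n m :=
  sval (diagram_transport a (@flip_pointK m n) (@flip_pointK n m)
    (@flip_point_cyclic m n)).

Lemma partner_dflip m n (a : diagram m n) x :
  partner (dflip a) x = flip_point (partner a (flip_point x)).
Proof. exact: (svalP (diagram_transport a _ _ _)). Qed.

Lemma dflipK m n : cancel (@dflip m n) (@dflip n m).
Proof. by move=> a; apply: diagram_ext => x; rewrite !partner_dflip !flip_pointK. Qed.

(** The leftmost top point becomes the leftmost bottom point, which rotates the
    boundary circle by one step. *)
Definition bend_point m n (x : point m.+1 n) : point m n.+1 :=
  match x with
  | inl i => if unlift ord0 i is Some i' then inl i' else inr ord0
  | inr j => inr (lift ord0 j)
  end.

Definition unbend_point m n (x : point m n.+1) : point m.+1 n :=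
  match x with
  | inl i => inl (lift ord0 i)
  | inr j => if unlift ord0 j is Some j' then inr j' else inl ord0
  end.

Lemma bend_pointK m n : cancel (@bend_point m n) (@unbend_point m n).
Proof.
move=> [i|j] /=; last by rewrite liftK.
by case: unliftP => [i' ->|->] //=; rewrite unlift_none.
Qed.

Lemma unbend_pointK m n : cancel (@unbend_point m n) (@bend_point m n).
Proof.
move=> [i|j] /=; first by rewrite liftK.
by case: unliftP => [i' ->|->] //=; rewrite unlift_none.
Qed.

Lemma bpos_bend m n (x : point m.+1 n) :
  bpos x = 0 /\ bpos (bend_point x) = m + n \/ bpos x = (bpos (bend_point x)).+1.
Proof.
case: x => [i|j] /=; last by rewrite /bump /=; have := ltn_ord j; lia.
case: unliftP => [i' ->|->] /=; rewrite ?/bump /=; lia.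
Qed.

Lemma bend_point_cyclic m n (x y z t : point m.+1 n) :
  [&& bpos (bend_point x) < bpos (bend_point y),
      bpos (bend_point y) < bpos (bend_point z)
    & bpos (bend_point z) < bpos (bend_point t)] ->
  cyclic4 (bpos x) (bpos y) (bpos z) (bpos t).
Proof.
have := bpos_lt x; have := bpos_lt y; have := bpos_lt z; have := bpos_lt t.
have := bpos_bend x; have := bpos_bend y; have := bpos_bend z; have := bpos_bend t.
case: (posnP (bpos t)) => *; apply/or4P; last by apply: Or41; lia.
by apply: Or43; lia.
Qed.

Definition bend m n (a : diagram m.+1 n) : diagram m n.+1 :=
  sval (diagram_transport a (@bend_pointK m n) (@unbend_pointK m n)
    (@bend_point_cyclic m n)).

Lemma partner_bend m n (a : diagram m.+1 n) x :
  partner (bend a) x = bend_point (partner a (unbend_point x)).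
Proof. exact: (svalP (diagram_transport a _ _ _)). Qed.

Lemma unbend_point_cyclic m n (x y z t : point m n.+1) :
  [&& bpos (unbend_point x) < bpos (unbend_point y),
      bpos (unbend_point y) < bpos (unbend_point z)
    & bpos (unbend_point z) < bpos (unbend_point t)] ->
  cyclic4 (bpos x) (bpos y) (bpos z) (bpos t).
Proof.
have E (u : point m n.+1) := bpos_bend (unbend_point u).
move: (E x) (E y) (E z) (E t); rewrite !unbend_pointK.
have L (u : point m n.+1) := bpos_lt (unbend_point u).
move: (L x) (L y) (L z) (L t).
case: (posnP (bpos (unbend_point x))) => *; apply/or4P; last by apply: Or41; lia.
by apply: Or42; lia.
Qed.

Definition unbend m n (a : diagram m n.+1) : diagram m.+1 n :=
  sval (diagram_transport a (@unbend_pointK m n) (@bend_pointK m n)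
    (@unbend_point_cyclic m n)).

Lemma partner_unbend m n (a : diagram m n.+1) x :
  partner (unbend a) x = unbend_point (partner a (bend_point x)).
Proof. exact: (svalP (diagram_transport a _ _ _)). Qed.

Lemma bendK m n : cancel (@bend m n) (@unbend m n).
Proof.
move=> a; apply: diagram_ext => x.
by rewrite partner_unbend partner_bend !bend_pointK.
Qed.

Lemma unbendK m n : cancel (@unbend m n) (@bend m n).
Proof.
move=> a; apply: diagram_ext => x.
by rewrite partner_bend partner_unbend !unbend_pointK.
Qed.

(** ** Elementary diagrams *)

Lemma id_diagram_ex m : {a : diagram m m | partner a =1 @opposite m}.
Proof.
apply: diagram_of => [[] //|[] //|[x|x] [y|y]] /=; have := ltn_ord x; have := ltn_ord y; lia.
Qed.

Definition id_diagram m := sval (id_diagram_ex m).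

Lemma partner_id m : partner (id_diagram m) =1 @opposite m.
Proof. exact: (svalP (id_diagram_ex m)). Qed.

Section Juxtaposition.
Variables (m m' n n' : nat).

Lemma bpos_juxt_left (x : point m n) :
  bpos (juxt_left m' n' x) = if bpos x < m then bpos x else bpos x + (m' + n').
Proof. by case: x => i /=; have := ltn_ord i; case: ifP; lia. Qed.

Lemma bpos_juxt_right (x : point m' n') : bpos (juxt_right m n x) = m + bpos x.
Proof. by case: x => i /=; have := ltn_ord i; lia. Qed.

Variant juxt_spec : point (m + m') (n + n') -> Type :=
  | JuxtLeft x : juxt_spec (juxt_left m' n' x)
  | JuxtRight y : juxt_spec (juxt_right m n y).

Lemma juxtP z : juxt_spec z.
Proof.
case: z => i; rewrite -(splitK i); case: (split i) => j /=.
- exact: (JuxtLeft (inl j)).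
- exact: (JuxtRight (inl j)).
- exact: (JuxtLeft (inr j)).
- exact: (JuxtRight (inr j)).
Qed.

Lemma juxt_left_inj : injective (@juxt_left m m' n n').
Proof. by move=> [x|x] [y|y] // [] /val_inj ->. Qed.

Lemma juxt_right_inj : injective (@juxt_right m m' n n').
Proof.
by move=> [x|x] [y|y] // [] /addnI/val_inj ->.
Qed.

Lemma juxt_left_right x y : juxt_left m' n' x != juxt_right m n y.
Proof.
apply/eqP; case: x y => x [y|y] // [E]; have := ltn_ord x; rewrite E; lia.
Qed.

Variables (a : diagram m n) (b : diagram m' n').

Definition juxt_partner z : point (m + m') (n + n') :=
  match juxtP z with
  | JuxtLeft x => juxt_left m' n' (partner a x)
  | JuxtRight y => juxt_right m n (partner b y)
  end.

Lemma juxt_partner_left x :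
  juxt_partner (juxt_left m' n' x) = juxt_left m' n' (partner a x).
Proof.
rewrite /juxt_partner; set z := juxt_left _ _ x.
have : z = juxt_left m' n' x by []; case: z / (juxtP z) => y.
  by move/juxt_left_inj->.
by move/esym/eqP; rewrite (negbTE (juxt_left_right _ _)).
Qed.

Lemma juxt_partner_right y :
  juxt_partner (juxt_right m n y) = juxt_right m n (partner b y).
Proof.
rewrite /juxt_partner; set z := juxt_right _ _ y.
have : z = juxt_right m n y by []; case: z / (juxtP z) => x.
  by move/eqP; rewrite (negbTE (juxt_left_right _ _)).
by move/juxt_right_inj->.
Qed.

Lemma juxt_ex : {c : diagram (m + m') (n + n') | partner c =1 juxt_partner}.
Proof.
apply: diagram_of.
- move=> z; case: (juxtP z) => x; rewrite ?juxt_partner_left ?juxt_partner_right.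
    by rewrite (inj_eq juxt_left_inj) partner_neq.
  by rewrite (inj_eq juxt_right_inj) partner_neq.
- by move=> z; case: (juxtP z) => x;
    rewrite ?(juxt_partner_left, juxt_partner_right) partnerK.
move=> z t; case: (juxtP z) => x; case: (juxtP t) => y;
  rewrite ?(juxt_partner_left, juxt_partner_right, bpos_juxt_left, bpos_juxt_right).
- have := partner_noncrossing a x y.
  by case: ifP; case: ifP; case: ifP; case: ifP; lia.
- have := bpos_lt y; have := bpos_lt (partner b y); have := partner_neq a x.
  by case: ifP; case: ifP; lia.
- have := bpos_lt x; have := bpos_lt (partner b x); have := partner_neq a y.
  by case: ifP; case: ifP; lia.
- have := partner_noncrossing b x y; lia.
Qed.

Definition juxt := sval juxt_ex.

Lemma partner_juxt_left x :
  partner juxt (juxt_left m' n' x) = juxt_left m' n' (partner a x).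
Proof. by rewrite (svalP juxt_ex) juxt_partner_left. Qed.

Lemma partner_juxt_right y :
  partner juxt (juxt_right m n y) = juxt_right m n (partner b y).
Proof. by rewrite (svalP juxt_ex) juxt_partner_right. Qed.

Lemma is_juxtapositionE c : is_juxtaposition a b c = (c == juxt).
Proof.
apply/andP/eqP=> [[/forallP Hl /forallP Hr]|->].
  apply: diagram_ext => z; case: (juxtP z) => x.
    by rewrite partner_juxt_left; apply/eqP.
  by rewrite partner_juxt_right; apply/eqP.
by split; apply/forallP=> x; rewrite ?(partner_juxt_left, partner_juxt_right).
Qed.

End Juxtaposition.

(** The diagram with a cup joining the points [i] and [i + 1] of its bottom
    edge, and with vertical strands otherwise. *)
Section Cup.
Variables (N : nat) (i : 'I_N.+1).

Definition skip2 (x : 'I_N) : 'I_N.+2 :=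
  inord (if x < i then (x : nat) else x.+2).
Definition cup_left : 'I_N.+2 := inord i.
Definition cup_right : 'I_N.+2 := inord i.+1.

Lemma skip2E x : skip2 x = (if x < i then (x : nat) else x.+2) :> nat.
Proof. by rewrite inordK //; have := ltn_ord x; case: ifP; lia. Qed.
Lemma cup_leftE : cup_left = i :> nat.
Proof. by rewrite inordK //; have := ltn_ord i; lia. Qed.
Lemma cup_rightE : cup_right = i.+1 :> nat.
Proof. by rewrite inordK //; have := ltn_ord i; lia. Qed.

Lemma skip2_inj : injective skip2.
Proof.
move=> x y /(congr1 (@nat_of_ord _)); rewrite !skip2E => E; apply: val_inj => /=.
by move: E; case: ifP; case: ifP; lia.
Qed.

Lemma skip2_left x : (skip2 x == cup_left) = false.
Proof. by apply/eqP=> /(congr1 (@nat_of_ord _)); rewrite skip2E cup_leftE; case: ifP; lia. Qed.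
Lemma skip2_right x : (skip2 x == cup_right) = false.
Proof. by apply/eqP=> /(congr1 (@nat_of_ord _)); rewrite skip2E cup_rightE; case: ifP; lia. Qed.
Lemma cup_right_left : (cup_right == cup_left) = false.
Proof. by apply/eqP=> /(congr1 (@nat_of_ord _)); rewrite cup_leftE cup_rightE; lia. Qed.

Variant skip2_spec : 'I_N.+2 -> Type :=
  | SkipLeft : skip2_spec cup_left
  | SkipRight : skip2_spec cup_right
  | Skip2 x : skip2_spec (skip2 x).

Lemma skip2P y : skip2_spec y.
Proof.
have := ltn_ord y; have := ltn_ord i => iN yN.
have [lt|gt|eq] := ltngtP y i.
- have xN : y < N by lia.
  have -> : y = skip2 (Ordinal xN); last exact: Skip2.
  by apply: val_inj; rewrite [RHS]skip2E /= lt.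
- have [eq|neq] := eqVneq (y : nat) i.+1.
    have -> : y = cup_right; last exact: SkipRight.
    by apply: val_inj; rewrite [RHS]cup_rightE.
  have xN : y - 2 < N by lia.
  have -> : y = skip2 (Ordinal xN); last exact: Skip2.
  by apply: val_inj; rewrite [RHS]skip2E /=; case: ifP; lia.
- have -> : y = cup_left; last exact: SkipLeft.
  by apply: val_inj; rewrite [RHS]cup_leftE.
Qed.

Definition cup_partner (x : point N N.+2) : point N N.+2 :=
  match x with
  | inl x => inr (skip2 x)
  | inr y => match skip2P y with
             | SkipLeft => inr cup_right
             | SkipRight => inr cup_left
             | Skip2 x => inl x
             end
  end.

Lemma cup_partner_left : cup_partner (inr cup_left) = inr cup_right.
Proof.
rewrite /=; set y := cup_left; have : y = cup_left by [].
case: y / (skip2P y) => [//|->//|x /eqP].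
by rewrite skip2_left.
Qed.
Lemma cup_partner_right : cup_partner (inr cup_right) = inr cup_left.
Proof.
rewrite /=; set y := cup_right; have : y = cup_right by [].
case: y / (skip2P y) => [->//|//|x /eqP].
by rewrite skip2_right.
Qed.
Lemma cup_partner_skip x : cup_partner (inr (skip2 x)) = inl x.
Proof.
rewrite /=; set y := skip2 x; have : y = skip2 x by [].
case: y / (skip2P y) => [||z] /eqP; rewrite 1?eq_sym ?skip2_left ?skip2_right //.
by move/eqP/skip2_inj->.
Qed.

Lemma cup_ex : {a : diagram N N.+2 | partner a =1 cup_partner}.
Proof.
have E := (cup_partner_left, cup_partner_right, cup_partner_skip).
apply: diagram_of.
- case=> [x|y] //; case: (skip2P y) => [||x]; rewrite E //.
    by rewrite (inj_eq (@inr_inj _ _)) cup_right_left.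
  by rewrite (inj_eq (@inr_inj _ _)) eq_sym cup_right_left.
- case=> [x|y]; first exact: cup_partner_skip.
  by case: (skip2P y) => [||x]; rewrite !E.
have V := (skip2E, cup_leftE, cup_rightE).
have iN := ltn_ord i.
case=> [x|x] [y|y]; try (case: (skip2P x) => [||{}x]);
  try (case: (skip2P y) => [||{}y]); rewrite ?E /= ?V;
  try (have := ltn_ord x); try (have := ltn_ord y); repeat (case: ifP); lia.
Qed.

Definition cup := sval cup_ex.

Lemma partner_cup : partner cup =1 cup_partner.
Proof. exact: (svalP cup_ex). Qed.

End Cup.

(** * Closing a diagram by another one *)

(** Two diagrams with the same boundary, one drawn inside the rectangle and the
    other one outside, form closed curves. *)
Definition nb_curves m n (a b : diagram m n) : nat :=
  n_comp (inv_rel (partner a) (partner b)) (point m n).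

Lemma nb_curvesC m n (a b : diagram m n) : nb_curves a b = nb_curves b a.
Proof. by apply: eq_n_comp; apply: eq_connect => x y; rewrite /inv_rel /= orbC. Qed.

Lemma inv_partner_sym m n (a b : diagram m n) :
  connect_sym (inv_rel (partner a) (partner b)).
Proof. by apply: sym_connect_sym; apply: inv_rel_sym; apply: partnerK. Qed.

Lemma nb_curves_relabel m n m' n' (f : point m n -> point m' n') g (a b : diagram m n)
    (a' b' : diagram m' n') : cancel f g -> cancel g f ->
    (forall x, partner a' (f x) = f (partner a x)) ->
    (forall x, partner b' (f x) = f (partner b x)) -> nb_curves a' b' = nb_curves a b.
Proof.
move=> fK gK aE bE; apply: esym; rewrite /nb_curves.
apply: (n_comp_retract (r := f) (i := g)); try exact: inv_partner_sym; try done.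
- by move=> x; rewrite fK.
- move=> x y H; apply: connect1; move: H; rewrite /inv_rel /=.
  by case/orP=> /eqP->; rewrite -?aE -?bE eqxx ?orbT.
move=> x y H; apply: connect1; move: H; rewrite /inv_rel /=.
by rewrite -[x]gK aE bE => /orP[] /eqP->; rewrite !fK eqxx ?orbT.
Qed.

Lemma nb_curves_flip m n (a b : diagram m n) : nb_curves (dflip a) (dflip b) = nb_curves a b.
Proof.
by apply: (nb_curves_relabel (@flip_pointK m n) (@flip_pointK n m)) => x;
  rewrite partner_dflip flip_pointK.
Qed.

Lemma nb_curves_bend m n (a b : diagram m.+1 n) : nb_curves (bend a) (bend b) = nb_curves a b.
Proof.
by apply: (nb_curves_relabel (@bend_pointK m n) (@unbend_pointK m n)) => x;
  rewrite partner_bend bend_pointK.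
Qed.

Section GlueFlip.
Variables l m n : nat.

Definition flip_stack (u : stack l m n) : stack n m l :=
  match u with
  | inl (inl i) => inr i
  | inl (inr j) => inl (inr j)
  | inr k => inl (inl k)
  end.

Lemma strand_flip (a : diagram l m) (b : diagram m n) u v :
  strand a b u v -> strand (dflip b) (dflip a) (flip_stack u) (flip_stack v).
Proof.
case/strandP=> -[x [-> ->]].
  have E y : flip_stack (upper n y) = lower n (flip_point y) by case: y.
  by rewrite !E; have := strand_lower (dflip b) (dflip a) (flip_point x);
    rewrite partner_dflip flip_pointK.
have E y : flip_stack (lower l y) = upper l (flip_point y) by case: y.
by rewrite !E; have := strand_upper (dflip b) (dflip a) (flip_point x);
  rewrite partner_dflip flip_pointK.
Qed.

End GlueFlip.

Lemma flip_stackK l m n : cancel (@flip_stack l m n) (@flip_stack n m l).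
Proof. by case=> [[]|]. Qed.

Lemma connect_flip l m n (a : diagram l m) (b : diagram m n) u v :
  connect (strand (dflip b) (dflip a)) (flip_stack u) (flip_stack v)
    = connect (strand a b) u v.
Proof.
have sub l' m' n' (a' : diagram l' m') (b' : diagram m' n') u' v' :
    connect (strand a' b') u' v' ->
  connect (strand (dflip b') (dflip a')) (flip_stack u') (flip_stack v').
  move=> uv; apply: (connect_ind (P := fun z => connect (strand (dflip b') (dflip a'))
     (flip_stack u') (flip_stack z)) _ _ uv) => // x y ux xy.
  by apply: connect_trans ux (connect1 _); apply: strand_flip.
apply/idP/idP=> [/sub|/sub //]; by rewrite !dflipK !flip_stackK.
Qed.

Lemma flip_outer l m n (z : point l n) :
  flip_stack (outer m z) = outer m (flip_point z).
Proof. by case: z. Qed.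

Lemma glue_flip l m n (a : diagram l m) (b : diagram m n) :
  glue (dflip b) (dflip a) = dflip (glue a b).
Proof.
apply: esym; apply/eqP; rewrite -is_glueingE; apply/forallP=> z.
have -> : outer m z = flip_stack (outer m (flip_point z)).
  by rewrite flip_outer flip_pointK.
rewrite partner_dflip -[X in connect _ _ X]flip_outer connect_flip.
by rewrite connect_outer eqxx orbT.
Qed.

Lemma nb_loops_flip l m n (a : diagram l m) (b : diagram m n) :
  nb_loops (dflip b) (dflip a) = nb_loops a b.
Proof.
have cl : closed (strand (dflip b) (dflip a))
    [pred u | [forall z, ~~ connect (strand (dflip b) (dflip a)) u (outer m z)]].
  apply: (intro_closed (strand_sym _ _)) => x y xy /forallP H; apply/forallP=> z.
  by rewrite -(same_connect1 (strand_sym _ _) xy).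
rewrite /nb_loops (adjunction_n_comp (@flip_stack l m n) (strand_sym _ _)
  (strand_sym a b) cl).
  apply: eq_n_comp_r => u; rewrite !inE; apply/forallP/forallP=> H z.
    by rewrite -connect_flip flip_outer.
  by rewrite -[z]flip_pointK -flip_outer connect_flip.
split=> [x _|x y _]; last by rewrite connect_flip.
by exists (flip_stack x); rewrite flip_stackK.
Qed.

Lemma nb_loops_eq0 l m n (a : diagram l m) (b : diagram m n) :
    (forall u, exists z, connect (strand a b) u (outer m z)) ->
  nb_loops a b = 0.
Proof.
move=> H; apply: eq_card0 => u; rewrite !inE; apply/negP=> /andP[_ /forallP Hu].
by case: (H u) => z uz; have := Hu z; rewrite uz.
Qed.

(** ** Closing a composite *)

Section Triangle.
Variables l m p : nat.

(** The upper diagram [a], the lower diagram [g] and, outside, the diagram [b]. *)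
Definition closed_stack (a : diagram l m) (g : diagram m p) (b : diagram l p) :=
  plug_rel (strand a g) (@outer l m p) [rel u v | v == partner b u].

Lemma partner_rel_sym m' n' (b : diagram m' n') :
  symmetric [rel u v | v == partner b u].
Proof. by move=> u v /=; apply/eqP/eqP=> ->; rewrite partnerK. Qed.

Lemma n_comp_closed_stack (a : diagram l m) (g : diagram m p) (b : diagram l p) :
  n_comp (closed_stack a g b) (stack l m p) = nb_loops a g + nb_curves (glue a g) b.
Proof.
by rewrite (n_comp_plug (strand_sym a g) (@partner_rel_sym _ _ b) (connect_outer a g)).
Qed.

Definition swap_stack (u : stack l m p) : stack m l p :=
  match u with
  | inl (inl i) => inl (inr i)
  | inl (inr j) => inl (inl j)
  | inr k => inr k
  end.

Lemma swap_upper x : swap_stack (upper p x) = upper p (flip_point x).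
Proof. by case: x. Qed.
Lemma swap_lower x : swap_stack (lower l x) = outer l x.
Proof. by case: x. Qed.
Lemma swap_outer x : swap_stack (outer m x) = lower m x.
Proof. by case: x. Qed.

Lemma closed_stack_sym (a : diagram l m) (g : diagram m p) (b : diagram l p) :
  connect_sym (closed_stack a g b).
Proof. exact: plug_rel_sym (strand_sym a g) (@partner_rel_sym _ _ b). Qed.

End Triangle.

Lemma closed_stack_swap l m p (a : diagram l m) (g : diagram m p) (b : diagram l p) x y :
  closed_stack a g b x y ->
  connect (closed_stack (dflip a) b g) (swap_stack x) (swap_stack y).
Proof.
move=> xy; apply/connect1/plug_relP.
case/plug_relP: xy => [/strandP[]|[u [v [/eqP-> -> ->]]]].
- case=> u [-> ->]; left; rewrite !swap_upper.
  by have := strand_upper (dflip a) b (flip_point u); rewrite partner_dflip flip_pointK.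
- by case=> u [-> ->]; right; exists u, (partner g u); rewrite /= !swap_lower.
- by left; rewrite !swap_outer; apply: strand_lower.
Qed.

Lemma swap_stackK l m p : cancel (@swap_stack l m p) (@swap_stack m l p).
Proof. by case=> [[]|]. Qed.

(** Both sides count the curves of the same picture, in which [a], [g] and [b]
    are glued pairwise along the three edges. All the associativity and
    cyclicity that negligible morphisms need is contained in this identity. *)
Lemma nb_curves_glue l m p (a : diagram l m) (g : diagram m p) (b : diagram l p) :
  nb_loops a g + nb_curves (glue a g) b
    = nb_loops (dflip a) b + nb_curves g (glue (dflip a) b).
Proof.
rewrite [in RHS]nb_curvesC -!n_comp_closed_stack.
apply: (n_comp_retract (r := @swap_stack l m p) (i := @swap_stack m l p)).
- exact: closed_stack_sym.
- exact: closed_stack_sym.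
- by move=> x; rewrite swap_stackK.
- exact: swap_stackK.
- by move=> x y; apply: closed_stack_swap.
by move=> x y /closed_stack_swap; rewrite dflipK.
Qed.

(** ** Identities *)

Lemma connect_id_upper m n (a : diagram n m) z :
  connect (strand a (id_diagram m)) (outer m z) (upper m z).
Proof.
case: z => [i|j] //; apply: connect1.
have := strand_lower a (id_diagram m) (inr j).
by rewrite partner_id.
Qed.

Lemma glue_idr m n (a : diagram n m) : glue a (id_diagram m) = a.
Proof.
apply/esym/eqP; rewrite -is_glueingE; apply/forallP=> z.
apply: connect_trans (connect_id_upper a z) _; rewrite strand_sym.
apply: connect_trans (connect_id_upper a _) _; rewrite strand_sym.
by apply: connect1; apply: strand_upper.
Qed.

Lemma nb_loops_idr m n (a : diagram n m) : nb_loops a (id_diagram m) = 0.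
Proof.
apply: nb_loops_eq0 => -[x|k]; last by exists (inr k).
by exists x; rewrite strand_sym connect_id_upper.
Qed.

Lemma dflip_id m : dflip (id_diagram m) = id_diagram m.
Proof.
apply: diagram_ext => x; rewrite partner_dflip !partner_id.
by case: x.
Qed.

Lemma glue_idl m n (a : diagram m n) : glue (id_diagram m) a = a.
Proof. by rewrite -[RHS]dflipK -[dflip a in RHS]glue_idr -glue_flip dflipK dflip_id. Qed.

Lemma nb_loops_idl m n (a : diagram m n) : nb_loops (id_diagram m) a = 0.
Proof. by rewrite -nb_loops_flip dflip_id nb_loops_idr. Qed.

Lemma nb_closure_loops_curves n (a : diagram n n) : nb_closure_loops a = nb_curves a (id_diagram n).
Proof.
rewrite /nb_closure_loops /nb_curves; apply: eq_n_comp.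
by apply: eq_connect => x y; rewrite /inv_rel /= partner_id.
Qed.

(** The Markov trace of a composite only depends on the curves that the two
    factors form together: close by the identity and move one factor outside. *)
Lemma closure_glue m n (b : diagram m n) (a : diagram n m) :
  nb_loops b a + nb_closure_loops (glue b a) = nb_curves a (dflip b).
Proof. by rewrite nb_closure_loops_curves nb_curves_glue nb_loops_idr glue_idr. Qed.

(** ** Closing part of a diagram *)

(** The boundary of [b] consists of two parts that do not interleave; a diagram
    [g] closes the second part, and [b] induces a diagram on the first one. This
    is what makes negligible morphisms stable under tensor products. *)
Section PartialClosure.
Variables (m n m' n' p q : nat).
Variables (h : point m n -> point p q) (k : point m' n' -> point p q).
Hypotheses (h_inj : injective h) (k_inj : injective k).
Hypothesis h_mono : forall u v, (bpos (h u) < bpos (h v)) = (bpos u < bpos v).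
Hypothesis k_mono : forall u v, (bpos (k u) < bpos (k v)) = (bpos u < bpos v).
Hypothesis hk : forall u v, h u != k v.
Hypothesis hk_split : forall x, (exists u, x = h u) \/ (exists v, x = k v).
Hypothesis hkhk : forall u v u' v',
  ~~ [&& bpos (h u) < bpos (k v), bpos (k v) < bpos (h u') & bpos (h u') < bpos (k v')].
Hypothesis khkh : forall u v u' v',
  ~~ [&& bpos (k v) < bpos (h u), bpos (h u) < bpos (k v') & bpos (k v') < bpos (h u')].

Lemma sum_split (F : point p q -> nat) :
  \sum_x F x = \sum_u F (h u) + \sum_v F (k v).
Proof.
pose f (w : point m n + point m' n') := match w with inl u => h u | inr v => k v end.
have f_inj : injective f.
  move=> [u|v] [u'|v'] /=.
  - by move/h_inj->.
  - by move/eqP; rewrite (negbTE (hk _ _)).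
  - by move/esym/eqP; rewrite (negbTE (hk _ _)).
  - by move/k_inj->.
have f_surj x : exists w, f w == x.
  by case: (hk_split x) => -[w ->]; [exists (inl w)|exists (inr w)] => /=.
pose g' x := xchoose (f_surj x).
have g'K : cancel g' f by move=> x; apply/eqP/(xchooseP (f_surj x)).
rewrite (reindex f) ?big_sumType //.
by exists g' => x _ //; apply: f_inj; rewrite g'K.
Qed.

Variables (b : diagram p q) (g : diagram m' n').

Definition closing (x : point p q) : point p q :=
  if [pick v | k v == x] is Some v then k (partner g v) else x.

Lemma closing_k v : closing (k v) = k (partner g v).
Proof.
rewrite /closing; case: pickP => [w /eqP/k_inj-> //|/(_ v)].
by rewrite eqxx.
Qed.

Lemma closing_h u : closing (h u) = h u.
Proof.
rewrite /closing; case: pickP => // v /eqP E.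
by have := hk u v; rewrite E eqxx.
Qed.

Lemma closingK : involutive closing.
Proof.
move=> x; case: (hk_split x) => -[y ->]; first by rewrite !closing_h.
by rewrite !closing_k partnerK.
Qed.

(** Such an interval contains the values at all indices or at none. *)
Lemma odd_block (I : finType) (f : I -> nat) (P : pred I) lo hi :
    odd (\sum_i (P i : nat)) = false ->
    (forall i j, lo < f i < hi -> lo < f j < hi) ->
  odd (\sum_i (P i && (lo < f i < hi) : nat)) = false.
Proof.
move=> P0 H; have [/existsP[i0 Hi0]|/existsPn Hn] := boolP [exists i, lo < f i < hi].
  rewrite -[RHS]P0; congr odd; apply: eq_bigr => i _.
  by rewrite (H _ i Hi0) andbT.
by rewrite big1 // => i _; rewrite (negbTE (Hn i)) andbF.
Qed.

Lemma sum_below (I : finType) (f : I -> nat) (P : pred I) lo hi :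
    lo <= hi -> (forall i, P i -> f i <> lo) ->
  \sum_i (P i && (f i < hi) : nat)
    = \sum_i (P i && (f i < lo) : nat) + \sum_i (P i && (lo < f i < hi) : nat).
Proof.
move=> le H; rewrite -big_split; apply: eq_bigr => i _ /=.
case Pi: (P i) => //=; have := H i Pi; lia.
Qed.

(** The colour is the parity of the number of points of [gam] before a point. As
    the parts do not interleave, the first part does not separate the points of
    the second one, nor conversely, except by all of its points; and both parts
    have an even number of points in [gam]. *)
Lemma closing_colour (gam : pred (point p q)) :
  (forall x, gam (partner b x) = gam x) -> (forall x, gam (closing x) = gam x) ->
  exists s : point p q -> bool,
  [/\ forall x, ~~ gam x -> s (partner b x) = s x,
      forall x, ~~ gam x -> s (closing x) = s x
    & forall u u', ~~ gam (h u) -> ~~ gam (h u') -> bpos u < bpos u' ->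
        s (h u) (+) s (h u')
          = odd (\sum_v (gam (h v) && (bpos u < bpos v < bpos u') : nat))].
Proof.
move=> gb gc.
pose H := [pred u | gam (h u)]; pose K := [pred v | gam (k v)].
have Kg v : K (partner g v) = K v by rewrite /K /= -closing_k gc.
have K0 := even_sum_involution (@partnerK _ _ g) (@partner_neq _ _ g) Kg.
have H0 : odd (\sum_u (H u : nat)) = false.
  have := even_sum_involution (@partnerK _ _ b) (@partner_neq _ _ b) gb.
  by rewrite sum_split oddD [X in _ (+) X]K0 addbF.
exists (fun x => odd (\sum_y (gam y && (bpos y < bpos x) : nat))).
have Hk v v' : odd (\sum_u (H u && (bpos (h u) < bpos (k v)) : nat))
             = odd (\sum_u (H u && (bpos (h u) < bpos (k v')) : nat)).
  wlog le : v v' / bpos (k v) <= bpos (k v') => [W|].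
    by case: (leqP (bpos (k v)) (bpos (k v'))) => [/W//|/ltnW/W].
  rewrite (sum_below le) => [|u _ /bpos_inj/eqP]; last by rewrite (negbTE (hk _ _)).
  rewrite oddD (odd_block H0) ?addbF // => u u'.
  have := hkhk u' v u v'; have := khkh u v u' v'.
  have : bpos (h u') <> bpos (k v) by move=> /bpos_inj/eqP; rewrite (negbTE (hk _ _)).
  have : bpos (h u') <> bpos (k v') by move=> /bpos_inj/eqP; rewrite (negbTE (hk _ _)).
  lia.
split.
- by move=> x gx; apply: odd_below.
- move=> x gx; case: (hk_split x) => -[v E]; subst x; first by rewrite closing_h.
  rewrite closing_k !sum_split !oddD; congr (_ (+) _); first exact: Hk.
  rewrite (eq_bigr _ (fun v' _ => congr1 (fun c => (gam (k v') && c : nat)) (k_mono v' _))).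
  rewrite [in RHS](eq_bigr _ (fun v' _ => congr1 (fun c => (gam (k v') && c : nat)) (k_mono v' _))).
  exact: (odd_below Kg).
move=> u u' gu gu' uu'.
rewrite (@sum_below _ _ gam (bpos (h u)) (bpos (h u'))); last 2 first.
- by rewrite ltnW ?h_mono.
- by move=> y gy /bpos_inj E; move: gu; rewrite -E gy.
rewrite oddD addbA addbb /= sum_split oddD.
have -> : odd (\sum_v (gam (k v) && (bpos (h u) < bpos (k v) < bpos (h u')) : nat)) = false.
  apply: (odd_block K0) => v v'.
  have := hkhk u v u' v'; have := khkh u v' u' v.
  have : bpos (h u) <> bpos (k v') by move=> /bpos_inj/eqP; rewrite (negbTE (hk _ _)).
  have : bpos (h u') <> bpos (k v') by move=> /bpos_inj/eqP; rewrite (negbTE (hk _ _)).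
  have : bpos (h u) < bpos (h u') by rewrite h_mono.
  lia.
by rewrite addbF; congr odd; apply: eq_bigr => v _; rewrite !h_mono.
Qed.

(** The number [r] counts the loops that [b] and [g] close off. *)
Lemma partial_closure : exists (b' : diagram m n) (r : nat),
  forall (a : diagram m n) (c : diagram p q),
    (forall u, partner c (h u) = h (partner a u)) ->
    (forall v, partner c (k v) = k (partner g v)) -> nb_curves c b = r + nb_curves a b'.
Proof.
have cl_ends x : end_point (partner b) closing x = (x \in codom h).
  rewrite /end_point (negbTE (partner_neq b x)) /=.
  apply/eqP/codomP=> [E|[u ->]]; last exact: closing_h.
  case: (hk_split x) => -[v xE]; first by exists v.
  by move/eqP: E; rewrite xE closing_k (inj_eq k_inj) (negbTE (partner_neq g v)).
have ncf x : ~~ ((partner b x == x) && (closing x == x)).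
  by rewrite (negbTE (partner_neq b x)).
have [mu [mu_neq muK muE mu_nc]] := ends_matching (@partnerK _ _ b) closingK
  ncf h_inj cl_ends closing_colour.
have [b' b'E] := diagram_of mu_neq muK mu_nc.
pose e := inv_rel (partner b) closing.
exists b', (n_comp e [pred x | [forall u, ~~ connect e x (h u)]]) => a c ch ck.
have sym_e : connect_sym e := sym_connect_sym (inv_rel_sym (@partnerK _ _ b) closingK).
have e2_sym : symmetric [rel u v | v == partner a u].
  by move=> u v /=; apply/eqP/eqP=> ->; rewrite partnerK.
have -> : nb_curves a b' = n_comp (plugged_rel mu [rel u v | v == partner a u]) (point m n).
  apply: eq_n_comp; apply: eq_connect => u v.
  by rewrite /inv_rel /plugged_rel /= b'E orbC.
rewrite -(n_comp_plug sym_e e2_sym muE) /nb_curves.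
apply: eq_n_comp => x y; apply/idP/idP; apply: connect_sub => {x y} x y.
  case/orP=> /eqP->; last by apply/connect1/plug_relP; left; rewrite /e /inv_rel /= eqxx.
  case: (hk_split x) => -[u ->].
    by rewrite ch; apply/connect1/plug_relP; right; exists u, (partner a u); rewrite /= eqxx.
  rewrite ck -closing_k; apply/connect1/plug_relP; left.
  by rewrite /e /inv_rel /= eqxx orbT.
case/plug_relP=> [/orP[]/eqP->|[u [v [/eqP-> -> ->]]]].
- by apply: connect1; rewrite /inv_rel /= eqxx orbT.
- case: (hk_split x) => -[u ->]; first by rewrite closing_h.
  by rewrite closing_k -ck; apply: connect1; rewrite /inv_rel /= eqxx.
- by rewrite -ch; apply: connect1; rewrite /inv_rel /= eqxx.
Qed.

End PartialClosure.

Section JuxtClosure.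
Variables (m m' n n' : nat).

Lemma juxt_left_mono (u v : point m n) :
  (bpos (juxt_left m' n' u) < bpos (juxt_left m' n' v)) = (bpos u < bpos v).
Proof. by rewrite !bpos_juxt_left; case: ifP; case: ifP; lia. Qed.

Lemma juxt_right_mono (u v : point m' n') :
  (bpos (juxt_right m n u) < bpos (juxt_right m n v)) = (bpos u < bpos v).
Proof. by rewrite !bpos_juxt_right; lia. Qed.

Lemma juxt_no_interleave (u : point m n) (v : point m' n') (u' : point m n)
    (v' : point m' n') :
  ~~ [&& bpos (juxt_left m' n' u) < bpos (juxt_right m n v),
         bpos (juxt_right m n v) < bpos (juxt_left m' n' u')
       & bpos (juxt_left m' n' u') < bpos (juxt_right m n v')].
Proof.
rewrite !bpos_juxt_left !bpos_juxt_right.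
have := bpos_lt v; have := bpos_lt v'; case: ifP; case: ifP; lia.
Qed.

Lemma juxt_no_interleave' (u : point m n) (v : point m' n') (u' : point m n)
    (v' : point m' n') :
  ~~ [&& bpos (juxt_right m n v) < bpos (juxt_left m' n' u),
         bpos (juxt_left m' n' u) < bpos (juxt_right m n v')
       & bpos (juxt_right m n v') < bpos (juxt_left m' n' u')].
Proof.
rewrite !bpos_juxt_left !bpos_juxt_right.
have := bpos_lt v; have := bpos_lt v'; case: ifP; case: ifP; lia.
Qed.

Lemma nb_curves_juxt_left (g : diagram m' n') (b : diagram (m + m') (n + n')) :
  exists b' r, forall a : diagram m n, nb_curves (juxt a g) b = r + nb_curves a b'.
Proof.
have [|b' [r H]] := partial_closure (@juxt_left_inj m m' n n') (@juxt_right_inj m m' n n')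
  juxt_left_mono juxt_right_mono (@juxt_left_right m m' n n') _ juxt_no_interleave
  juxt_no_interleave' b g.
  by move=> x; case: (juxtP x) => y; [left|right]; exists y.
exists b', r => a; apply: H => u; first exact: partner_juxt_left.
exact: partner_juxt_right.
Qed.

Lemma nb_curves_juxt_right (g : diagram m n) (b : diagram (m + m') (n + n')) :
  exists b' r, forall a : diagram m' n', nb_curves (juxt g a) b = r + nb_curves a b'.
Proof.
have rl (y : point m' n') (x : point m n) : juxt_right m n y != juxt_left m' n' x.
  by rewrite eq_sym juxt_left_right.
have [|b' [r H]] := partial_closure (@juxt_right_inj m m' n n') (@juxt_left_inj m m' n n')
  juxt_right_mono juxt_left_mono rl _
  (fun u v u' v' => juxt_no_interleave' v u v' u')
  (fun u v u' v' => juxt_no_interleave v u v' u') b g.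
  by move=> x; case: (juxtP x) => y; [right|left]; exists y.
exists b', r => a; apply: H => u; first exact: partner_juxt_right.
exact: partner_juxt_left.
Qed.

End JuxtClosure.

(** ** Capping two neighbouring points *)

Section GlueCup.
Variables (N k : nat) (i : 'I_N.+1) (D : diagram N.+2 k).

Definition skip_point (z : point N k) : point N.+2 k :=
  match z with inl x => inl (skip2 i x) | inr y => inr y end.
Definition cap_left : point N.+2 k := inl (cup_left i).
Definition cap_right : point N.+2 k := inl (cup_right i).

Lemma skip_point_inj : injective skip_point.
Proof. by move=> [x|x] [y|y] // []; [move/skip2_inj->|move->]. Qed.

Lemma skip_point_left z : (skip_point z == cap_left) = false.
Proof. by case: z => // x; rewrite (inj_eq (@inl_inj _ _)) skip2_left. Qed.
Lemma skip_point_right z : (skip_point z == cap_right) = false.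
Proof. by case: z => // x; rewrite (inj_eq (@inl_inj _ _)) skip2_right. Qed.
Lemma cap_right_left : (cap_right == cap_left) = false.
Proof. by rewrite (inj_eq (@inl_inj _ _)) cup_right_left. Qed.

Variant skip_point_spec : point N.+2 k -> Type :=
  | PointLeft : skip_point_spec cap_left
  | PointRight : skip_point_spec cap_right
  | PointSkip z : skip_point_spec (skip_point z).

Lemma skip_pointP x : skip_point_spec x.
Proof.
case: x => [x|y]; last exact: (PointSkip (inr y)).
case: (skip2P i x) => [||z]; [exact: PointLeft|exact: PointRight|].
exact: (PointSkip (inl z)).
Qed.

Let e := strand (cup i) D.
Let sym_e : connect_sym e := strand_sym _ _.

Lemma connect_skip z : connect e (outer N.+2 z) (lower N (skip_point z)).
Proof.
case: z => [x|y] //; apply: connect1.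
by have := strand_upper (cup i) D (inl x); rewrite partner_cup.
Qed.

Lemma connect_cap : connect e (lower N cap_left) (lower N cap_right).
Proof.
apply: connect1.
by have := strand_upper (cup i) D (inr (cup_left i)); rewrite partner_cup cup_partner_left.
Qed.

Lemma glue_cup_skip z z' : partner D (skip_point z) = skip_point z' ->
  partner (glue (cup i) D) z = z'.
Proof.
move=> E; apply: partner_glue.
  by have := partner_neq D (skip_point z); rewrite E (inj_eq skip_point_inj).
apply: connect_trans (connect_skip z) _; rewrite sym_e.
apply: connect_trans (connect_skip z') _; rewrite sym_e -E.
exact/connect1/strand_lower.
Qed.

(** The two strands that end at the cup are joined through it. *)
Lemma glue_cup_turn z z' : partner D cap_left = skip_point z ->
  partner D cap_right = skip_point z' -> partner (glue (cup i) D) z = z'.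
Proof.
move=> E E'; apply: partner_glue.
  rewrite -(inj_eq skip_point_inj) -E -E' (inj_eq (@partner_inj _ _ D)).
  by rewrite cap_right_left.
apply: connect_trans (connect_skip z) _; rewrite sym_e.
apply: connect_trans (connect_skip z') _; rewrite sym_e -E -E'.
apply: (@connect_trans _ _ (lower N cap_left)).
  by rewrite sym_e; apply/connect1/strand_lower.
by apply: connect_trans connect_cap _; apply/connect1/strand_lower.
Qed.

Lemma nb_loops_cup0 : partner D cap_left != cap_right -> nb_loops (cup i) D = 0.
Proof.
move=> neq; have cl : exists z, connect e (lower N cap_left) (outer N.+2 z).
  have := strand_lower (cup i) D cap_left; have := partner_neq D cap_left.
  case: (skip_pointP (partner D cap_left)) neq => [|/eqP//|z _ _ lz]; first by rewrite eqxx.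
  by exists z; apply: connect_trans (connect1 lz) _; rewrite sym_e connect_skip.
apply: nb_loops_eq0 => -[[x|y]|y]; [by exists (inl x)| |by exists (inr y)].
case: (skip2P i y) => [//||x]; last first.
  by exists (inl x); have := connect_skip (inl x); rewrite sym_e.
by case: cl => z lz; exists z; apply: connect_trans lz; rewrite sym_e; apply: connect_cap.
Qed.

Lemma nb_loops_cup1 : partner D cap_left = cap_right -> nb_loops (cup i) D = 1.
Proof.
move=> E; rewrite -(n_comp_connect sym_e (lower N cap_left)).
have cl x y : e x y -> x \in [pred u | (u == lower N cap_left) || (u == lower N cap_right)] ->
    y \in [pred u | (u == lower N cap_left) || (u == lower N cap_right)].
  have E' : partner D cap_right = cap_left by rewrite -E partnerK.
  case/strandP=> -[z [-> ->]]; rewrite !inE.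
    rewrite -[lower N cap_left]/(upper k (inr (cup_left i))).
    rewrite -[lower N cap_right]/(upper k (inr (cup_right i))).
    by rewrite !(inj_eq (@upper_inj _ _ _)) partner_cup => /orP[]/eqP->;
      rewrite ?cup_partner_left ?cup_partner_right eqxx ?orbT.
  by rewrite !(inj_eq (@lower_inj _ _ _)) => /orP[]/eqP->; rewrite ?E ?E' eqxx ?orbT.
apply: eq_n_comp_r => u; rewrite !inE; apply/forallP/idP=> [H|lu z].
  have out z : connect e u (outer N.+2 z) -> false by rewrite (negbTE (H z)).
  case: u H out => [[x|y]|y] H out; [by have := out (inl x) (connect0 _ _)| |
    by have := out (inr y) (connect0 _ _)].
  case: (skip2P i y) H out => [||x] H out //; first exact: connect_cap.
  by have := out (inl x); rewrite sym_e connect_skip => /(_ isT).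
apply/negP=> uz; have lz := connect_trans lu uz.
have := closed_connect (intro_closed sym_e cl) lz; rewrite !inE eqxx /=.
case: z {uz lz} => [x|y]; first by case/esym/orP=> /eqP.
by case/esym/orP=> /eqP.
Qed.

End GlueCup.

Lemma partner_cap N k (i : 'I_N.+1) (c : diagram N k) :
  partner (glue (dflip (cup i)) c) (cap_left k i) = cap_right k i.
Proof.
apply: partner_glue; first by rewrite cap_right_left.
apply: connect1; have := strand_upper (dflip (cup i)) c (inl (cup_left i)).
by rewrite partner_dflip partner_cup cup_partner_left.
Qed.

(** Capping [D] off with a cup only turns its cap at [i] into a loop, so that
    putting the cap back recovers [D]. *)
Lemma glue_cap_glue_cup N k (i : 'I_N.+1) (D : diagram N.+2 k) :
    partner D (cap_left k i) = cap_right k i ->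
  glue (dflip (cup i)) (glue (cup i) D) = D.
Proof.
move=> E; set c := glue (cup i) D; set e := strand (dflip (cup i)) c.
have sym_e : connect_sym e := strand_sym _ _.
have E' : partner D (cap_right k i) = cap_left k i by rewrite -E partnerK.
have top z : connect e (outer N (skip_point i z)) (lower N.+2 z).
  case: z => [x|y] //; apply: connect1.
  have := strand_upper (dflip (cup i)) c (inl (skip2 i x)).
  by rewrite partner_dflip partner_cup cup_partner_skip.
have cap : connect e (outer N (cap_left k i)) (outer N (cap_right k i)).
  by rewrite connect_outer partner_cap eqxx orbT.
apply/esym/eqP; rewrite -is_glueingE; apply/forallP=> x.
case: (skip_pointP i x) => [||z]; first by rewrite E.
  by rewrite E' -/e sym_e.
have : partner D (skip_point i z) != cap_left k i.
  by rewrite -E' (inj_eq (@partner_inj _ _ D)) skip_point_right.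
have : partner D (skip_point i z) != cap_right k i.
  by rewrite -E (inj_eq (@partner_inj _ _ D)) skip_point_left.
case F : _ / (skip_pointP i (partner D (skip_point i z))) => [||z']; rewrite ?eqxx // => _ _.
apply: connect_trans (top z) _; rewrite -/e sym_e; apply: connect_trans (top z') _.
by rewrite sym_e -(glue_cup_skip F); apply/connect1/strand_lower.
Qed.

Lemma nb_loops_cap_glue_cup N k (i : 'I_N.+1) (c : diagram N k) :
  nb_loops (dflip (cup i)) c = 0.
Proof.
apply: nb_loops_eq0 => -[[x|y]|y]; [by exists (inl x)| |by exists (inr y)].
exists (inl (skip2 i y)); rewrite strand_sym; apply: connect1.
have := strand_upper (dflip (cup i)) c (inl (skip2 i y)).
by rewrite partner_dflip partner_cup cup_partner_skip.
Qed.

(** ** Bending by composition *)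

(** Bending adds a strand on the left and joins it to the leftmost strand by a cup
    or a cap; so ideals are stable under bending. *)

Section BendGlue.
Variables (m n : nat) (a : diagram m.+1 n).
Let D : diagram m.+2 n.+1 := juxt (id_diagram 1) a.
Let i0 : 'I_m.+1 := ord0.

Lemma skip_bend (w : point m.+1 n) : w != inl ord0 ->
  skip_point i0 (bend_point w) = juxt_right 1 1 w.
Proof.
case: w => [x|y] neq /=; last by congr inr; apply: val_inj.
case: unliftP neq => [x' ->|->] //= _; congr inl; apply: val_inj => /=.
by rewrite skip2E.
Qed.

Lemma bend_cap_left : partner D (cap_left _ i0) = skip_point i0 (inr ord0).
Proof.
have -> : cap_left _ i0 = @juxt_left 1 m.+1 1 n (inl ord0) :> point m.+2 n.+1.
  by congr inl; apply: val_inj; rewrite /= cup_leftE.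
by rewrite (partner_juxt_left (id_diagram 1) a (inl ord0)) partner_id /=; congr inr; apply: val_inj.
Qed.

Lemma bend_cap_right :
  partner D (cap_right _ i0) = skip_point i0 (bend_point (partner a (inl ord0))).
Proof.
have -> : cap_right _ i0 = juxt_right 1 1 (inl ord0) :> point m.+2 n.+1.
  by congr inl; apply: val_inj; rewrite /= cup_rightE.
by rewrite skip_bend ?partner_neq // (partner_juxt_right (id_diagram 1) a (inl ord0)).
Qed.

Lemma glue_cup_bend : glue (cup i0) D = bend a.
Proof.
have bend0 : bend_point (inl ord0) = inr ord0 :> point m n.+1.
  by rewrite /= unlift_none.
have turn : partner (glue (cup i0) D) (inr ord0) = bend_point (partner a (inl ord0)).
  exact: glue_cup_turn bend_cap_left bend_cap_right.
apply: diagram_ext => z; rewrite partner_bend -{1}[z]unbend_pointK.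
set w := unbend_point z.
have [->|w0] := eqVneq w (inl ord0); first by rewrite bend0.
have [aw|aw] := eqVneq (partner a w) (inl ord0).
  by rewrite aw bend0 -[w](partnerK a) aw -turn partnerK.
by apply: glue_cup_skip; rewrite !skip_bend // (partner_juxt_right (id_diagram 1) a w).
Qed.

Lemma nb_loops_cup_bend : nb_loops (cup i0) D = 0.
Proof. by apply: nb_loops_cup0; rewrite bend_cap_left skip_point_right. Qed.

End BendGlue.

Lemma dflip_juxt m m' n n' (a : diagram m n) (b : diagram m' n') :
  dflip (juxt a b) = juxt (dflip a) (dflip b).
Proof.
have fl (u : point n m) : flip_point (juxt_left n' m' u) = juxt_left m' n' (flip_point u).
  by case: u.
have fr (u : point n' m') : flip_point (juxt_right n m u) = juxt_right m n (flip_point u).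
  by case: u.
have fl' (u : point m n) : flip_point (juxt_left m' n' u) = juxt_left n' m' (flip_point u).
  by case: u.
have fr' (u : point m' n') : flip_point (juxt_right m n u) = juxt_right n m (flip_point u).
  by case: u.
apply: diagram_ext => z; rewrite partner_dflip; case: (juxtP z) => x.
  by rewrite fl !partner_juxt_left partner_dflip fl'.
by rewrite fr !partner_juxt_right partner_dflip fr'.
Qed.

Lemma dflip_bend m n (b : diagram m n.+1) : dflip (bend (dflip b)) = unbend b.
Proof.
have E (x : point m.+1 n) : flip_point (unbend_point (flip_point x)) = bend_point x.
  by case: x => [x|y] //=; case: unliftP.
have E' (x : point m n.+1) : flip_point (bend_point (flip_point x)) = unbend_point x.
  by case: x => [x|y] //=; case: unliftP.
apply: diagram_ext => x; rewrite partner_unbend partner_dflip partner_bend partner_dflip.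
by rewrite E E'.
Qed.

Lemma glue_cap_unbend m n (b : diagram m n.+1) :
  glue (juxt (id_diagram 1) b : diagram m.+1 n.+2) (dflip (cup (ord0 : 'I_n.+1))) = unbend b.
Proof.
have E : dflip (juxt (id_diagram 1) (dflip b)) = juxt (id_diagram 1) b.
  by rewrite dflip_juxt dflip_id dflipK.
rewrite -dflip_bend -glue_cup_bend -glue_flip.
exact: (congr1 (fun x : diagram m.+1 n.+2 => glue x (dflip (cup (ord0 : 'I_n.+1)))) (esym E)).
Qed.

Lemma nb_loops_cap_unbend m n (b : diagram m n.+1) :
  nb_loops (juxt (id_diagram 1) b : diagram m.+1 n.+2) (dflip (cup (ord0 : 'I_n.+1))) = 0.
Proof.
have E : dflip (juxt (id_diagram 1) b) = juxt (id_diagram 1) (dflip b).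
  by rewrite dflip_juxt dflip_id.
rewrite -nb_loops_flip (dflipK (cup _)).
exact: (etrans (congr1 (fun x : diagram n.+2 m.+1 => nb_loops (cup (ord0 : 'I_n.+1)) x) E)
  (nb_loops_cup_bend (dflip b))).
Qed.

Lemma juxt_id0 m n (a : diagram m n) : juxt (id_diagram 0) a = a.
Proof.
have E (x : point m n) : juxt_right 0 0 x = x :> point m n.
  by case: x => x; [congr inl|congr inr]; apply: val_inj.
by apply: diagram_ext => x; rewrite -[x in LHS]E partner_juxt_right E.
Qed.

Lemma diagram00 (a b : diagram 0 0) : a = b.
Proof. by apply: diagram_ext => -[[]|[]]. Qed.

Lemma nb_curves00 (a b : diagram 0 0) : nb_curves a b = 0.
Proof. by apply: eq_card0 => -[[]|[]]. Qed.

(** For diagrams with an empty bottom edge, closed curves are loops of a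
    composite. *)
Lemma nb_loops_to0 m (a b : diagram m 0) : nb_loops (dflip b) a = nb_curves a b.
Proof.
have := nb_curves_glue (dflip b) a (id_diagram 0).
by rewrite nb_curves00 addn0 dflipK nb_loops_idr glue_idr.
Qed.

(** * Arcs of a diagram with an empty bottom edge *)

(** The innermost arcs below a given one join neighbouring points. *)
Lemma adjacent_top_arc m n (D : diagram m n) (x y : 'I_m) :
    partner D (inl x) = inl y -> x < y ->
  exists z z' : 'I_m, [/\ x <= z, z' = z.+1 :> nat & partner D (inl z) = inl z'].
Proof.
move: {2}(y - x) (leqnn (y - x)) => b.
elim: b x y => [|b IHb] x y len E lt; first by lia.
have [e|ne] := eqVneq (y : nat) x.+1; first by exists x, y.
have lez : x.+1 < m by have := ltn_ord y; lia.
have [z zE] : exists z : 'I_m, z = x.+1 :> nat by exists (Ordinal lez).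
have := partner_noncrossing D (inl x) (inl z).
have := partner_noncrossing D (partner D (inl z)) (inl x).
rewrite partnerK E; case F : (partner D (inl z)) => [w|w] /=; last first.
  by have := ltn_ord y; rewrite zE; lia.
rewrite zE => n2 n1.
have wx : (w : nat) <> x.
  move=> /val_inj wx; have := partnerK D (inl z); rewrite F wx E => -[] e.
  by rewrite e zE eqxx in ne.
have wy : (w : nat) <> y.
  move=> /val_inj wy; have := partnerK D (inl z); rewrite F wy -E partnerK => -[] e.
  by have := zE; rewrite -e; lia.
have wz : (w : nat) <> z.
  by move=> /val_inj wz; have := partner_neq D (inl z); rewrite F wz eqxx.
have [||t [t' [t1 t2 t3]]] := IHb z w _ F; [by lia|by lia|].
by exists t, t'; split=> //; lia.
Qed.

Section Arcs.
Variable N : nat.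
Implicit Type D : diagram N 0.

Definition mate D (i : 'I_N) : 'I_N :=
  match partner D (inl i) with inl j => j | inr _ => i end.

Lemma partner_mate D i : partner D (inl i) = inl (mate D i).
Proof. by rewrite /mate; case: (partner D _) => // -[]. Qed.

Lemma mateK D : involutive (mate D).
Proof. by move=> i; apply: (@inl_inj _ 'I_0); rewrite -!partner_mate partnerK. Qed.

Lemma mate_neq D i : mate D i != i.
Proof. by have := partner_neq D (inl i); rewrite partner_mate (inj_eq (@inl_inj _ _)). Qed.

Lemma mate_neq_nat D i : (mate D i : nat) <> i.
Proof. by move=> /val_inj/eqP; rewrite (negbTE (mate_neq D i)). Qed.

Lemma mate_nc D (i j : 'I_N) : ~~ [&& i < j, j < mate D i & mate D i < mate D j].
Proof. by have := partner_noncrossing D (inl i) (inl j); rewrite !partner_mate. Qed.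

Lemma mate_inj D : injective (mate D).
Proof. exact: can_inj (mateK D). Qed.

Lemma mate_ext D D' : mate D =1 mate D' -> D = D'.
Proof. by move=> E; apply: diagram_ext => -[i|[]//]; rewrite !partner_mate E. Qed.

(** As for well-parenthesized words: by induction on the length of an arc of [D],
    the points below it are matched by [D'] as by [D], and a different mate of an
    end would force two arcs of [D'] to cross. *)
Lemma left_ends_inj D D' :
  (forall i : 'I_N, (i < mate D i) = (i < mate D' i)) -> D = D'.
Proof.
move=> E; suff H n (x : 'I_N) : x < mate D x -> mate D x - x <= n -> mate D' x = mate D x.
  apply: mate_ext => x; have [lt|] := ltnP x (mate D x); first by rewrite (H _ x lt (leqnn _)).
  rewrite leq_eqVlt => /orP[/eqP/mate_neq_nat//|lt].
  have := H (x - mate D x) (mate D x); rewrite mateK => /(_ lt (leqnn _)) e.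
  by rewrite -[in RHS]e mateK.
elim: n x => [|n IHn] x lt len; first by lia.
have inside (z : 'I_N) : x < z < mate D x -> mate D' z = mate D z /\ x < mate D z < mate D x.
  move=> zxy; have n1 := mate_nc D x z; have n2 := mate_nc D (mate D z) x.
  have n3 : (mate D z : nat) <> x by move=> /val_inj /(congr1 (mate D)); rewrite mateK => e; move: zxy; rewrite e; lia.
  have n4 : (mate D z : nat) <> mate D x by move=> /val_inj/mate_inj e; move: zxy; rewrite e; lia.
  rewrite mateK in n2; have mz : x < mate D z < mate D x by lia.
  split=> //; have n5 := @mate_neq_nat D z.
  have [lz|lz] := ltnP z (mate D z); first by apply: IHn => //; lia.
  have e : mate D' (mate D z) = z by rewrite IHn mateK //; lia.
  by rewrite -[in LHS]e mateK.
apply/eqP/negPn/negP => /eqP neq.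
have ltx : x < mate D' x by rewrite -E.
have lty : mate D' (mate D x) < mate D x.
  have := E (mate D x); rewrite mateK ltnNge (ltnW lt) /= => /esym/negbT.
  by have := @mate_neq_nat D' (mate D x); lia.
have neq' : (mate D' x : nat) <> mate D x by move=> /val_inj.
have r1 : mate D x < mate D' x.
  have [//|le] := ltnP (mate D x) (mate D' x); have [|e1 e2] := inside (mate D' x); first by lia.
  by move: e2; rewrite -e1 mateK; lia.
have r2 : mate D' (mate D x) < x.
  have [//|le] := ltnP (mate D' (mate D x)) x.
  have [e|n1] := eqVneq (mate D' (mate D x)) x.
    by case: neq; rewrite -[in LHS]e mateK.
  have n2 : (mate D' (mate D x) : nat) <> x by move=> /val_inj/eqP; rewrite (negbTE n1).
  have [|e1 e2] := inside (mate D' (mate D x)); first by lia.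
  by move: e2; rewrite -e1 mateK; lia.
have := mate_nc D' (mate D' (mate D x)) x; rewrite mateK; lia.
Qed.

Lemma adjacent_arc D (x : 'I_N) : x < mate D x ->
  exists2 z : 'I_N, x <= z & mate D z = z.+1 :> nat.
Proof.
move=> lt; have [z [z' [xz zz' E]]] := adjacent_top_arc (partner_mate D x) lt.
by exists z => //; move: E; rewrite partner_mate => -[->].
Qed.

(** The last points outnumber the first ones, so that they cannot all be matched
    with first ones. *)
Lemma suffix_adjacent_arc D p : p < N - p ->
  exists2 z : 'I_N, p <= z & mate D z = z.+1 :> nat.
Proof.
move=> lt; suff [x px lx] : exists2 x : 'I_N, p <= x & x < mate D x.
  by have [z xz zE] := adjacent_arc lx; exists z; lia.
have [/existsP[x /andP[p1 p2]]|/existsPn H] := boolP [exists x : 'I_N, (p <= x) && (p <= mate D x)].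
  have := @mate_neq_nat D x; have [l _|l ne] := ltnP x (mate D x); first by exists x.
  by exists (mate D x); rewrite ?mateK //; lia.
suff : N - p <= p by lia.
have s0 : \sum_(x < N) (p <= x : nat) = N - p.
  rewrite -(big_mkord predT (fun i => (p <= i) : nat)); elim: (N) => [|n IHn].
    by rewrite big_geq.
  by rewrite big_nat_recr //= IHn; lia.
have s1 : \sum_(x < N) (x < p : nat) <= p.
  rewrite -(big_mkord predT (fun i => (i < p) : nat)).
  suff -> : \sum_(0 <= i < N) (i < p : nat) = minn N p by exact: geq_minr.
  elim: (N) => [|n IHn]; first by rewrite big_geq // min0n.
  by rewrite big_nat_recr //= IHn; lia.
rewrite -s0; apply: leq_trans s1; rewrite [leqRHS](reindex_inj (@mate_inj D)) /=.
by apply: leq_sum => x _; have := H x; lia.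
Qed.

End Arcs.

(** ** Removing two neighbouring points *)

Section RemoveTwo.
Variables (N : nat) (i : 'I_N.+1) (D : diagram N.+2 0).
Let c : diagram N 0 := glue (cup i) D.

Lemma mate_skip x y : mate D (skip2 i x) = skip2 i y -> mate c x = y.
Proof.
move=> E; apply: (@inl_inj _ 'I_0); rewrite -partner_mate.
by apply: glue_cup_skip; rewrite partner_mate E.
Qed.

Lemma mate_turn x y : mate D (cup_left i) = skip2 i x ->
  mate D (cup_right i) = skip2 i y -> mate c x = y.
Proof.
move=> E E'; apply: (@inl_inj _ 'I_0); rewrite -partner_mate.
by apply: glue_cup_turn; rewrite partner_mate ?E ?E'.
Qed.

Lemma skip2_ltn x y : (skip2 i x < skip2 i y) = (x < y).
Proof. by rewrite !skip2E; case: ifP; case: ifP; lia. Qed.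

Lemma skip2_neq x : (skip2 i x : nat) <> i /\ (skip2 i x : nat) <> i.+1.
Proof. by rewrite skip2E; case: ifP; lia. Qed.

Lemma big_skip2 (R : Type) (idx : R) (op : Monoid.com_law idx) (F : 'I_N.+2 -> R) :
  \big[op/idx]_y F y
    = op (F (cup_left i)) (op (F (cup_right i)) (\big[op/idx]_x F (skip2 i x))).
Proof.
pose f (w : 'I_N + bool) := match w with
  inl x => skip2 i x | inr true => cup_left i | inr false => cup_right i end.
have lr : cup_left i != cup_right i by rewrite eq_sym cup_right_left.
have f_inj : injective f.
  move=> [x|[]] [y|[]] //= /eqP; rewrite ?skip2_left ?skip2_right ?cup_right_left ?(negbTE lr) //.
  - by move/eqP/skip2_inj->.
  - by rewrite eq_sym skip2_left.
  - by rewrite eq_sym skip2_right.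
have f_surj x : exists w, f w == x.
  by case: (skip2P i x) => [||y]; [exists (inr true)|exists (inr false)|exists (inl y)] => /=.
pose g x := xchoose (f_surj x).
have gK : cancel g f by move=> x; apply/eqP/(xchooseP (f_surj x)).
rewrite (reindex f) /=; last by exists g => x _ //; apply: f_inj; rewrite gK.
by rewrite big_sumType /= big_bool Monoid.mulmC -Monoid.mulmA.
Qed.

Variables (u v : seq bool).
Hypotheses (size_u : size u = i) (size_uv : size (u ++ v) = N).

Lemma nth_insert_left a b : nth false (u ++ [:: a, b & v]) (cup_left i) = a.
Proof. by rewrite cup_leftE nth_cat size_u ltnn subnn. Qed.
Lemma nth_insert_right a b : nth false (u ++ [:: a, b & v]) (cup_right i) = b.
Proof. by rewrite cup_rightE nth_cat size_u ltnNge leqnSn /= subSnn. Qed.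
Lemma nth_insert_skip a b x :
  nth false (u ++ [:: a, b & v]) (skip2 i x) = nth false (u ++ v) x.
Proof.
rewrite skip2E !nth_cat size_u; case: (ltnP x i) => [-> //|le].
have -> : x.+2 < i = false by lia.
by have -> : x.+2 - i = (x - i).+2 by lia.
Qed.

End RemoveTwo.

(** * Evaluation on words *)

Section Words.
Variables (K : fieldType) (q : K).
Hypothesis q_neq0 : q != 0%R.

(** The arcs are invariant bilinear forms on the two-dimensional representation of
    the quantum group [sl_2]; the letters are its weight vectors. *)
Definition opposite_ends N (D : diagram N 0) (s : seq bool) :=
  [forall i : 'I_N, nth false s i != nth false s (mate D i)].
Definition descents N (D : diagram N 0) (s : seq bool) : nat :=
  \sum_(i < N) ((i < mate D i) && nth false s i).
Definition diagram_value N (D : diagram N 0) (s : seq bool) : K :=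
  if opposite_ends D s then (q ^+ descents D s)%R else 0%R.

Section Insert.
Variables (N : nat) (i : 'I_N.+1) (D : diagram N.+2 0) (u v : seq bool).
Hypotheses (size_u : size u = i) (size_uv : size (u ++ v) = N).
Let c : diagram N 0 := glue (cup i) D.

Lemma forall_skip2 (P : pred 'I_N.+2) :
  [forall y, P y] = [&& P (cup_left i), P (cup_right i) & [forall x, P (skip2 i x)]].
Proof.
apply/forallP/and3P=> [H|[H1 H2 /forallP H3] y]; first by split=> //; apply/forallP.
by case: (skip2P i y).
Qed.

Lemma value_adjacent a b : mate D (cup_left i) = cup_right i ->
  diagram_value D (u ++ [:: a, b & v])
    = (if a == b then 0 else q ^+ a * diagram_value c (u ++ v))%R.
Proof.
move=> E; have E' : mate D (cup_right i) = cup_left i by rewrite -E mateK.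
have skip x : mate D (skip2 i x) = skip2 i (mate c x).
  case F : _ / (skip2P i (mate D (skip2 i x))) => [||y].
  - by move/eqP: F; rewrite -E' (inj_eq (@mate_inj _ D)) skip2_right.
  - by move/eqP: F; rewrite -E (inj_eq (@mate_inj _ D)) skip2_left.
  - by rewrite (mate_skip F).
have oE : opposite_ends D (u ++ [:: a, b & v]) = (a != b) && opposite_ends c (u ++ v).
  rewrite /opposite_ends forall_skip2 E E' !nth_insert_left // !nth_insert_right //.
  rewrite [b == a]eq_sym andbA andbb; congr (_ && _); apply: eq_forallb => x.
  by rewrite skip !nth_insert_skip.
have dE : descents D (u ++ [:: a, b & v]) = a + descents c (u ++ v).
  rewrite /descents (big_skip2 i) E E' !nth_insert_left // !nth_insert_right //.
  rewrite cup_leftE cup_rightE ltnSn ltnNge leqnSn /= add0n; congr (_ + _).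
  by apply: eq_bigr => x _; rewrite skip !nth_insert_skip // skip2_ltn.
rewrite /diagram_value oE; case: eqP => //= _; case: ifP => // _; last by rewrite mulr0.
by rewrite dE exprD.
Qed.

(** The positions [x] and [y] of the mates of [l] and [l + 1] can be on either side
    of the two points. In each case that planarity allows, the descents of the
    two arcs and the factor of the cup add up to those of the arc that joins [x]
    and [y]. *)
Lemma turn_count (l x y : nat) :
    x <> l /\ x <> l.+1 -> y <> l /\ y <> l.+1 -> x <> y ->
    ~~ [&& x < y, y < l & l < l.+1] -> ~~ [&& l < l.+1, l.+1 < x & x < y] ->
    ~~ [&& y < l, l < l.+1 & l.+1 < x] ->
  (l.+1 < y) + (x < l) = (x < y).+1 /\ (l < x) + (y < l.+1) = (y < x).
Proof.
move=> [x1 x2] [y1 y2] xy; have [lx|gx|//] := ltngtP x l; have [ly|gy|//] := ltngtP y l;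
  by have [?|?|//] := ltngtP x y; lia.
Qed.

Lemma value_turn : mate D (cup_left i) != cup_right i ->
  diagram_value c (u ++ v)
    = (q^-1 * diagram_value D (u ++ [:: false, true & v]) + diagram_value D (u ++ [:: true, false & v]))%R.
Proof.
move=> ne.
have [x0 E] : exists x, mate D (cup_left i) = skip2 i x.
  have := mate_neq D (cup_left i).
  case F : _ / (skip2P i (mate D (cup_left i))) ne => [||x] ne; rewrite ?eqxx // in ne *.
  by exists x.
have [y0 E'] : exists x, mate D (cup_right i) = skip2 i x.
  have := mate_neq D (cup_right i).
  case F : _ / (skip2P i (mate D (cup_right i))) => [||x]; rewrite ?eqxx // => _; last by exists x.
  by move: ne; rewrite -F mateK eqxx.
have cx : mate c x0 = y0 by apply: mate_turn E E'.
have cy : mate c y0 = x0 by rewrite -cx mateK.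
have xy : y0 != x0 by rewrite -cx mate_neq.
have skip x : x != x0 -> x != y0 -> mate D (skip2 i x) = skip2 i (mate c x).
  move=> nx ny; case F : _ / (skip2P i (mate D (skip2 i x))) => [||y].
  - by move/(congr1 (mate D)): F; rewrite mateK E => /skip2_inj e; rewrite e eqxx in nx.
  - by move/(congr1 (mate D)): F; rewrite mateK E' => /skip2_inj e; rewrite e eqxx in ny.
  - by rewrite (mate_skip F).
have Ex : mate D (skip2 i x0) = cup_left i by rewrite -E mateK.
have Ey : mate D (skip2 i y0) = cup_right i by rewrite -E' mateK.
set s := u ++ v; set sx := nth false s x0; set sy := nth false s y0.
pose rest := [forall x : 'I_N, (x != x0) && (x != y0) ==> (nth false s x != nth false s (mate c x))].
have split_forall (P : pred 'I_N) : [forall x, P x]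
    = [&& P x0, P y0 & [forall x, (x != x0) && (x != y0) ==> P x]].
  apply/forallP/and3P=> [H|[Px Py /forallP H] x]; first by split=> //; apply/forallP=> x; rewrite H implybT.
  by case: (eqVneq x x0) (eqVneq x y0) (H x) => [->//|_] [->//|_].
have split_sum (F : 'I_N -> nat) : \sum_x F x
    = F x0 + (F y0 + \sum_(x | (x != x0) && (x != y0)) F x).
  by rewrite (bigD1 x0) //= (bigD1 y0).
pose r := \sum_(x : 'I_N | (x != x0) && (x != y0)) ((x < mate c x) && nth false s x).
have ocE : opposite_ends c s = (sx != sy) && rest.
  rewrite /opposite_ends split_forall cx cy -/sx -/sy [sy == sx]eq_sym andbA andbb.
  by [].
have dcE : descents c s = ((x0 < y0) && sx) + (((y0 < x0) && sy) + r).
  by rewrite /descents split_sum cx cy.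
have oE a b : opposite_ends D (u ++ [:: a, b & v]) = [&& a != sx, b != sy & rest].
  rewrite /opposite_ends forall_skip2 E E' !nth_insert_left // !nth_insert_right //.
  rewrite !nth_insert_skip // split_forall Ex Ey !nth_insert_left // !nth_insert_right //.
  rewrite !nth_insert_skip // -/s -/sx -/sy.
  rewrite [sx == a]eq_sym [sy == b]eq_sym.
  have -> : [forall x : 'I_N, (x != x0) && (x != y0) ==> (nth false (u ++ [:: a, b & v]) (skip2 i x)
       != nth false (u ++ [:: a, b & v]) (mate D (skip2 i x)))] = rest.
    apply: eq_forallb => x; case: (boolP ((x != x0) && (x != y0))) => //= /andP[nx ny].
    by rewrite skip // !nth_insert_skip.
  by case: (a != sx); case: (b != sy).
have dE a b : descents D (u ++ [:: a, b & v])
    = ((i < skip2 i x0) && a) + (((i.+1 < skip2 i y0) && b)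
      + (((skip2 i x0 < i) && sx) + (((skip2 i y0 < i.+1) && sy) + r))).
  rewrite /descents (big_skip2 i) E E' !nth_insert_left // !nth_insert_right //.
  rewrite split_sum Ex Ey !nth_insert_skip // cup_leftE cup_rightE.
  do 4 congr (_ + _); apply: eq_bigr => x /andP[nx ny].
  by rewrite skip // !nth_insert_skip // skip2_ltn.
have pos := (cup_leftE i, cup_rightE i).
have xy_ne : (skip2 i x0 : nat) <> skip2 i y0.
  by move=> /val_inj/skip2_inj e; rewrite e eqxx in xy.
have n1 := mate_nc D (skip2 i x0) (skip2 i y0); have n2 := mate_nc D (cup_left i) (cup_right i).
have n3 := mate_nc D (skip2 i y0) (cup_left i).
rewrite ?(E, E', Ex, Ey) !pos in n1 n2 n3.
have [c1 c2] := turn_count (skip2_neq i x0) (skip2_neq i y0) xy_ne n1 n2 n3.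
have xyE : (x0 < y0) = (skip2 i x0 < skip2 i y0) by rewrite skip2_ltn.
have yxE : (y0 < x0) = (skip2 i y0 < skip2 i x0) by rewrite skip2_ltn.
rewrite /diagram_value ocE !oE !dE dcE xyE yxE.
case: (boolP rest) => _; rewrite ?andbF ?andbT ?mulr0 ?addr0 //.
case: (sx) (sy) => -[] /=; rewrite ?andbF ?andbT ?mulr0 ?addr0 ?add0r //.
  have -> : (i.+1 < skip2 i y0) + ((skip2 i x0 < i) + (0 + r))
     = ((skip2 i x0 < skip2 i y0) + r).+1 by rewrite add0n addnA c1.
  by rewrite exprS mulKf.
by rewrite -c2 -addnA.
Qed.

(** The cup has the values [q^-1] on 01 and 1 on 10, the inverse matrix of the
    values of an arc:
    straightening a strand costs nothing, and a loop has the value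
    [q + q^-1]. *)
Lemma value_cup :
  ((q + q^-1) ^+ nb_loops (cup i) D * diagram_value c (u ++ v)
    = q^-1 * diagram_value D (u ++ [:: false, true & v]) + diagram_value D (u ++ [:: true, false & v]))%R.
Proof.
have [E|ne] := eqVneq (mate D (cup_left i)) (cup_right i).
  rewrite nb_loops_cup1 ?partner_mate /cap_left /cap_right ?partner_mate ?E //.
  by rewrite !value_adjacent //= expr1 mul1r; ring.
rewrite nb_loops_cup0 ?expr0 ?mul1r ?value_turn //.
by rewrite /cap_left partner_mate (inj_eq (@inl_inj _ _)).
Qed.

End Insert.

End Words.

Local Open Scope ring_scope.

(** * Negligible morphisms *)

Section Morphisms.
Variables (K : fieldType) (d : K).

Definition basis_hom m n (a : diagram m n) : TLhom K m n := [ffun c => (c == a)%:R].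

Definition pairing m n (f : TLhom K m n) (b : diagram m n) : K :=
  \sum_a f a * d ^+ nb_curves a b.

Lemma sum_basis_hom m n (a : diagram m n) (F : diagram m n -> K) :
  \sum_c basis_hom a c * F c = F a.
Proof.
rewrite (bigD1 a) //= ffunE eqxx mul1r big1 ?addr0 // => c /negbTE ca.
by rewrite ffunE ca mul0r.
Qed.

Lemma sum_TLcomp l m n (g : TLhom K m n) (f : TLhom K l m) (F : diagram l n -> K) :
  \sum_c TLcomp d g f c * F c
    = \sum_a f a * \sum_b g b * (d ^+ nb_loops a b * F (glue a b)).
Proof.
under eq_bigr => c _ do rewrite ffunE mulr_suml.
rewrite exchange_big; apply: eq_bigr => a _ /=.
under eq_bigr => c _ do rewrite mulr_suml big_mkcond.
rewrite exchange_big mulr_sumr; apply: eq_bigr => b _ /=.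
under eq_bigr => c _ do rewrite is_glueingE.
by rewrite -big_mkcond big_pred1_eq -!mulrA mulrCA.
Qed.

Lemma TLcompE l m n (g : TLhom K m n) (f : TLhom K l m) c :
  TLcomp d g f c
    = \sum_a f a * \sum_b g b * (d ^+ nb_loops a b * (c == glue a b)%:R).
Proof.
rewrite -(sum_TLcomp g f (fun e => (c == e)%:R)) (bigD1 c) //= eqxx mulr1.
by rewrite big1 ?addr0 // => e /negbTE; rewrite eq_sym => ->; rewrite mulr0.
Qed.

Lemma sum_TLtens m m' n n' (f : TLhom K m n) (g : TLhom K m' n')
    (F : diagram (m + m') (n + n') -> K) :
  \sum_c TLtens f g c * F c = \sum_a f a * \sum_b g b * F (juxt a b).
Proof.
under eq_bigr => c _ do rewrite ffunE mulr_suml.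
rewrite exchange_big; apply: eq_bigr => a _ /=.
under eq_bigr => c _ do rewrite mulr_suml big_mkcond.
rewrite exchange_big mulr_sumr; apply: eq_bigr => b _ /=.
under eq_bigr => c _ do rewrite is_juxtapositionE.
by rewrite -big_mkcond big_pred1_eq; ring.
Qed.

Lemma TLtensE m m' n n' (f : TLhom K m n) (g : TLhom K m' n') c :
  TLtens f g c = \sum_a f a * \sum_b g b * (c == juxt a b)%:R.
Proof.
rewrite -(sum_TLtens f g (fun e => (c == e)%:R)) (bigD1 c) //= eqxx mulr1.
by rewrite big1 ?addr0 // => e /negbTE; rewrite eq_sym => ->; rewrite mulr0.
Qed.

(** ** The ideal of negligible morphisms *)

Lemma negligibleP m n (f : TLhom K m n) :
  negligible d f <-> forall b, pairing f b = 0.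
Proof.
have E (g : TLhom K n m) : markov_trace d (TLcomp d f g) = \sum_b g b * pairing f (dflip b).
  rewrite /markov_trace (sum_TLcomp f g (fun c => d ^+ nb_closure_loops c)).
  by apply: eq_bigr => b _; congr (_ * _); apply: eq_bigr => a _;
    rewrite -exprD closure_glue.
split=> [H b|H g]; last by rewrite E big1 // => b _; rewrite H mulr0.
by have := H (basis_hom (dflip b)); rewrite E sum_basis_hom dflipK.
Qed.

(** Moving the diagrams of [f] outside, one pairs [g] with diagrams. *)
Lemma pairing_comp l m n (g : TLhom K m n) (f : TLhom K l m) b :
  pairing (TLcomp d g f) b = \sum_a f a * (d ^+ nb_loops (dflip a) b * pairing g (glue (dflip a) b)).
Proof.
rewrite /pairing (sum_TLcomp g f (fun c => d ^+ nb_curves c b)); apply: eq_bigr => a _.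
congr (_ * _); rewrite /pairing mulr_sumr; apply: eq_bigr => c _.
by rewrite -exprD nb_curves_glue exprD mulrCA.
Qed.

Lemma pairing_comp_r l m n (g : TLhom K m n) (f : TLhom K l m) b :
  pairing (TLcomp d g f) b
    = \sum_c g c * (d ^+ nb_loops b (dflip c) * pairing f (glue b (dflip c))).
Proof.
rewrite /pairing (sum_TLcomp g f (fun c => d ^+ nb_curves c b)).
under eq_bigr do rewrite mulr_sumr.
rewrite exchange_big; apply: eq_bigr => c _ /=; rewrite !mulr_sumr.
apply: eq_bigr => a _; rewrite -exprD.
have -> : (nb_loops a c + nb_curves (glue a c) b = nb_loops b (dflip c) + nb_curves a (glue b (dflip c)))%N.
  rewrite -nb_loops_flip -(nb_curves_flip (glue a c)) -glue_flip nb_curves_glue dflipK.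
  rewrite -[nb_loops b _]nb_loops_flip dflipK -(nb_curves_flip a) -glue_flip dflipK.
  by [].
by rewrite exprD mulrCA; congr (_ * _); rewrite mulrCA.
Qed.

(** In each case the pairing with a diagram is a combination of pairings of the
    negligible factor with diagrams. *)
Lemma negligible_is_ideal : is_ideal d (negligible d).
Proof.
split.
- move=> m n; apply/negligibleP => b; rewrite /pairing big1 // => a _.
  by rewrite ffunE mul0r.
- move=> m n f g /negligibleP Hf /negligibleP Hg; apply/negligibleP => b.
  transitivity (pairing f b + pairing g b); last by rewrite Hf Hg addr0.
  by rewrite /pairing -big_split; apply: eq_bigr => a _; rewrite ffunE mulrDl.
- move=> m n k f /negligibleP Hf; apply/negligibleP => b.
  transitivity (k * pairing f b); last by rewrite Hf mulr0.
  by rewrite /pairing mulr_sumr; apply: eq_bigr => a _; rewrite ffunE mulrA.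
- move=> l m n g f /negligibleP Hg; apply/negligibleP => b.
  by rewrite pairing_comp big1 // => a _; rewrite Hg !mulr0.
- move=> l m n g f /negligibleP Hf; apply/negligibleP => b.
  by rewrite pairing_comp_r big1 // => a _; rewrite Hf !mulr0.
- move=> m m' n n' f g /negligibleP Hf; apply/negligibleP => b.
  rewrite /pairing (sum_TLtens f g (fun c => d ^+ nb_curves c b)).
  under eq_bigr do rewrite mulr_sumr.
  rewrite exchange_big big1 // => c _ /=.
  have [b' [r E]] := nb_curves_juxt_left c b.
  transitivity (g c * d ^+ r * pairing f b'); last by rewrite Hf mulr0.
  rewrite /pairing mulr_sumr; apply: eq_bigr => a _.
  by rewrite E exprD mulrCA -mulrA; congr (_ * _); rewrite mulrCA.
- move=> m m' n n' f g /negligibleP Hg; apply/negligibleP => b.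
  rewrite /pairing (sum_TLtens f g (fun c => d ^+ nb_curves c b)) big1 // => c _.
  have [b' [r E]] := nb_curves_juxt_right c b.
  transitivity (f c * d ^+ r * pairing g b'); last by rewrite Hg mulr0.
  rewrite /pairing -mulrA !mulr_sumr; apply: eq_bigr => a _.
  by rewrite E exprD; congr (_ * _); rewrite mulrCA.
Qed.

Lemma negligible_proper : ~ negligible d (basis_hom (id_diagram 0)).
Proof.
move=> /negligibleP/(_ (id_diagram 0))/eqP.
by rewrite /pairing (sum_basis_hom _ (fun c => d ^+ nb_curves c _)) nb_curves00 expr0 oner_eq0.
Qed.

(** Diagrams with a cap at [i] factor through this cap, the loop parameter being
    the price of removing and restoring it. *)
Lemma comp_cup_cap N k (i : 'I_N.+1) (y : TLhom K N.+2 k) :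
    (forall c, y c != 0 -> partner c (cap_left k i) = cap_right k i) ->
  d *: y = TLcomp d (TLcomp d y (basis_hom (cup i))) (basis_hom (dflip (cup i))).
Proof.
move=> supp; apply/ffunP => c; rewrite ffunE TLcompE sum_basis_hom.
rewrite (sum_TLcomp y _ (fun b => d ^+ nb_loops (dflip (cup i)) b
  * (c == glue (dflip (cup i)) b)%:R)) sum_basis_hom.
transitivity (\sum_b y b * (d * (c == b)%:R)).
  rewrite (bigD1 c) //= eqxx mulr1 big1 ?addr0 => [|b /negbTE cb].
    by rewrite mulrC.
  by rewrite eq_sym cb !mulr0.
apply: eq_bigr => b _; have [->|yb] := eqVneq (y b) 0; first by rewrite !mul0r.
by rewrite nb_loops_cup1 ?supp // glue_cap_glue_cup ?supp // nb_loops_cap_glue_cup expr1 mul1r.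
Qed.

(** ** Ideals and bending *)

Definition bendh m n (f : TLhom K m.+1 n) : TLhom K m n.+1 := [ffun c => f (unbend c)].
Definition unbendh m n (f : TLhom K m n.+1) : TLhom K m.+1 n := [ffun c => f (bend c)].

Lemma bendhK m n : cancel (@bendh m n) (@unbendh m n).
Proof. by move=> f; apply/ffunP => c; rewrite !ffunE bendK. Qed.
Lemma unbendhK m n : cancel (@unbendh m n) (@bendh m n).
Proof. by move=> f; apply/ffunP => c; rewrite !ffunE unbendK. Qed.

Section Ideal.
Variables (J : hom_family K) (idJ : is_ideal d J).

Lemma ideal_bend m n (f : TLhom K m.+1 n) : J f -> J (bendh f).
Proof.
move=> Jf.
suff -> : bendh f = TLcomp d (TLtens (basis_hom (id_diagram 1)) f : TLhom K m.+2 n.+1)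
    (basis_hom (cup (ord0 : 'I_m.+1))).
  by apply: (ideal_comp_l idJ); apply: (ideal_tens_r idJ (basis_hom (id_diagram 1)) Jf).
apply/ffunP => c; rewrite TLcompE sum_basis_hom.
rewrite (@sum_TLtens 1 m.+1 1 n _ f (fun b : diagram m.+2 n.+1 =>
  d ^+ nb_loops (cup (ord0 : 'I_m.+1)) b * (c == glue (cup ord0) b)%:R)).
rewrite sum_basis_hom ffunE.
under eq_bigr => b _ do rewrite nb_loops_cup_bend glue_cup_bend expr0 mul1r.
rewrite (bigD1 (unbend c)) //= unbendK eqxx mulr1 big1 ?addr0 // => b.
rewrite -(can_eq (@bendK m n)) unbendK eq_sym => /negbTE->; exact: mulr0.
Qed.

Lemma ideal_unbend m n (f : TLhom K m n.+1) : J f -> J (unbendh f).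
Proof.
move=> Jf.
suff -> : unbendh f = TLcomp d (basis_hom (dflip (cup (ord0 : 'I_n.+1))))
    (TLtens (basis_hom (id_diagram 1)) f : TLhom K m.+1 n.+2).
  by apply: (ideal_comp_r idJ); apply: (ideal_tens_r idJ (basis_hom (id_diagram 1)) Jf).
apply/ffunP => c; rewrite TLcompE.
under eq_bigr => a _ do rewrite sum_basis_hom.
rewrite (@sum_TLtens 1 m 1 n.+1 _ f (fun b : diagram m.+1 n.+2 =>
  d ^+ nb_loops b (dflip (cup (ord0 : 'I_n.+1))) * (c == glue b (dflip (cup ord0)))%:R)).
rewrite sum_basis_hom ffunE.
under eq_bigr => b _ do rewrite nb_loops_cap_unbend glue_cap_unbend expr0 mul1r.
rewrite (bigD1 (bend c)) //= bendK eqxx mulr1 big1 ?addr0 // => b.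
rewrite -(can_eq (@unbendK m n)) bendK eq_sym => /negbTE->; exact: mulr0.
Qed.

(** Bend all bottom points up and compose with the mirror image of [b]. *)
Lemma ideal_pairing m n (f : TLhom K m n) b :
  J f -> J (pairing f b *: basis_hom (id_diagram 0)).
Proof.
elim: n m f b => [|n IHn] m f b Jf.
  suff -> : pairing f b *: basis_hom (id_diagram 0) = TLcomp d f (basis_hom (dflip b)).
    exact: (ideal_comp_l idJ).
  apply/ffunP => c; rewrite TLcompE sum_basis_hom !ffunE (diagram00 c (id_diagram 0)) eqxx.
  rewrite /pairing /GRing.scale /= mulr1; apply: eq_bigr => a _.
  by rewrite nb_loops_to0 (diagram00 (glue _ _) (id_diagram 0)) eqxx mulr1.
have -> : pairing f b = pairing (unbendh f) (unbend b); last exact/IHn/ideal_unbend.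
rewrite /pairing (reindex (@bend m n)) /=; last first.
  exact: onW_bij (Bijective (@bendK m n) (@unbendK m n)).
by apply: eq_bigr => a _; rewrite ffunE -[in LHS](unbendK b) nb_curves_bend.
Qed.

Lemma ideal_full : J (basis_hom (id_diagram 0)) -> forall m n (f : TLhom K m n), J f.
Proof.
move=> J1 m n f; suff -> : f = TLtens (basis_hom (id_diagram 0)) f.
  exact: (@ideal_tens_l _ _ _ idJ 0 m 0 n (basis_hom (id_diagram 0)) f J1).
apply/ffunP => c; rewrite (TLtensE (basis_hom (id_diagram 0)) f c) sum_basis_hom.
rewrite (bigD1 c) //= juxt_id0 eqxx mulr1 big1 ?addr0 // => b.
by rewrite juxt_id0 eq_sym => /negbTE->; rewrite mulr0.
Qed.

(** A nonzero pairing would put the identity of the unit object into the ideal. *)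
Lemma proper_ideal_negligible : proper_family J ->
  forall m n (f : TLhom K m n), J f -> negligible d f.
Proof.
move=> [m0 [n0 [f0 nJ]]] m n f Jf; apply/negligibleP => b.
apply/eqP/negPn/negP => nz; apply: nJ; apply: ideal_full.
have := ideal_scale idJ (pairing f b)^-1 (ideal_pairing b Jf).
by rewrite scalerA mulVf // scale1r.
Qed.

End Ideal.
End Morphisms.

Lemma count_nth (p : pred bool) N s : size s = N ->
  count p s = (\sum_(i < N) (p (nth false s i) : nat))%N.
Proof.
by move=> <-; rewrite -sum1_count (big_nth false) big_mkord big_mkcond.
Qed.

(** * Gaussian integers and binomials *)

Section GaussianBinomials.
Variables (K : fieldType) (s : K).

(** Gaussian binomial coefficients at [s], by their Pascal rule, which needs no
    division; [qbin m 1] is the Gaussian integer [1 + s + ... + s ^ (m - 1)]. *)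
Fixpoint qbin (M j : nat) : K :=
  if M is M'.+1 then
    (if j is j'.+1 then qbin M' j' else 0) + s ^+ j * qbin M' j
  else (j == 0%N)%:R.

Lemma qbin_gt M j : (M < j)%N -> qbin M j = 0.
Proof.
elim: M j => [|M IHM] [|j] //= lt.
by rewrite !IHM ?mulr0 ?addr0 //; lia.
Qed.

Lemma qbin_0 M : qbin M 0 = 1.
Proof. by elim: M => //= M ->; rewrite add0r mul1r. Qed.

Lemma qbin_1S M : qbin M.+1 1 = 1 + s * qbin M 1.
Proof. by rewrite -[1 in RHS](qbin_0 M). Qed.

Lemma qint_geometric m : (1 - s) * qbin m 1 = 1 - s ^+ m.
Proof.
elim: m => [|m IHm]; first by rewrite mulr0 subrr.
rewrite qbin_1S mulrDr mulr1 mulrCA IHm exprS; ring.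
Qed.

Lemma qbin_pascal M j : qbin M.+1 j.+1 = qbin M j + s ^+ j.+1 * qbin M j.+1.
Proof. by []. Qed.

Lemma qbin_nn M : qbin M M = 1.
Proof. by elim: M => //= M ->; rewrite qbin_gt // mulr0 addr0. Qed.

Lemma qbin_absorption M j :
  qbin j.+1 1 * qbin M.+1 j.+1 = qbin M.+1 1 * qbin M j.
Proof.
elim: M j => [|M IHM] [|j].
- by rewrite qbin_1S qbin_0 [qbin 0 1]/= mulr0 addr0.
- by rewrite (qbin_gt (M := 1)) // (qbin_gt (M := 0)) // !mulr0.
- by rewrite !qbin_0 mulr1 qbin_1S [qbin 0 1]/= mulr0 addr0 mul1r.
rewrite (qbin_pascal M.+1 j.+1) mulrDr mulrCA IHM (qbin_1S M.+1) (qbin_1S j.+1).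
have := IHM j; rewrite (qbin_pascal M j).
move: (qbin j.+1 1) (qbin M.+1 1) (qbin M j) (qbin M j.+1) => c e a b E.
have -> : (1 + s * c) * (a + s ^+ j.+1 * b) = (a + s ^+ j.+1 * b) + s * (e * a).
  by rewrite mulrDl mul1r -mulrA E.
rewrite [s ^+ j.+2]exprS; ring.
Qed.

Variable n : nat.
Hypothesis n_gt0 : (0 < n)%N.
Hypothesis s_n : s ^+ n = 1.
Hypothesis qint_neq0 : forall m, (0 < m < n)%N -> qbin m 1 != 0.
Hypothesis qint_n : qbin n 1 = 0.

Lemma qbin_inner j : (0 < j < n)%N -> qbin n j = 0.
Proof.
case: j n n_gt0 qint_neq0 qint_n => [|j] // [|k] // _ Hq Hn jk.
have := qbin_absorption k j; rewrite Hn mul0r => /eqP.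
by rewrite mulf_eq0 (negbTE (Hq _ jk)) => /eqP.
Qed.

Lemma qbin_periodic M j : (j < n)%N -> qbin (M + n) j = qbin M j.
Proof.
elim: M j => [|M IHM] [|j] jn; rewrite ?qbin_0 //.
  by rewrite qbin_inner ?qbin_gt //; lia.
by rewrite addSn !qbin_pascal !IHM //; lia.
Qed.

(** By periodicity one can take [M < n], and then only [M = n - 1] is not below the
    diagonal. *)
Lemma qbin_last M : qbin M n.-1 = (M %% n == n.-1)%N%:R.
Proof.
rewrite {1}(divn_eq M n) addnC; elim: (M %/ n)%N => [|c IHc].
  rewrite mul0n addn0; have := ltn_pmod M n_gt0 => lt.
  have [->|ne] := eqVneq; first exact: qbin_nn.
  by rewrite qbin_gt //; move/eqP: ne; lia.
by rewrite mulSnr addnA qbin_periodic //; lia.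
Qed.

(** A case of Lucas' theorem at a primitive [n]-th root of unity: in the Pascal
    rule the power of [s] is 1, and the sum counts the [M < k + n] congruent to
    [-1] modulo [n]. *)
Lemma qbin_lucas k : qbin (k + n) n = (1 + k %/ n)%N%:R.
Proof.
elim: k => [|k IHk]; first by rewrite qbin_nn div0n.
have -> : qbin (k.+1 + n) n = qbin (k + n) n.-1 + s ^+ n * qbin (k + n) n.
  by rewrite addSn; case: (n) n_gt0.
rewrite qbin_periodic ?IHk ?qbin_last ?s_n ?mul1r -?natrD; last by lia.
rewrite divnS //; congr (_%:R); rewrite addnCA; congr (_ + (_ + _))%N.
congr nat_of_bool; have lt := ltn_pmod k n_gt0; have := modnS k n.
have lt' := ltn_pmod k.+1 n_gt0; rewrite /dvdn.
by case: (eqVneq (k.+1 %% n)%N 0%N) => E H; apply/eqP; [|lia]; move: (modnDml k 1 n);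
  rewrite !addn1 E; have [l|l] := ltnP (k %% n)%N.+1 n; [rewrite modn_small|lia].
Qed.

End GaussianBinomials.

Lemma cat_nseq_cons (T : Type) j (x : T) s : nseq j x ++ x :: s = nseq j.+1 x ++ s.
Proof. by elim: j => //= j ->. Qed.

Definition middle j : 'I_j.*2.+1 := inord j.

Lemma middleE j : middle j = j :> nat.
Proof. by rewrite inordK //; lia. Qed.

Section Words.
Variables (K : fieldType) (q : K).
Hypothesis q_neq0 : q != 0.
Local Notation d := (q + q^-1).
Local Notation value := (diagram_value q).
Local Notation sigma := (- q^-1).

Lemma sigma_neq0 : sigma != 0.
Proof. by rewrite oppr_eq0 invr_eq0. Qed.

Lemma value_balanced N (D : diagram N 0) s :
  size s = N -> value D s != 0 -> count id s = count negb s.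
Proof.
move=> sN; rewrite /diagram_value; case: ifP => [/forallP H _|]; last by rewrite eqxx.
rewrite !(count_nth _ sN) [in LHS](reindex_inj (@mate_inj _ D)) /=.
apply: eq_bigr => i _; have := H i.
by case: (nth _ _ i); case: (nth _ _ _).
Qed.

(** The Dyck word of the diagram. *)
Definition ends_word N (D : diagram N 0) : seq bool :=
  [seq (mate D i < i)%N | i <- enum 'I_N].

Lemma size_ends_word N (D : diagram N 0) : size (ends_word D) = N.
Proof. by rewrite size_map size_enum_ord. Qed.

Lemma nth_ends_word N (D : diagram N 0) (i : 'I_N) :
  nth false (ends_word D) i = (mate D i < i)%N.
Proof. by rewrite (nth_map i) ?size_enum_ord // nth_ord_enum. Qed.

Lemma value_ends_word N (D : diagram N 0) : value D (ends_word D) = 1.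
Proof.
rewrite /diagram_value.
have -> : opposite_ends D (ends_word D).
  apply/forallP=> i; rewrite !nth_ends_word mateK.
  by case: ltngtP (@mate_neq_nat _ D i).
rewrite /descents big1 ?expr0 // => i _; rewrite nth_ends_word.
by case: ltngtP.
Qed.

Definition left_sum N (D : diagram N 0) : nat :=
  (\sum_(i < N) (if i < mate D i then i : nat else 0))%N.

(** An arc of [D'] contains exactly one left end of [D], not smaller than its
    own left end: the words of the arcs are unitriangular. *)
Lemma left_sum_lt N (D D' : diagram N 0) :
  value D' (ends_word D) != 0 -> D' != D -> (left_sum D' < left_sum D)%N.
Proof.
rewrite /diagram_value; case: ifP => [/forallP H _ ne|]; last by rewrite eqxx.
have {}H i : (mate D (mate D' i) < mate D' i)%N = (i < mate D i)%N.
  have := H i; rewrite !nth_ends_word => h.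
  by have := @mate_neq_nat _ D i; have := @mate_neq_nat _ D (mate D' i); lia.
have E : left_sum D' = (\sum_(i < N) (if i < mate D i then minn i (mate D' i) else 0))%N.
  rewrite /left_sum (bigID (fun i : 'I_N => (i < mate D i)%N)) /=.
  rewrite [X in (_ + X)%N](reindex_inj (@mate_inj _ D')) /=.
  rewrite [X in (_ + X)%N](eq_bigl (fun i : 'I_N => (i < mate D i)%N)); last first.
    move=> i; have := H i; have := @mate_neq_nat _ D (mate D' i); lia.
  rewrite -big_split -big_mkcond /=; apply: eq_bigr => i _; rewrite mateK.
  by have := @mate_neq_nat _ D' i; case: ifP; case: ifP; lia.
rewrite ltn_neqAle E leq_sum ?andbT => [|i _]; last by case: ifP => // _; exact: geq_minl.
apply: contra_neq ne => eq.
have {}eq (i : 'I_N) : (i < mate D i)%N -> (i < mate D' i)%N.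
  move=> lt; rewrite ltnNge; apply/negP=> le.
  have : (left_sum D' < left_sum D)%N; last by rewrite E eq ltnn.
  rewrite E /left_sum (bigD1 i) //= [X in (_ < X)%N](bigD1 i) //= lt -addSn.
  apply: leq_add; first by have := @mate_neq_nat _ D' i; lia.
  by apply: leq_sum => j _; case: ifP => // _; exact: geq_minl.
apply: left_ends_inj => i; apply/idP/idP=> [lt|/eq//].
have [//|ge] := ltnP i (mate D i).
have lt' : (mate D i < i)%N by have := @mate_neq_nat _ D i; lia.
have := H (mate D' i); rewrite mateK lt' => /esym/eq; rewrite mateK; lia.
Qed.

(** ** Evaluation of morphisms *)

Definition hom_value N (f : TLhom K N 0) (s : seq bool) : K := \sum_D f D * value D s.

Lemma hom_value0 N (s : seq bool) : hom_value (0 : TLhom K N 0) s = 0.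
Proof. by rewrite /hom_value big1 // => D _; rewrite ffunE mul0r. Qed.

Lemma hom_value_balanced N (f : TLhom K N 0) s :
  size s = N -> hom_value f s != 0 -> count id s = count negb s.
Proof.
move=> sN; have [E _|ne] := eqVneq (count id s) (count negb s); first exact: E.
rewrite /hom_value big1 ?eqxx // => D _; have [->|] := eqVneq (value D s) 0.
  by rewrite mulr0.
by move=> /(value_balanced sN)/eqP; rewrite (negbTE ne).
Qed.

(** Evaluate on the Dyck word of a diagram [D] in the support of [f] whose left
    ends have the least sum: no other diagram of the support contributes. *)
Lemma hom_value_inj N (f : TLhom K N 0) :
  f != 0 -> exists2 s, size s = N & hom_value f s != 0.
Proof.
move=> f0; have [D0 D0f] : exists D, f D != 0.
  apply/existsP; apply: contraNT f0 => /existsPn H; apply/eqP/ffunP => D.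
  by rewrite ffunE; apply/eqP; have := H D; rewrite negbK.
have [D fD minD] := arg_minnP (P := fun D => f D != 0) (@left_sum N) D0f.
exists (ends_word D); first exact: size_ends_word.
rewrite /hom_value (bigD1 D) //= value_ends_word mulr1 big1 ?addr0 // => D' ne.
have [->|fD'] := eqVneq (f D') 0; first by rewrite mul0r.
have [->|wD'] := eqVneq (value D' (ends_word D)) 0; first by rewrite mulr0.
by have := left_sum_lt wD' ne; rewrite ltnNge minD.
Qed.

Lemma hom_value_cup N (i : 'I_N.+1) (f : TLhom K N.+2 0) u v :
    size u = i -> size (u ++ v) = N ->
  hom_value (TLcomp d f (basis_hom K (cup i))) (u ++ v)
    = q^-1 * hom_value f (u ++ [:: false, true & v]) + hom_value f (u ++ [:: true, false & v]).
Proof.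
move=> su suv; rewrite /hom_value (sum_TLcomp d f _ (fun c => value c (u ++ v))) sum_basis_hom.
rewrite mulr_sumr -big_split; apply: eq_bigr => D _ /=.
by rewrite (value_cup q_neq0 D su suv); ring.
Qed.

(** Annihilation by the cup at [i], read off the values. *)
Definition killed N (f : TLhom K N 0) (i : nat) := forall u v : seq bool,
  size u = i -> (size u + size v + 2 = N)%N ->
  hom_value f (u ++ [:: true, false & v]) = sigma * hom_value f (u ++ [:: false, true & v]).

Lemma cup_killed N (i : 'I_N.+1) (f : TLhom K N.+2 0) :
  TLcomp d f (basis_hom K (cup i)) = 0 -> killed f i.
Proof.
move=> f0 u v su sN.
have suv : size (u ++ v) = N by rewrite size_cat; lia.
have := hom_value_cup f su suv; rewrite f0 hom_value0 => /esym/eqP.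
by rewrite addrC addr_eq0 -mulNr => /eqP.
Qed.

(** ** Symmetrizing functionals *)

(** The sum of the values of [F] on the words of length [M] with [j] zeros,
    weighted by the power of [- q^-1] that counts the inversions: a matrix
    coefficient of the [j]-th divided power of the raising operator. *)
Fixpoint weighted_sum (M j : nat) (F : seq bool -> K) : K :=
  if M is M'.+1 then
    (if j is j'.+1 then weighted_sum M' j' (fun s => F (false :: s)) else 0)
      + sigma ^+ j * weighted_sum M' j (fun s => F (true :: s))
  else if j is 0%N then F [::] else 0.

Definition killed_fun M (F : seq bool -> K) := forall u v : seq bool,
  (size u + size v + 2 = M)%N ->
  F (u ++ [:: true, false & v]) = sigma * F (u ++ [:: false, true & v]).

Lemma killed_cons M F x : killed_fun M.+1 F -> killed_fun M (fun s => F (x :: s)).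
Proof. by move=> H u v sM; apply: (H (x :: u) v); rewrite /= addSn addSn sM. Qed.

Lemma killed_move M F j u v : killed_fun M F -> (size u + j + size v + 1 = M)%N ->
  F (u ++ true :: nseq j false ++ v) = sigma ^+ j * F (u ++ nseq j false ++ true :: v).
Proof.
move=> H; elim: j u => [|j IHj] u sM; first by rewrite mul1r.
rewrite [nseq _ _]/= -[(false :: _) ++ v]/(false :: (nseq j false ++ v)).
rewrite H; last by rewrite size_cat size_nseq; lia.
by rewrite -cat_rcons IHj ?size_rcons ?cat_rcons ?exprS ?mulrA //; lia.
Qed.

(** Sorting a word gives the same weight a second time, whence [sigma ^+ 2]. *)
Lemma weighted_sum_killed M j F : killed_fun M F ->
  weighted_sum M j F = qbin (sigma ^+ 2) M j * F (nseq j false ++ nseq (M - j) true).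
Proof.
elim: M j F => [|M IHM] j F H; first by case: j => [|j]; rewrite /= ?mul1r ?mul0r.
rewrite /= mulrDl; congr (_ + _).
  by case: j => [|j]; rewrite ?mul0r // IHM //; exact: killed_cons.
rewrite IHM; last exact: killed_cons.
have [lt|le] := ltnP M j; first by rewrite qbin_gt // !(mul0r, mulr0).
rewrite (killed_move (u := [::]) H); last by rewrite size_nseq /=; lia.
rewrite cat0s -[true :: _]/(nseq (M - j).+1 true) -subSn // -exprM mulnC exprM.
by rewrite expr2; ring.
Qed.

Lemma weighted_sum_0 M F : weighted_sum M 0 F = F (nseq M true).
Proof. by elim: M F => //= M IHM F; rewrite IHM add0r mul1r. Qed.

Lemma weighted_sum_1 M F : weighted_sum M.+1 1 F
  = weighted_sum M 0 (fun s => F (false :: s)) + sigma * weighted_sum M 1 (fun s => F (true :: s)).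
Proof. by []. Qed.

Lemma weighted_sum_scale M j c F F' : (forall s, size s = M -> F s = c * F' s) ->
  weighted_sum M j F = c * weighted_sum M j F'.
Proof.
elim: M j F F' => [|M IHM] j F F' H.
  by case: j => [|j] /=; rewrite ?mulr0 ?H.
rewrite /= mulrDr mulrCA; congr (_ + _ * _).
  by case: j => [|j]; rewrite ?mulr0 //; apply: IHM => s sM; apply: H; rewrite /= sM.
by apply: IHM => s sM; apply: H; rewrite /= sM.
Qed.

Lemma weighted_sum_sum (I : finType) M j (a : I -> K) (F : I -> seq bool -> K) :
  weighted_sum M j (fun s => \sum_i a i * F i s) = \sum_i a i * weighted_sum M j (F i).
Proof.
elim: M j F => [|M IHM] j F.
  by case: j => [|j] //=; rewrite big1 // => i _; rewrite mulr0.
rewrite /= (IHM j (fun i s => F i (true :: s))) mulr_sumr.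
have -> : (if j is j'.+1 then weighted_sum M j' (fun s => \sum_i a i * F i (false :: s)) else 0)
  = \sum_i a i * (if j is j'.+1 then weighted_sum M j' (fun s => F i (false :: s)) else 0).
  case: j => [|j]; first by rewrite big1 // => i _; rewrite mulr0.
  exact: (IHM j (fun i s => F i (false :: s))).
by rewrite -big_split; apply: eq_bigr => i _ /=; rewrite mulrDr; congr (_ + _); ring.
Qed.

(** An arc between neighbouring letters contributes [F (01) + sigma F (10)], and
    [sigma q = - 1]. *)
Lemma weighted_sum_arc M i j F : (i + 2 <= M)%N ->
    (forall u v x, size u = i -> (i + 2 + size v = M)%N -> F (u ++ [:: x, x & v]) = 0) ->
    (forall u v, size u = i -> (i + 2 + size v = M)%N ->
       F (u ++ [:: true, false & v]) = q * F (u ++ [:: false, true & v])) ->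
  weighted_sum M j F = 0.
Proof.
elim: i M j F => [|i IHi] [|M] j F // leM Hxx Hxy; last first.
  have {}IHi x j' : weighted_sum M j' (fun s => F (x :: s)) = 0.
    apply: IHi => [|u v y su sM|u v su sM]; first by lia.
      by apply: (Hxx (x :: u) v y); rewrite /= ?su; lia.
    by apply: (Hxy (x :: u) v); rewrite /= ?su; lia.
  by rewrite /= IHi mulr0 addr0; case: j.
case: M leM Hxx Hxy => [|M] // leM Hxx Hxy.
have zero x j' : weighted_sum M j' (fun s => F [:: x, x & s]) = 0.
  rewrite (@weighted_sum_scale M j' 0 _ (fun=> 0)) ?mul0r // => s sM.
  by rewrite (Hxx [::]) ?mul0r //= sM.
have swap j' : weighted_sum M j' (fun s => F [:: true, false & s])
    = q * weighted_sum M j' (fun s => F [:: false, true & s]).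
  by apply: weighted_sum_scale => s sM; apply: (Hxy [::]); rewrite //= sM.
case: j => [|j] /=; first by rewrite zero !(mulr0, addr0).
rewrite zero swap mulr0 addr0.
have -> : (if j is j'.+1 then weighted_sum M j' (fun s => F [:: false, false & s]) else 0) = 0.
  by case: j.
by rewrite exprSr; field.
Qed.

(** The zeros at the first [p] positions leave room for an arc between neighbours
    after them, by [suffix_adjacent_arc]; it makes the sum vanish. *)
Lemma weighted_sum_hom_value N (f : TLhom K N 0) p j : (p < N - p)%N ->
  weighted_sum (N - p) j (fun s => hom_value f (nseq p false ++ s)) = 0.
Proof.
move=> lt; rewrite /hom_value weighted_sum_sum big1 // => D _.
have [z pz zE] := suffix_adjacent_arc D lt.
suff -> : weighted_sum (N - p) j (fun s => value D (nseq p false ++ s)) = 0 by rewrite mulr0.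
case: N {f} D lt z pz zE => [|[|N]] D lt z pz zE; [by case: z {pz zE}|by have := ltn_ord (mate D z); lia|].
have zN : (z < N.+1)%N by have := ltn_ord (mate D z); rewrite zE.
pose i := Ordinal zN.
have zl : z = cup_left i by apply: val_inj; rewrite [RHS]cup_leftE.
have E : mate D (cup_left i) = cup_right i.
  by apply: val_inj; rewrite -zl [RHS]cup_rightE.
have wE u v a b : size u = (z - p)%N -> (z - p + 2 + size v = N.+2 - p)%N ->
  value D (nseq p false ++ u ++ [:: a, b & v])
    = if a == b then 0 else q ^+ a * value (glue (cup i) D) ((nseq p false ++ u) ++ v).
  move=> su sv; rewrite catA; apply: value_adjacent => //.
    by rewrite size_cat size_nseq su /=; lia.
  by rewrite !size_cat size_nseq su; lia.
apply: (weighted_sum_arc (i := z - p)); first by lia.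
  by move=> u v x su sv; rewrite wE // eqxx.
by move=> u v su sv; rewrite !wE // /= expr1 mul1r.
Qed.

(** ** Morphisms annihilated by cups *)

Lemma killed_sort M F s : killed_fun M F -> size s = M ->
  exists e, F s = sigma ^+ e * F (nseq (count negb s) false ++ nseq (count id s) true).
Proof.
elim: s M F => [|x s IHs] M F H sM; first by exists 0%N; rewrite mul1r.
case: M H sM => // M H [sM].
have [e ->] := IHs M _ (@killed_cons _ _ x H) sM.
case: x; last by exists e.
exists (e + count negb s)%N; rewrite (killed_move (u := [::]) H) /=.
  by rewrite exprD mulrA.
by rewrite size_nseq -sM -(count_predC negb s) (eq_count (a1 := predC negb) (a2 := id)) /=;
  [lia|case].
Qed.

Lemma killed_all N (f : TLhom K N 0) :
  (forall i, (i.+2 <= N)%N -> killed f i) -> killed_fun N (hom_value f).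
Proof. by move=> H u v sN; apply: H => //; lia. Qed.

(** Up to a factor, the values of [f] are the powers of [sigma] that count
    inversions. The divided powers of the raising operator send them to Gaussian
    binomials, but annihilate all diagrams. *)
Theorem killed_qbin N (f : TLhom K N 0) :
    f != 0 -> (forall i, (i.+2 <= N)%N -> killed f i) ->
  exists k, [/\ N = k.*2, hom_value f (nseq k false ++ nseq k true) != 0
    & forall j, (0 < j <= k)%N -> qbin (sigma ^+ 2) (k + j) j = 0].
Proof.
move=> f0 /killed_all H; have [s sN fs] := hom_value_inj f0.
have bal := hom_value_balanced sN fs; set k := count negb s in bal.
have Nk : N = k.*2.
  by rewrite -sN -(count_predC negb s) (eq_count (a1 := predC negb) (a2 := id)) ?bal ?addnn //; case.
have fk : hom_value f (nseq k false ++ nseq k true) != 0.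
  have [e E] := killed_sort H sN; move: fs; rewrite E bal -/k mulf_eq0 negb_or.
  by case/andP.
exists k; split=> // j /andP[j0 jk].
have lt : (k - j < N - (k - j))%N by lia.
have := weighted_sum_hom_value f j lt; rewrite weighted_sum_killed; last first.
  move=> u v suv; rewrite !catA; apply: H; rewrite size_cat size_nseq; lia.
have -> : (N - (k - j) = k + j)%N by lia.
rewrite addnK catA -nseqD subnK // => /eqP.
by rewrite mulf_eq0 (negbTE fk) orbF => /eqP.
Qed.

(** ** Morphisms annihilated by all cups but the middle one *)

Definition killed_sides j (y : TLhom K j.*2 0) :=
  forall i, (i.+2 <= j.*2)%N -> i.+1 != j -> killed y i.

Definition contract_middle j (y : TLhom K j.+1.*2 0) : TLhom K j.*2 0 :=
  TLcomp d y (basis_hom K (cup (middle j))).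

Lemma hom_value_contract_middle j (y : TLhom K j.+1.*2 0) u v :
    size u = j -> (size u + size v = j.*2)%N ->
  hom_value (contract_middle y) (u ++ v)
    = q^-1 * hom_value y (u ++ [:: false, true & v]) + hom_value y (u ++ [:: true, false & v]).
Proof. by move=> su suv; apply: hom_value_cup; rewrite ?middleE ?size_cat. Qed.

Lemma hom_value_contract_sorted j (y : TLhom K j.+1.*2 0) :
  hom_value (contract_middle y) (nseq j false ++ nseq j true)
    = q^-1 * hom_value y (nseq j.+1 false ++ nseq j.+1 true)
      + hom_value y (nseq j false ++ [:: true, false & nseq j true]).
Proof. by rewrite hom_value_contract_middle ?size_nseq ?addnn // -cat_nseq_cons. Qed.

Lemma killed_sides_contract j (y : TLhom K j.+1.*2 0) :
  killed_sides y -> killed_sides (contract_middle y).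
Proof.
move=> Hk a aj anj u v su suv.
have [le|lt] := leqP (a.+2) j.
  have sv : (j - a.+2 <= size v)%N by lia.
  have E x z : u ++ [:: x, z & v]
      = (u ++ [:: x, z & take (j - a.+2) v]) ++ drop (j - a.+2) v.
    by rewrite -catA /= cat_take_drop.
  have szt : size (take (j - a.+2) v) = (j - a.+2)%N by rewrite size_takel.
  have szd : size (drop (j - a.+2) v) = (size v - (j - a.+2))%N by rewrite size_drop.
  rewrite !E !hom_value_contract_middle; try by rewrite ?size_cat /= szt ?szd; lia.
  rewrite -!catA /=.
  have kl w : size w = (size v).+2 ->
    hom_value y (u ++ [:: true, false & w]) = sigma * hom_value y (u ++ [:: false, true & w]).
    by move=> sw; apply: (Hk a); rewrite ?su ?sw; lia.
  have szw x z : size (take (j - a.+2) v ++ [:: x, z & drop (j - a.+2) v]) = (size v).+2.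
    by rewrite size_cat /= szt szd; lia.
  by rewrite !kl ?szw //; ring.
have E x z : u ++ [:: x, z & v] = take j u ++ (drop j u ++ [:: x, z & v]).
  by rewrite catA cat_take_drop.
have szt : size (take j u) = j by rewrite size_takel //; lia.
have szd : size (drop j u) = (size u - j)%N by rewrite size_drop.
rewrite !E !hom_value_contract_middle; try by rewrite ?size_cat /= szt ?szd; lia.
have kl x z : hom_value y (take j u ++ [:: x, z & drop j u ++ [:: true, false & v]])
    = sigma * hom_value y (take j u ++ [:: x, z & drop j u ++ [:: false, true & v]]).
  rewrite -!cat_cons !catA; apply: (Hk a.+2); rewrite ?size_cat /= ?szt ?szd; lia.
by rewrite !kl; ring.
Qed.

(** The weighted sum over the words [0^j t] with a single zero in [t] vanishes. Its
    first term belongs to the sorted word; in the others the cups on the right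
    half sort the letters after the position [j]. *)
Lemma middle_relation j (y : TLhom K j.+1.*2 0) : killed_sides y ->
  hom_value y (nseq j.+1 false ++ nseq j.+1 true)
    + sigma * (qbin (sigma ^+ 2) j.+1 1
               * hom_value y (nseq j false ++ [:: true, false & nseq j true])) = 0.
Proof.
move=> Hk; have lt : (j < j.+1.*2 - j)%N by lia.
have := weighted_sum_hom_value y 1 lt; have -> : (j.+1.*2 - j = j.+2)%N by lia.
rewrite weighted_sum_1 weighted_sum_0.
have -> : nseq j false ++ false :: nseq j.+1 true = nseq j.+1 false ++ nseq j.+1 true.
  exact: cat_nseq_cons.
rewrite weighted_sum_killed ?subn1 // => u v suv.
have E x z : nseq j false ++ true :: (u ++ [:: x, z & v])
    = (nseq j false ++ true :: u) ++ [:: x, z & v] by rewrite -catA.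
have sz : size (nseq j false ++ true :: u) = (j + (size u).+1)%N.
  by rewrite size_cat size_nseq.
by rewrite !E; apply: (Hk (j + (size u).+1)%N); rewrite ?sz //; lia.
Qed.

(** By [middle_relation] the value on [0^j 10 1^j] vanishes as well, so that the
    contraction of [y] at the middle cup satisfies the same hypotheses and is
    zero by induction. Then all cups annihilate [y], and the sorted word decides. *)
Theorem killed_sides_eq0 j (y : TLhom K j.*2 0) :
    killed_sides y -> hom_value y (nseq j false ++ nseq j true) = 0 ->
    (forall m, (0 < m <= j)%N -> qbin (sigma ^+ 2) m 1 != 0) ->
  y = 0.
Proof.
elim: j y => [|j IHj] y Hk y0 Hq.
  apply/eqP/negPn/negP => ny; have [] := killed_qbin ny; first by [].
  by case=> [|k] [] // _; rewrite y0 eqxx.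
have h0 : hom_value y (nseq j false ++ [:: true, false & nseq j true]) = 0.
  have := middle_relation Hk; rewrite y0 add0r => /eqP.
  have q1 : qbin (sigma ^+ 2) j.+1 1 != 0 by apply: Hq; lia.
  by rewrite !mulf_eq0 (negbTE sigma_neq0) (negbTE q1) => /eqP.
(* The sorted value of the contraction is a combination of those on the two words
   [0^j 01 1^j] and [0^j 10 1^j]. *)
have y'0 : contract_middle y = 0.
  apply: IHj; [exact: killed_sides_contract| |by move=> m mj; apply: Hq; lia].
  by rewrite hom_value_contract_sorted y0 h0 mulr0 addr0.
apply/eqP/negPn/negP => ny; have [a aN|k [kE]] := killed_qbin ny.
  have [aj|] := eqVneq a.+1 j.+1; last exact: Hk.
  have -> : a = middle j :> nat by rewrite middleE; lia.
  exact: (@cup_killed j.*2 (middle j)).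
have -> : k = j.+1 by lia.
by rewrite y0 eqxx.
Qed.

End Words.

(** * Diagrams without arcs between top points *)

(** Strands from top to bottom cannot cross, so they are increasing. *)
Lemma through_id p (D : diagram p p) (phi : 'I_p -> 'I_p) :
  (forall i, partner D (inl i) = inr (phi i)) -> D = id_diagram p.
Proof.
move=> E.
have phi_inj : injective phi.
  by move=> i j ij; apply: (@inl_inj _ 'I_p); apply: (@partner_inj _ _ D); rewrite !E ij.
have mono (i j : 'I_p) : (i < j)%N -> (phi i < phi j)%N.
  move=> ij; have := partner_noncrossing D (inl i) (inl j).
  rewrite !E /= ij /=; have := ltn_ord j; have := ltn_ord (phi i); have := ltn_ord (phi j).
  have : (phi i : nat) <> phi j by move=> /val_inj/phi_inj e; rewrite e ltnn in ij.
  lia.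
have ge (i : 'I_p) : (i <= phi i)%N.
  case: i => i; elim: i => // i IHi lt.
  have lt' : (i < p)%N by lia.
  by have := IHi lt'; have := mono (Ordinal lt') (Ordinal lt) (ltnSn i); simpl; lia.
have phiE i : phi i = i.
  have sum_eq : (\sum_(j < p) (phi j - j) = 0)%N.
    rewrite sumnB // [X in (_ - X)%N](reindex_inj phi_inj).
    by rewrite subnn.
  apply: val_inj; move/eqP: sum_eq; rewrite sum_nat_eq0 => /forallP/(_ i) /=.
  by have := ge i; lia.
apply: diagram_ext => x; rewrite partner_id; case: x => i; first by rewrite E phiE.
by rewrite -[in LHS](phiE i) -E partnerK.
Qed.

(** Without arcs on the top edge all strands are vertical. *)
Lemma top_arc_or_id N (D : diagram N.+2 N.+2) : D = id_diagram N.+2 \/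
  exists i : 'I_N.+1, partner D (cap_left N.+2 i) = cap_right N.+2 i.
Proof.
have [/existsP[x /existsP[y /eqP E]]|/existsPn H] :=
  boolP [exists x : 'I_N.+2, exists y : 'I_N.+2, partner D (inl x) == inl y]; last first.
  left; pose phi i := if partner D (inl i) is inr j then j else i.
  apply: (@through_id _ _ phi) => i; rewrite /phi; case F : (partner D (inl i)) => [j|j] //.
  by have /existsPn/(_ j) := H i; rewrite F eqxx.
right; wlog lt : x y E / (x < y)%N => [W|].
  have [|le] := ltnP x y; first exact: W.
  apply: (W y x); first by rewrite -E partnerK.
  rewrite ltn_neqAle le andbT; apply/eqP=> /val_inj yx.
  by have := partner_neq D (inl x); rewrite E yx eqxx.
have [z [z' [_ zz' F]]] := adjacent_top_arc E lt.
have zN : (z < N.+1)%N by have := ltn_ord z'; lia.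
exists (Ordinal zN).
have -> : cap_left N.+2 (Ordinal zN) = inl z.
  by rewrite /cap_left; congr inl; apply: val_inj; rewrite [LHS]cup_leftE.
have -> // : cap_right N.+2 (Ordinal zN) = inl z'.
by rewrite /cap_right; congr inl; apply: val_inj; rewrite [LHS]cup_rightE; exact: esym zz'.
Qed.

(** ** Bending half of the points *)

(** The points of the left half of the top edge of a [(2 k, 0)]-diagram, of which
    [r] have not been bent yet. *)
Definition left_part m n (r : nat) (x : point m n) : bool :=
  match x with inl i => (i < r)%N | inr _ => true end.

Definition separated m n (r : nat) (D : diagram m n) :=
  forall x, left_part r (partner D x) = ~~ left_part r x.

Lemma left_part_bend m n r (x : point m.+1 n) :
  left_part r (bend_point x) = left_part r.+1 x.
Proof. by case: x => [i|j] //=; case: unliftP => [i' ->|->]. Qed.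

Lemma separated_bend m n r (D : diagram m.+1 n) :
  separated r.+1 D -> separated r (bend D).
Proof.
move=> H x; rewrite partner_bend left_part_bend H -left_part_bend.
by rewrite unbend_pointK.
Qed.

Lemma separated0_card m n (D : diagram m n) : separated 0 D -> m = n.
Proof.
move=> H.
have E : (\sum_(x : point m n) (left_part 0 x : nat) = \sum_(x : point m n) (~~ left_part 0 x : nat))%N.
  by rewrite (reindex_inj (@partner_inj _ _ D)); apply: eq_bigr => x _; rewrite H.
move: E; rewrite !big_sumType /= !sum_nat_const !card_ord; lia.
Qed.

Lemma separated0_id m (D : diagram m m) : separated 0 D -> D = id_diagram m.
Proof.
move=> H; pose phi i := if partner D (inl i) is inr j then j else i.
apply: (@through_id _ _ phi) => i; rewrite /phi.
by have := H (inl i); case: (partner D _).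
Qed.

(** * Ideals *)

Section Ideals.
Variables (K : fieldType) (q : K).
Hypothesis q_neq0 : q != 0.
Local Notation d := (q + q^-1).
Local Notation sigma := (- q^-1).
Local Notation qb := (qbin (sigma ^+ 2)).

Section OneIdeal.
Variables (J : hom_family K) (idJ : is_ideal d J).

Lemma ideal_sum m n (I : finType) (F : I -> TLhom K m n) (P : pred I) :
  (forall i, P i -> J (F i)) -> J (\sum_(i | P i) F i).
Proof.
move=> H; apply: (big_ind (fun f => J f)) => //; first exact: ideal_zero idJ _ _.
by move=> f g; apply: (ideal_add idJ).
Qed.

Lemma ideal_unbend_all m n (f : TLhom K m n) : J f -> f != 0 ->
  exists N (g : TLhom K N 0), J g /\ g != 0.
Proof.
elim: n m f => [|n IHn] m f Jf f0; first by exists m, f.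
apply: (IHn _ (unbendh f)); first exact: (ideal_unbend idJ).
by apply: contra_neq f0 => E; rewrite -[f]unbendhK E; apply/ffunP => c; rewrite !ffunE.
Qed.

Lemma minimal_element : nonzero_family J ->
  exists N (f : TLhom K N 0), [/\ J f, f != 0
    & forall M (g : TLhom K M 0), (M < N)%N -> J g -> g = 0].
Proof.
move=> [m [n [f0 [Jf0 /eqP nz0]]]].
have [N0 [f {f0 nz0 Jf0}]] := ideal_unbend_all Jf0 nz0; move: {m n}N0 f.
suff H b : forall N (f : TLhom K N 0), (N <= b)%N -> J f /\ f != 0 ->
    exists N (f : TLhom K N 0), [/\ J f, f != 0
      & forall M (g : TLhom K M 0), (M < N)%N -> J g -> g = 0].
  by move=> N f; apply: (H N).
elim: b => [|b IHb] N f Nb [Jf nz].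
  by exists N, f; split=> // M g; lia.
have [[M [g [MN [Jg ng]]]]|none] := classic (exists M (g : TLhom K M 0), (M < N)%N /\ J g /\ g != 0).
  by apply: (IHb M g) => //; lia.
exists N, f; split=> // M g MN Jg; apply/eqP/negPn/negP => ng.
by apply: none; exists M, g.
Qed.

(** Composing a nonzero element of minimal size with a cup gives a smaller one,
    that is zero. *)
Lemma minimal_element_qbin : nonzero_family J ->
  exists k (f : TLhom K k.*2 0), [/\ J f,
    hom_value q f (nseq k false ++ nseq k true) != 0,
    forall j, (0 < j <= k)%N -> qb (k + j) j = 0
    & forall M (g : TLhom K M 0), (M < k.*2)%N -> J g -> g = 0].
Proof.
move=> /minimal_element[N [f [Jf nz minN]]].
have kf i : (i.+2 <= N)%N -> killed q f i.
  case: N f Jf nz minN => [|[|N]] f Jf nz minN // iN.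
  have iN' : (i < N.+1)%N by lia.
  apply: (@cup_killed _ _ q_neq0 _ (Ordinal iN')); apply: minN; first by lia.
  exact: (ideal_comp_l idJ).
have [k [Nk fk H]] := killed_qbin q_neq0 nz kf; subst N.
by exists k, f; split.
Qed.

Lemma ideal_bend_separated r m n (f : TLhom K (r + m) n) D :
    J f -> f D != 0 -> separated r D ->
  exists n' (g : TLhom K m n') D', [/\ J g, g D' != 0 & separated 0 D'].
Proof.
elim: r n f D => [|r IHr] n f D Jf fD sD; first by exists n, f, D.
apply: (IHr n.+1 (bendh f) (bend D)); first exact: (ideal_bend idJ).
  by rewrite ffunE bendK.
exact: separated_bend.
Qed.

(** A diagram that does not vanish on the sorted word matches the left half with
    the right half; bending the left half makes it the identity. *)
Lemma ideal_identity_coefficient k (f : TLhom K k.*2 0) : J f ->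
    hom_value q f (nseq k false ++ nseq k true) != 0 ->
  exists g : TLhom K k k, J g /\ g (id_diagram k) != 0.
Proof.
rewrite -addnn in f * => Jf.
have [/existsP[D /andP[fD wD]]|/existsPn H] := boolP [exists D, (f D != 0) &&
    (diagram_value q D (nseq k false ++ nseq k true) != 0)]; last first.
  rewrite /hom_value big1 ?eqxx // => D _; have := H D.
  by rewrite negb_and !negbK => /orP[]/eqP->; rewrite ?mul0r ?mulr0.
move=> _; have sD : separated k D.
  have opp (i : 'I_(k + k)) : (mate D i < k)%N = ~~ (i < k)%N.
    move: wD; rewrite /diagram_value; case: ifP => [/forallP/(_ i)|_]; last by rewrite eqxx.
    have nthE (j : 'I_(k + k)) : nth false (nseq k false ++ nseq k true) j = ~~ (j < k)%N.
      rewrite nth_cat size_nseq !nth_nseq; have := ltn_ord j.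
      by move=> jk; case lt: (j < k)%N => //=; have -> : (j - k < k)%N by lia.
    by rewrite !nthE => + _; case: (i < k)%N; case: (mate D i < k)%N.
  by move=> [i|[]//]; rewrite partner_mate /= opp.
have [n' [g [D' [Jg gD' sD']]]] := ideal_bend_separated Jf fD sD.
have nk := separated0_card sD'; subst n'.
by exists g; rewrite -(separated0_id sD').
Qed.

Lemma full_of_unit (f : TLhom K 0 0) : J f -> hom_value q f [::] != 0 ->
  forall m n (g : TLhom K m n), J g.
Proof.
move=> Jf fk; apply: (ideal_full idJ).
have f1 : f (id_diagram 0) != 0.
  apply: contraNneq fk => f1; rewrite /hom_value big1 // => D _.
  by rewrite (diagram00 D (id_diagram 0)) f1 mul0r.
suff -> : basis_hom K (id_diagram 0) = (f (id_diagram 0))^-1 *: f by apply: (ideal_scale idJ).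
apply/ffunP => c; rewrite !ffunE (diagram00 c (id_diagram 0)) eqxx.
by rewrite /GRing.scale /= mulVf.
Qed.

End OneIdeal.

(** A minimal element of an ideal lives in [Hom(0, 0)], because the Gaussian
    integers do not vanish. *)
Theorem generic_no_ideal : (forall m, (0 < m)%N -> qb m 1 != 0) ->
  forall J : hom_family K, ~ nonzero_proper_ideal d J.
Proof.
move=> Hq J [idJ nzJ [m0 [n0 [f0 nJ]]]].
have [[|k] [f [Jf fk H _]]] := minimal_element_qbin idJ nzJ; last first.
  by have /eqP := H 1 isT; rewrite (negbTE (Hq _ _)) // addn1.
by apply: nJ; apply: (full_of_unit idJ Jf fk).
Qed.

End Ideals.

Lemma rainbow_ex p : {R : diagram p.*2 0 |
  forall i : 'I_p.*2, mate R i = rev_ord i}.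
Proof.
pose f (x : point p.*2 0) : point p.*2 0 :=
  match x with inl i => inl (rev_ord i) | inr j => inr j end.
have [R RE] : {R : diagram p.*2 0 | partner R =1 f}.
  apply: diagram_of => [[i|[]//]|[i|[]//]|[i|[]//] [j|[]//]] /=.
  - apply/eqP=> -[/(congr1 (@nat_of_ord _))] /=; have := ltn_ord i; lia.
  - by rewrite rev_ordK.
  - by have := ltn_ord i; have := ltn_ord j; lia.
by exists R => i; rewrite /mate RE.
Qed.

Definition rainbow p := sval (rainbow_ex p).

Lemma mate_rainbow p (i : 'I_p.*2) : mate (rainbow p) i = rev_ord i.
Proof. exact: (svalP (rainbow_ex p)). Qed.

(** * The parameter at a root of unity *)

Section RootOfUnity.
Variables (K : fieldType) (q : K).
Hypothesis q_neq0 : q != 0.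
Local Notation d := (q + q^-1).
Local Notation sigma := (- q^-1).
Local Notation qb := (qbin (sigma ^+ 2)).
Variable N : nat.
Local Notation p := N.+2.
Local Notation n := N.+3.
Hypothesis qint_neq0 : forall m, (0 < m < n)%N -> qb m 1 != 0.
Hypothesis qint_n : qb n 1 = 0.
Hypothesis qbin_n : forall k, (n <= k)%N -> qb (k + n) n != 0.

(** [1 + q^-2 = q^-1 d] is a Gaussian integer. *)
Lemma d_neq0 : d != 0.
Proof.
have := qint_neq0 (m := 2) isT; apply: contra_neq => d0.
rewrite /= !expr1 !expr0 !mul1r !mulr0 !addr0 add0r mulr1 sqrrN.
have -> : 1 + q^-1 ^+ 2 = q^-1 * (q + q^-1) by field.
by rewrite d0 mulr0.
Qed.

Lemma idealN (J : hom_family K) m k (f : TLhom K m k) : 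
  is_ideal d J -> J m k f -> J m k (- f).
Proof. by move=> idJ Jf; rewrite -scaleN1r; apply: (ideal_scale idJ). Qed.

(** ** The lowest element of a proper ideal *)

(** A minimal element has [k] with the Gaussian integer of [k + 1] zero, hence
    [n <= k + 1], and [k < n] by [qbin_n]. *)
Lemma proper_ideal_lowest (J : hom_family K) : nonzero_proper_ideal d J ->
  (exists g : TLhom K p p, J p p g /\ g (id_diagram p) != 0)
  /\ (forall M (g : TLhom K M 0), (M < p.*2)%N -> J M 0%N g -> g = 0).
Proof.
move=> [idJ nzJ prJ]; have [k [f [Jf fk H low]]] := minimal_element_qbin q_neq0 idJ nzJ.
have k0 : (0 < k)%N.
  case: k f Jf fk H low => // f Jf fk _ _; case: prJ => m0 [n0 [f0 nJ]]; case: nJ.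
  exact: (full_of_unit idJ Jf fk).
have kn : (n <= k.+1)%N.
  rewrite leqNgt; apply/negP=> lt; have := H 1%N; rewrite k0 => /(_ isT)/eqP.
  by rewrite addn1 (negbTE (qint_neq0 _)) //; lia.
have kp : k = p.
  suff : (k < n)%N by lia.
  rewrite ltnNge; apply/negP=> le; have /eqP := H n le.
  by rewrite (negbTE (qbin_n le)).
subst k; split=> //; exact: (ideal_identity_coefficient q_neq0 idJ Jf fk).
Qed.

(** ** Every nonzero proper ideal contains the negligible morphisms *)

Section Uniqueness.
Variables (J : hom_family K).
Hypothesis J_npi : nonzero_proper_ideal d J.
Hypothesis negl_npi : nonzero_proper_ideal d (negligible d).
Let idJ : is_ideal d J := let: And3 H _ _ := J_npi in H.
Let idN := negligible_is_ideal d.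

Definition negl_sub m k := forall f : TLhom K m k, negligible d f -> J f.

Lemma negl_sub_bend m k : negl_sub m.+1 k <-> negl_sub m k.+1.
Proof.
split=> H f nf.
  by rewrite -[f]unbendhK; apply/(ideal_bend idJ)/H/(ideal_unbend idN).
by rewrite -[f]bendhK; apply/(ideal_unbend idJ)/H/(ideal_bend idN).
Qed.

Lemma negl_sub_top m k l : l = (m + k)%N -> negl_sub m k <-> negl_sub l 0.
Proof.
elim: k m => [|k IHk] m lE; first by rewrite lE addn0.
by apply: iff_trans (iff_sym (negl_sub_bend m k)) (IHk _ _); rewrite lE addnS.
Qed.

(** By induction on the number of points. Small morphisms vanish because they lie
    below the lowest element of the negligible ideal. Otherwise bend [f] to have
    [p] top points and compose it with the lowest element [g] of [J]: up to the
    coefficient of the identity, this gives [f] plus morphisms that factor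
    through a cap, and removing this cap leaves negligible morphisms with fewer
    points. *)
Lemma negligible_sub m k : negl_sub m k.
Proof.
have [[g [Jg g1]] _] := proper_ideal_lowest J_npi.
have [_ lowN] := proper_ideal_lowest negl_npi.
move: {2}(m + k)%N (erefl (m + k)%N) => l; elim/ltn_ind: l m k => l IHl m k mk.
apply/(negl_sub_top (esym mk)).
have [lt|ge] := ltnP l p.*2.
  by move=> f nf; rewrite (lowN _ f lt nf); apply: (ideal_zero idJ).
have lE : l = (p + (l - p))%N by lia.
apply/(negl_sub_top lE) => f nf; set M := (l - p)%N in lE f nf *.
pose y D : TLhom K p M := TLcomp d f (basis_hom K D).
have compE : TLcomp d f g = \sum_D g D *: y D.
  apply/ffunP => c; rewrite sum_ffunE TLcompE; apply: eq_bigr => D _.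
  by rewrite ffunE TLcompE sum_basis_hom.
have y1 : y (id_diagram p) = f.
  apply/ffunP => c; rewrite TLcompE sum_basis_hom (bigD1 c) //= glue_idl eqxx mulr1.
  rewrite nb_loops_idl expr0 mulr1 big1 ?addr0 // => b /negbTE bc.
  by rewrite glue_idl eq_sym bc !mulr0.
have Jy D : D != id_diagram p -> J (y D).
  move=> D1; have [/eqP|[i iE]] := top_arc_or_id D; first by rewrite (negbTE D1).
  have ny : negligible d (y D) by apply: (ideal_comp_l idN).
  have supp c : y D c != 0 -> partner c (cap_left M i) = cap_right M i.
    apply: contraNeq => neq; rewrite TLcompE sum_basis_hom; apply/eqP.
    rewrite big1 // => b _; case: eqP => [cE|_]; last by rewrite !mulr0.
    case/eqP: neq; rewrite cE; apply: partner_glue; first by rewrite cap_right_left.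
    apply: connect1; have := strand_upper D b (inl (cup_left i)).
    by rewrite -[inl _]/(cap_left p i) iE.
  (* All diagrams in [y D] inherit the cap of [D]. *)
  have -> : y D = d^-1 *: TLcomp d (TLcomp d (y D) (basis_hom K (cup i))) (basis_hom K (dflip (cup i))).
    apply: (scalerI d_neq0); rewrite scalerA mulfV ?d_neq0 // scale1r.
    exact: comp_cup_cap supp.
  apply/(ideal_scale idJ)/(ideal_comp_l idJ).
  by apply: (IHl (N + M)%N); [lia|by []|apply: (ideal_comp_l idN)].
have -> : f = (g (id_diagram p))^-1 *:
    (TLcomp d f g - \sum_(D | D != id_diagram p) g D *: y D).
  rewrite compE (bigD1 (id_diagram p)) //= addrK y1 scalerA mulVf // scale1r //.
apply/(ideal_scale idJ)/(ideal_add idJ); first exact: (ideal_comp_r idJ).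
apply: (idealN idJ); apply: (ideal_sum idJ) => D D1.
by apply/(ideal_scale idJ)/Jy.
Qed.

End Uniqueness.

(** ** There are nonzero negligible morphisms *)

(** If the pairing is non-degenerate, let [g] be dual to the rainbow. The rainbow
    has no cap off the middle, so that only the middle cup can be nonzero on [g];
    [g] would be a multiple of the Jones-Wenzl projection on [n - 1] strands.
    Contracting the middle gives a value on the sorted word that is a multiple
    of the Gaussian integer of [n], hence zero; so the middle cup annihilates
    [g] too, but the rainbow factors through it. *)
Lemma negligible_nonzero : nonzero_family (negligible d).
Proof.
apply: NNPP => none.
have negl0 m k (f : TLhom K m k) : negligible d f -> f = 0.
  by move=> nf; apply: NNPP => nz; apply: none; exists m, k, f.
pose T := diagram p.*2 0.
pose G : 'M[K]_#|T| := \matrix_(i, j) d ^+ nb_curves (enum_val i : T) (enum_val j).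
have G_unit : G \in unitmx.
  rewrite -row_free_unit; apply: inj_row_free => v vG.
  pose f : TLhom K p.*2 0 := [ffun a => v 0 (enum_rank a)].
  have f0 : f = 0.
    apply/negl0/negligibleP => b; rewrite /pairing.
    have := congr1 (fun w : 'rV_#|T| => w 0 (enum_rank b)) vG; rewrite mxE [RHS]mxE => E.
    rewrite -[RHS]E.
    rewrite [RHS](reindex_onto enum_rank enum_val) /=; last by move=> i _; rewrite enum_valK.
    by apply: eq_big => [a|a _]; rewrite ?enum_rankK ?eqxx // !mxE ffunE !enum_rankK.
  apply/rowP => i; have := congr1 (fun h : TLhom K p.*2 0 => h (enum_val i)) f0.
  by rewrite !ffunE enum_valK mxE.
pose R : T := rainbow p.
have mateR (j : 'I_p.*2) : mate R j = rev_ord j by apply: mate_rainbow.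
pose g : TLhom K p.*2 0 := [ffun a => invmx G (enum_rank R) (enum_rank a)].
have gE b : pairing d g b = (b == R)%:R.
  have := congr1 (fun w : 'M_#|T| => w (enum_rank R) (enum_rank b)) (mulVmx G_unit).
  rewrite !mxE (inj_eq enum_rank_inj) eq_sym => <-.
  rewrite [RHS](reindex_onto enum_rank enum_val) /=; last by move=> i _; rewrite enum_valK.
  by apply: eq_big => [a|a _]; rewrite ?enum_rankK ?eqxx // !mxE ffunE !enum_rankK.
have pairing_cup (i : 'I_(N.+1).*2.+1) b : pairing d (TLcomp d g (basis_hom K (cup i))) b
    = (glue (dflip (cup i)) b == R)%:R.
  by rewrite pairing_comp sum_basis_hom gE nb_loops_cap_glue_cup expr0 mul1r.
have kg : killed_sides q g.
  move=> i ip ne; have ip' : (i < (N.+1).*2.+1)%N by lia.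
  apply: (@cup_killed _ _ q_neq0 _ (Ordinal ip')); apply/negl0/negligibleP => b.
  rewrite pairing_cup; case: eqP => // E.
  have := partner_cap (Ordinal ip') b; rewrite E partner_mate mateR.
  move=> -[/(congr1 (@nat_of_ord _))]; rewrite /= cup_rightE cup_leftE /=.
  by move/eqP: ne; lia.
(* The sorted value of the contraction is [qb n 1] times the value on the other
   word [0^(p - 1) 10 1^(p - 1)], by [middle_relation]. *)
have g0 : contract_middle q g = 0.
  apply: (@killed_sides_eq0 _ _ q_neq0 _ _ (killed_sides_contract q_neq0 kg)); last first.
    by move=> m mN; apply: qint_neq0; lia.
  rewrite hom_value_contract_sorted //; have := middle_relation q_neq0 kg.
  move: (hom_value q g _) (hom_value q g _) => a b /eqP; rewrite addr_eq0 => /eqP->.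
  have : 1 + sigma ^+ 2 * qb N.+2 1 = 0.
    exact: etrans (esym (qbin_1S _ N.+2)) qint_n.
  move=> E; transitivity ((1 + sigma ^+ 2 * qb N.+2 1) * a).
    by ring.
  by rewrite E mul0r.
have Rmid : partner R (cap_left 0 (middle N.+1)) = cap_right 0 (middle N.+1).
  rewrite partner_mate mateR; congr inl; apply: val_inj.
  have E k : k = N.+1 -> (p.*2 - k.+1 = k.+1)%N by move=> ->; lia.
  by rewrite [RHS]cup_rightE /= cup_leftE; apply: E; apply: middleE.
have := pairing_cup (middle N.+1) (glue (cup (middle N.+1)) R).
rewrite -/(contract_middle q g) g0 glue_cap_glue_cup // eqxx => /esym/eqP.
rewrite /pairing big1 ?oner_eq0 // => a _.
by rewrite ffunE mul0r.
Qed.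

Theorem unique_ideal : nonzero_proper_ideal d (negligible d) /\
  forall J : hom_family K, nonzero_proper_ideal d J ->
    forall k m (f : TLhom K k m), J k m f <-> negligible d f.
Proof.
have npi : nonzero_proper_ideal d (negligible d).
  split; [exact: negligible_is_ideal|exact: negligible_nonzero|].
  by exists 0%N, 0%N, (basis_hom K (id_diagram 0)); apply: negligible_proper.
split=> // J npiJ k m f; split; last exact: negligible_sub.
by case: npiJ => idJ _ prJ; apply: (proper_ideal_negligible idJ prJ).
Qed.

End RootOfUnity.

Import Order.TTheory Num.Theory.

(** * Parameters *)

Lemma sqr_sigma_exp (K : fieldType) (q : K) m : (- q^-1) ^+ 2 ^+ m = (q ^+ m ^+ 2)^-1.
Proof. by rewrite sqrrN -exprM mulnC exprM !exprVn. Qed.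

(** A zero Gaussian integer makes [q ^ (2 m) = 1], so that [q ^ 2 = 1]; but then it
    is the integer [m]. *)
Lemma qint_neq0_nonroot (K : fieldType) (q : K) :
    (forall m, (0 < m)%N -> m%:R != 0 :> K) -> ~ proper_root_of_unity q ->
  forall m, (0 < m)%N -> qbin ((- q^-1) ^+ 2) m 1 != 0.
Proof.
move=> char0 nroot m m_gt0; apply/negP=> /eqP E.
have sm : ((- q^-1) ^+ 2) ^+ m = 1.
  by apply/esym/eqP; rewrite -subr_eq0 -qint_geometric E mulr0.
have qm : q ^+ (m * 2) = 1 by apply: invr_inj; rewrite exprM -sqr_sigma_exp sm invr1.
have q1 : q ^+ 2 = 1.
  apply/eqP; rewrite sqrf_eq1; apply/orP.
  have [e1|n1] := eqVneq q 1; first by left.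
  have [e2|n2] := eqVneq q (-1); first by right.
  case: nroot; split; first by exists (m * 2)%N; [lia|].
  by split; apply/eqP.
move: E; rewrite sqrrN exprVn q1 invr1 => /eqP; apply/negP.
suff -> : qbin (1 : K) m 1 = m%:R by apply: char0.
elim: m {m_gt0 sm qm} => // m IHm; by rewrite qbin_1S IHm mul1r -natr1 addrC.
Qed.

Section UnitCircle.
Variable R : realType.
Local Open Scope complex_scope.

Lemma indeterminate_not_root (k : nat) : (0 < k)%N -> indeterminate R ^+ k <> 1.
Proof.
move=> k_gt0; rewrite /indeterminate -tofracXn -tofrac1 => /eqP; rewrite tofrac_eq => /eqP.
by move=> /(congr1 (fun p : {poly R[i]} => size p)); rewrite size_polyXn size_poly1; lia.
Qed.

Lemma fraction_char0 m : (0 < m)%N -> m%:R != 0 :> {fraction {poly R[i]}}.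
Proof.
move=> m_gt0; rewrite -(rmorph_nat (@tofrac {poly R[i]})) tofrac_eq0.
by rewrite -polyC_natr polyC_eq0 pnatr_eq0 -lt0n.
Qed.

Definition unit_circle (x : R) : R[i] := cos x +i* sin x.

Lemma unit_circleD x y : unit_circle (x + y) = unit_circle x * unit_circle y.
Proof. by rewrite /unit_circle cosD sinD; simpc; congr (_ +i* _); rewrite addrC. Qed.

Lemma unit_circle0 : unit_circle 0 = 1.
Proof. by rewrite /unit_circle cos0 sin0. Qed.

Lemma unit_circleX x m : unit_circle x ^+ m = unit_circle (x *+ m).
Proof.
elim: m => [|m IHm]; first by rewrite unit_circle0.
by rewrite exprS IHm mulrS unit_circleD.
Qed.

Lemma unit_circle_neq0 x : unit_circle x != 0.
Proof.
apply/eqP=> E; have := unit_circleD x (- x); rewrite subrr unit_circle0 E mul0r.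
by move/eqP; rewrite oner_eq0.
Qed.

Lemma unit_circleV x : (unit_circle x)^-1 = unit_circle (- x).
Proof.
apply: (mulfI (unit_circle_neq0 x)); rewrite mulfV ?unit_circle_neq0 //.
by rewrite -unit_circleD subrr unit_circle0.
Qed.

Lemma unit_circle_trace x : unit_circle x + (unit_circle x)^-1 = (2 * cos x)%:C.
Proof.
rewrite unit_circleV /unit_circle cosN sinN; simpc.
by congr (_ +i* _); rewrite ?subrr // mulr_natl mulr2n.
Qed.

(** The imaginary part [sin (m pi / n)] is positive. *)
Lemma unit_circle_sqr_neq1 n m : (0 < m < n)%N ->
  (unit_circle (pi / n%:R) ^+ m) ^+ 2 != 1.
Proof.
move=> /andP[m0 mn]; rewrite sqrf_eq1 unit_circleX.
have n0 : (0 : R) < n%:R by rewrite ltr0n; lia.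
have : 0 < sin (pi / n%:R *+ m : R).
  apply: sin_gt0_pi; rewrite pmulrn_lgt0 // divr_gt0 ?pi_gt0 //=.
  rewrite -mulr_natr mulrAC ltr_pdivrMr // ltr_pM2l ?pi_gt0 // ltr_nat //.
rewrite /unit_circle !eq_complex /= => lt.
by rewrite oppr0 (gt_eqF lt) !andbF.
Qed.

Lemma unit_circle_expn n : (0 < n)%N -> unit_circle (pi / n%:R) ^+ n = -1.
Proof.
move=> n0; have E : pi / n%:R *+ n = pi :> R.
  by rewrite -[LHS]mulr_natr divfK // pnatr_eq0 -lt0n.
rewrite unit_circleX E.
by rewrite /unit_circle cospi sinpi; apply/eqP; rewrite eq_complex /= oppr0 !eqxx.
Qed.

End UnitCircle.

Local Open Scope complex_scope.

Theorem theorem0p1 (R : realType) :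
  [/\ (forall J : hom_family {fraction {poly R[i]}},
         ~ nonzero_proper_ideal (loop_parameter (indeterminate R)) J),
      (forall tau : R[i], tau <> 0 -> ~ proper_root_of_unity tau ->
         forall J : hom_family R[i],
           ~ nonzero_proper_ideal (loop_parameter tau) J)
    & (forall n : nat, (3 <= n)%N ->
         let d : R[i] := (2 * cos (pi / n%:R))%:C in
         nonzero_proper_ideal d (negligible d) /\
         (forall J : hom_family R[i], nonzero_proper_ideal d J ->
            forall (k m : nat) (f : TLhom R[i] k m),
              J k m f <-> negligible d f))].
Proof.
have charC m : (0 < m)%N -> m%:R != 0 :> R[i] by rewrite pnatr_eq0 lt0n.
split.
- apply: generic_no_ideal; first by rewrite /indeterminate tofrac_eq0 polyX_eq0.
  apply: qint_neq0_nonroot => [m|[[k k0 E] _]]; first exact: fraction_char0.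
  exact: indeterminate_not_root k0 E.
- move=> tau /eqP tau0 nroot; apply: generic_no_ideal => //.
  exact: qint_neq0_nonroot.
case=> [|[|[|N]]] // _ d.
pose q := unit_circle (pi / N.+3%:R : R); pose s := (- q^-1) ^+ 2.
have dE : d = q + q^-1 by rewrite unit_circle_trace.
have s_neq1 m : (0 < m < N.+3)%N -> s ^+ m != 1.
  move=> mn; rewrite /s sqr_sigma_exp; apply: contra_neq (unit_circle_sqr_neq1 R mn) => E.
  by apply: invr_inj; rewrite E invr1.
have s_n : s ^+ N.+3 = 1.
  by rewrite /s sqr_sigma_exp unit_circle_expn // sqrrN !expr1n invr1.
have qint0 m : (0 < m < N.+3)%N -> qbin s m 1 != 0.
  move=> mn; apply/eqP=> E; have := qint_geometric s m; rewrite E mulr0 => /esym/eqP.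
  by rewrite subr_eq0 eq_sym (negbTE (s_neq1 m mn)).
have qintn : qbin s N.+3 1 = 0.
  have /eqP := qint_geometric s N.+3; rewrite s_n subrr mulf_eq0 subr_eq0 eq_sym.
  by rewrite -[s]expr1 (negbTE (s_neq1 1%N isT)) => /eqP.
rewrite dE; apply: (unique_ideal (unit_circle_neq0 _) qint0 qintn) => k _.
by rewrite (qbin_lucas _ s_n qint0 qintn) // charC.
Qed.
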